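(* Let $\phi$ be an even Schwartz test function such that $\operatorname{supp}(\widehat\phi)\subset[-2\sigma,2\sigma]$, with $\sigma=s/2$. Then for $2<s<3$ (so $1<\sigma<3/2$) and $\mathcal G\in\{\mathrm{SO(even)},\mathrm{O},\mathrm{SO(odd)},\mathrm{Sp}\}$, the test function which minimizes the right hand side $$\int_{-\infty}^\infty\phi(x)W_{1,\mathcal G}(x)\,dx=\int_{-\infty}^\infty\widehat\phi(y)\widehat W_{1,\mathcal G}(y)\,dy$$ of the average rank bound (recalled in the context) is given by $\widehat\phi=g_{\mathcal G,s}*\check g_{\mathcal G,s}$. Here $*$ is convolution, $\check g_{\mathcal G,s}(x)=\overline{g_{\mathcal G,s}}(-x)$, and $g_{\mathcal G,s}$ is given as follows. (i) For $\mathcal G=\mathrm{SO(even)}$: $$g_{\mathrm{SO(even)},s}(x)=\lambda_{\mathrm{SO(even)}}\begin{cases} c_1\cos\left(\frac{|x|}{\sqrt2}\right) & |x|\le s/2-1\\ \cos\left(\frac{|x|}{2}-\frac{\pi+1}{4}\right) & s/2-1\le|x|\le 2-s/2\\ \frac{c_1}{\sqrt2}\sin\left(\frac{|x|-1}{\sqrt2}\right)+c_3 & 2-s/2<|x|<s/2\\ 0 & |x|\ge s/2,\end{cases}$$ where $$c_1=\cos\left(\tfrac{\sigma-1}{2}+\tfrac14(-1-\pi)\right)\sec\left(\tfrac{\sigma-1}{\sqrt2}\right),$$ $$c_3=\sin\left(\tfrac14(2\sigma+3\pi-3)\right)+\tfrac{1}{\sqrt2}\sin\left(\tfrac14(-2\sigma+3\pi+3)\right)\tan\left(\tfrac{\sigma-1}{\sqrt2}\right),$$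 $$\lambda_{\mathrm{SO(even)}}=2\sqrt2\sin\left(\tfrac14(3-2\sigma)\right)+(\sigma-1)\sin\left(\tfrac14(-2\sigma+\pi+3)\right)+\tfrac12\sin\left(\tfrac14(2\sigma+\pi-3)\right)\left(\sqrt2(\sigma+1)\tan\left(\tfrac{\sigma-1}{\sqrt2}\right)+2\right).$$ (ii) For $\mathcal G=\mathrm{O}$: $g_{\mathrm O,s}(x)=\frac{1}{1+s/2}$ if $|x|<s/2$, and $g_{\mathrm O,s}(x)=0$ if $|x|\ge s/2$. (iii) For $\mathcal G=\mathrm{SO(odd)}$ or $\mathcal G=\mathrm{Sp}$: $$g_{\mathcal G,s}(x)=\lambda_{\mathcal G}\begin{cases} c_1\cos\left(\frac{|x|}{\sqrt2}\right) & |x|\le s/2-1\\ \cos\left(\frac{|x|}{2}+\frac{\pi-1}{4}\right) & s/2-1\le|x|\le 2-s/2\\ \frac{-c_1}{\sqrt2}\sin\left(\frac{|x|-1}{\sqrt2}\right)+c_3 & 2-s/2<|x|<s/2\\ 0 & |x|\ge s/2,\end{cases}$$ where $$c_1=\cos\left(\tfrac{1-\sigma}{2}+\tfrac{1-\pi}{4}\right)\sec\left(\tfrac{\sigma-1}{\sqrt2}\right),$$ $$c_3=\sin\left(\tfrac14(-2\sigma+3\pi+3)\right)-\tfrac{1}{\sqrt2}\sin\left(\tfrac14(2\sigma+3\pi-3)\right)\tan\left(\tfrac{\sigma-1}{\sqrt2}\right),$$ $$\lambda_{\mathrm{Sp}}=-2\sqrt2\sin\left(\tfrac14(3-2\sigma)\right)+(\sigma-1)\cos\left(\tfrac14(2\sigma+3\pi-3)\right)+\tfrac12\sin\left(\tfrac14(-2\sigma+\pi+3)\right)\left(\sqrt2(\sigma-3)\tan\left(\tfrac{\sigma-1}{\sqrt2}\right)+2\right),$$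 $$\lambda_{\mathrm{SO(odd)}}=\lambda_{\mathrm{Sp}}+4(\sigma-1)\sin\left(\tfrac14(2\sigma+\pi-3)\right)+4\sqrt2\sin\left(\tfrac14(3-2\sigma)\right)-2\sqrt2(\sigma-2)\sin\left(\tfrac14(-2\sigma+\pi+3)\right)\tan\left(\tfrac{\sigma-1}{\sqrt2}\right).$$
   Context: Fourier transform: $\widehat\phi(y)=\int_{-\infty}^{\infty}\phi(x)e^{-2\pi i xy}\,dx$. $W_{1,\mathcal G}$ is the limiting 1-level density of the classical compact group $\mathcal G$. With $\eta(u)=1,\frac12,0$ according as $|u|<1$, $|u|=1$, $|u|>1$, and $\delta_0$ the Dirac delta at $0$, its Fourier transform is $\widehat W_{1,\mathrm{SO(even)}}=\delta_0+\frac12\eta$, $\widehat W_{1,\mathrm O}=\delta_0+\frac12$, $\widehat W_{1,\mathrm{SO(odd)}}=\delta_0-\frac12\eta+1$, $\widehat W_{1,\mathrm{Sp}}=\delta_0-\frac12\eta$. The average rank bound: let $\mathcal F=\bigcup_N\mathcal F_N$ be a family of $L$-functions, with conductors tending to infinity and non-negative weights $w(f)$, whose 1-level density for the test function $\phi$ agrees with that of $\mathcal G$. Assuming the Generalized Riemann Hypothesis, for non-negative $\phi$, $$\lim_{N\to\infty}\frac{\sum_{f\in\mathcal F_N}w(f)\,\mathrm{Rank}(f)\,\phi(0)}{\sum_{f\in\mathcal F_N}w(f)}\le\int_{-\infty}^\infty\phi(x)W_{1,\mathcal G}(x)\,dx=\int_{-\infty}^\infty\widehat\phi(y)\widehat W_{1,\mathcal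 G}(y)\,dy,$$ where $\mathrm{Rank}(f)$ is the order of vanishing of $L(s,f)$ at the central point. Dividing by $\phi(0)$ bounds the average rank by $\int\phi W_{1,\mathcal G}/\phi(0)$, which is the functional the authors describe the optimal test function as minimizing. The constants $c_1,c_3,\lambda$ depend on $\mathcal G$ and $s$; $\lambda_{\mathcal G}$ is an overall scaling factor of $g_{\mathcal G,s}$.
   Formalization: The stated optimal φ is not Schwartz (its transform g*ǧ has corners), so minimality and uniqueness up to scaling of ∫φW/φ(0) are proved among continuous integrable even non-negative φ with φ(0)>0 and the same support condition; Schwartz φ come arbitrarily close to the minimum. *)

(* Defs.v *)
From mathcomp Require Import all_boot all_order all_algebra.
From mathcomp Require Import complex.
From mathcomp Require Import all_classical all_reals all_analysis.

Set Implicit Arguments.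
Unset Strict Implicit.
Unset Printing Implicit Defensive.

Import Order.TTheory GRing.Theory Num.Theory.
Import numFieldNormedType.Exports.

Local Open Scope classical_set_scope.
Local Open Scope ring_scope.
Local Open Scope complex_scope.

Section FourierTransform.
Variable R : realType.
Implicit Types (f h : R -> R[i]) (phi : R -> R).

Definition expi (t : R) : R[i] := cos t +i* sin t.

Definition cintegral f : R[i] :=
  (\int[lebesgue_measure]_x complex.Re (f x)) +i*
  (\int[lebesgue_measure]_x complex.Im (f x)).

Definition fourier phi (y : R) : R[i] :=
  cintegral (fun x => (phi x)%:C * expi (- (2 * pi * x * y))).

Definition convolution f h (x : R) : R[i] :=
  cintegral (fun t => f t * h (x - t)).

Definition check f (x : R) : R[i] := (f (- x))^*.

Definition fsupport f : set R := closure [set y | f y != 0].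

End FourierTransform.

Section TestFunctions.
Variable R : realType.
Implicit Types phi : R -> R.

Definition schwartz phi : Prop :=
  (forall (n : nat) (x : R), derivable (derive1n n phi) x 1) /\
  (forall m n : nat, exists C : R, forall x, `|x ^+ m * (derive1n n phi) x| <= C).

(* No Schwartz function attains the minimum: the Fourier transform of the
   optimal function is continuous but not smooth.
   This is the class containing both the Schwartz test functions and the
   optimal one.  Every Schwartz function is continuous and integrable, so for
   those [test_function] amounts to evenness, non-negativity, positivity at 0
   and the support condition. *)
Definition test_function (sigma : R) phi : Prop :=
  [/\ continuous phi,
      lebesgue_measure.-integrable setT (EFin \o phi),
      (forall x, phi (- x) = phi x),
      (forall x, 0 <= phi x) /\ 0 < phi 0 &
      fsupport (fourier phi) `<=` `[- (2 * sigma), 2 * sigma]].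

End TestFunctions.

Inductive classical_group := SO_even | O_full | SO_odd | Sp.

Section OneLevelDensity.
Variable R : realType.
Implicit Types (G : classical_group) (phi : R -> R) (f : R -> R[i]).

Definition eta (u : R) : R :=
  if `|u| < 1 then 1 else if `|u| == 1 then 2^-1 else 0.

(* Both W and its Fourier transform are a multiple of the Dirac delta at 0 plus
   a function, which is described by the following four definitions. *)
Definition W_delta G : R :=
  match G with SO_even => 0 | O_full => 2^-1 | SO_odd => 1 | Sp => 0 end.

(* The division by 0 at x = 0 is harmless under the integral. *)
Definition W_fun G (x : R) : R :=
  let S := sin (2 * pi * x) / (2 * pi * x) in
  match G with
  | SO_even => 1 + S | O_full => 1 | SO_odd => 1 - S | Sp => 1 - S
  end.

Definition What_delta G : R := 1.

Definition What_fun G (y : R) : R :=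
  match G with
  | SO_even => 2^-1 * eta y
  | O_full => 2^-1
  | SO_odd => - (2^-1 * eta y) + 1
  | Sp => - (2^-1 * eta y)
  end.

Definition integral_W G phi : R :=
  W_delta G * phi 0 + \int[lebesgue_measure]_x (phi x * W_fun G x).

Definition integral_What G f : R[i] :=
  (What_delta G)%:C * f 0 + cintegral (fun y => f y * (What_fun G y)%:C).

Definition rank_bound G phi : R := integral_W G phi / phi 0.

End OneLevelDensity.

Section OptimalFunction.
Variable R : realType.
Implicit Types (G : classical_group) (s x sigma : R).

Definition sec (x : R) : R := (cos x)^-1.

Definition even_c1 sigma : R :=
  cos ((sigma - 1) / 2 + 4^-1 * (- 1 - pi)) * sec ((sigma - 1) / Num.sqrt 2).

Definition even_c3 sigma : R :=
  sin (4^-1 * (2 * sigma + 3 * pi - 3))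
  + (Num.sqrt 2)^-1 * sin (4^-1 * (- 2 * sigma + 3 * pi + 3))
    * tan ((sigma - 1) / Num.sqrt 2).

Definition even_lambda sigma : R :=
  2 * Num.sqrt 2 * sin (4^-1 * (3 - 2 * sigma))
  + (sigma - 1) * sin (4^-1 * (- 2 * sigma + pi + 3))
  + 2^-1 * sin (4^-1 * (2 * sigma + pi - 3))
    * (Num.sqrt 2 * (sigma + 1) * tan ((sigma - 1) / Num.sqrt 2) + 2).

Definition odd_c1 sigma : R :=
  cos ((1 - sigma) / 2 + (1 - pi) / 4) * sec ((sigma - 1) / Num.sqrt 2).

Definition odd_c3 sigma : R :=
  sin (4^-1 * (- 2 * sigma + 3 * pi + 3))
  - (Num.sqrt 2)^-1 * sin (4^-1 * (2 * sigma + 3 * pi - 3))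
    * tan ((sigma - 1) / Num.sqrt 2).

Definition Sp_lambda sigma : R :=
  - 2 * Num.sqrt 2 * sin (4^-1 * (3 - 2 * sigma))
  + (sigma - 1) * cos (4^-1 * (2 * sigma + 3 * pi - 3))
  + 2^-1 * sin (4^-1 * (- 2 * sigma + pi + 3))
    * (Num.sqrt 2 * (sigma - 3) * tan ((sigma - 1) / Num.sqrt 2) + 2).

Definition SO_odd_lambda sigma : R :=
  Sp_lambda sigma
  + 4 * (sigma - 1) * sin (4^-1 * (2 * sigma + pi - 3))
  + 4 * Num.sqrt 2 * sin (4^-1 * (3 - 2 * sigma))
  - 2 * Num.sqrt 2 * (sigma - 2) * sin (4^-1 * (- 2 * sigma + pi + 3))
    * tan ((sigma - 1) / Num.sqrt 2).

(* In the next two definitions the formulas of the first two branches agree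
   at |x| = s / 2 - 1, so the order of the tests does not matter there. *)
Definition even_shape s x : R :=
  let sigma := s / 2 in
  if `|x| <= s / 2 - 1 then even_c1 sigma * cos (`|x| / Num.sqrt 2)
  else if `|x| <= 2 - s / 2 then cos (`|x| / 2 - (pi + 1) / 4)
  else if `|x| < s / 2 then
    even_c1 sigma / Num.sqrt 2 * sin ((`|x| - 1) / Num.sqrt 2) + even_c3 sigma
  else 0.

Definition odd_shape s x : R :=
  let sigma := s / 2 in
  if `|x| <= s / 2 - 1 then odd_c1 sigma * cos (`|x| / Num.sqrt 2)
  else if `|x| <= 2 - s / 2 then cos (`|x| / 2 + (pi - 1) / 4)
  else if `|x| < s / 2 then
    - odd_c1 sigma / Num.sqrt 2 * sin ((`|x| - 1) / Num.sqrt 2) + odd_c3 sigma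
  else 0.

Definition optimal_g G s x : R :=
  match G with
  | SO_even => even_lambda (s / 2) * even_shape s x
  | O_full => if `|x| < s / 2 then (1 + s / 2)^-1 else 0
  | SO_odd => SO_odd_lambda (s / 2) * odd_shape s x
  | Sp => Sp_lambda (s / 2) * odd_shape s x
  end.

End OptimalFunction.

(* Main.v *)
(** Let [e] be 1, 0, -1, -1 for SO(even), O, SO(odd), Sp.  Up to a constant the
    rank bound is J(phi) / phi(0), where J(phi) = u(0) + (e / 2) * (integral of u
    over [-1, 1]) and u is the Fourier transform of phi.  If u is the
    autocorrelation of a real function f supported in [-sigma, sigma], then
    phi(0) is the square of the integral of f, and J(phi) = B(f, f) with
    B(f, g) = <f, g> + e <f, K g>, K being convolution with one half of the
    indicator function of [-1, 1].  On functions supported in [-3/2, 3/2] the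
    norm of K is at most 11/12 (Schur test), so B is coercive and the quotient is
    minimal exactly at the multiples of a function f0 such that f0 + e K f0 is
    constant on its support; the piecewise trigonometric functions solve this
    equation.  A general test function is approximated by sampling u on a grid:
    u is positive definite, so by the Fejer-Riesz lemma the samples are a sum of
    two autocorrelations of finite sequences, and the resulting step functions
    are almost supported in [-sigma, sigma].  A quantitative form of coercivity
    carries both the lower bound and the uniqueness over to the limit.  Schwartz
    functions come close to the minimum because f0 can be cut off and convolved
    with a smooth bump function. *)
Require Import Defs.
From HB Require Import structures.
From mathcomp Require Import all_boot all_order all_algebra.
From mathcomp Require Import complex.
From mathcomp Require Import all_classical all_reals all_analysis.
From mathcomp Require Import measurable_realfun zify ring lra.

Set Implicit Arguments.
Unset Strict Implicit.
Unset Printing Implicit Defensive.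

Import Order.TTheory GRing.Theory Num.Theory.
Import numFieldNormedType.Exports.

Local Open Scope classical_set_scope.
Local Open Scope ring_scope.

(** * Lebesgue integral of real-valued functions *)
Section RealIntegral.
Variable R : realType.
Implicit Types (f g h : R -> R) (a b c x y : R).

(** The direct route would write a non-negative test function of exponential type as a squared
    modulus, which needs a factorization theory of entire functions. Sampling leaves only a
    factorization of polynomials, at two costs that shape the estimates. The step functions live on
    [[-w, w]] with [w] slightly above [sigma]; hence coercivity is proved on the fixed interval
    [[-3/2, 3/2]], where [sigma < 3/2] leaves room, and the failure of the Euler-Lagrange equation
    between [sigma] and [w] has to be bounded. Moreover the two sequences of step functions need not
    converge. This is harmless because the energies and the squared integrals are linear in the sum
    of the two autocorrelations, and that sum converges. The scaling factors lambda cancel in the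
    rank bound, so the proof has to show that they are nonzero. This too comes from coercivity: the
    constant in the Euler-Lagrange equation times the integral of f0 equals B(f0, f0), which is
    positive. *)

Definition int f : R := \int[@lebesgue_measure R]_x f x.
Definition L1 f : Prop := (@lebesgue_measure R).-integrable setT (EFin \o f).
Definition bounded f : Prop := exists M : R, forall x, `|f x| <= M.
Definition mfun f : Prop := measurable_fun setT f.

Lemma L1_mfun f : L1 f -> mfun f.
Proof. by move=> /integrableP[/measurable_EFinP]. Qed.

Lemma eq_int f g : f =1 g -> int f = int g.
Proof. by move=> /funext ->. Qed.

Lemma L1D f g : L1 f -> L1 g -> L1 (fun x => f x + g x).
Proof. by move=> hf hg; have := integrableD measurableT hf hg. Qed.

Lemma L1B f g : L1 f -> L1 g -> L1 (fun x => f x - g x).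
Proof. by move=> hf hg; have := integrableB measurableT hf hg. Qed.

Lemma L1Z c f : L1 f -> L1 (fun x => c * f x).
Proof. by move=> hf; have := integrableZl measurableT c hf. Qed.

Lemma L1Mb f g : L1 f -> mfun g -> bounded g -> L1 (fun x => f x * g x).
Proof.
move=> hf mg [M hM]; have := @integrableMl _ _ _ lebesgue_measure _ measurableT
  _ g hf mg; apply.
exists M; split; first exact: num_real.
by move=> y My x _; apply: (le_trans (hM x)); exact: ltW.
Qed.

Lemma L1bM f g : mfun f -> bounded f -> L1 g -> L1 (fun x => f x * g x).
Proof.
move=> mf bf hg; rewrite (_ : (fun x => _) = fun x => g x * f x).
  exact: L1Mb.
by apply/funext => x; rewrite mulrC.
Qed.

Lemma L1_abs f : L1 f -> L1 (fun x => `|f x|).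
Proof. exact: integrable_norm. Qed.

Lemma L1_le f g : mfun f -> (forall x, `|f x| <= g x) -> L1 g -> L1 f.
Proof.
move=> mf fg hg; apply: (le_integrable measurableT _ _ hg).
  exact/measurable_EFinP.
by move=> x _ /=; rewrite lee_fin (le_trans (fg x))// ler_norm.
Qed.

Lemma L1_0 : L1 (fun=> 0).
Proof. exact: integrable0. Qed.

Lemma L1_sum (I : Type) (s : seq I) (F : I -> R -> R) :
  (forall i, L1 (F i)) -> L1 (fun x => \sum_(i <- s) F i x).
Proof.
move=> hF; elim: s => [|i s IH].
  by under eq_fun do rewrite big_nil; exact: L1_0.
by under eq_fun do rewrite big_cons; exact: L1D.
Qed.

Lemma intD f g : L1 f -> L1 g -> int (fun x => f x + g x) = int f + int g.
Proof. by move=> hf hg; apply: RintegralD. Qed.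

Lemma intB f g : L1 f -> L1 g -> int (fun x => f x - g x) = int f - int g.
Proof. by move=> hf hg; apply: RintegralB. Qed.

Lemma intZ c f : L1 f -> int (fun x => c * f x) = c * int f.
Proof. by move=> hf; apply: RintegralZl. Qed.

Lemma intZr c f : L1 f -> int (fun x => f x * c) = int f * c.
Proof. by move=> hf; apply: RintegralZr. Qed.

Lemma int0 : int (fun=> 0) = 0.
Proof. by rewrite /int Rintegral_cst// mul0r. Qed.

Lemma int_sum (I : Type) (s : seq I) (F : I -> R -> R) :
  (forall i, L1 (F i)) ->
  int (fun x => \sum_(i <- s) F i x) = \sum_(i <- s) int (F i).
Proof.
move=> hF; elim: s => [|i s IH].
  by under eq_int do rewrite big_nil; rewrite big_nil int0.
under eq_int do rewrite big_cons.
by rewrite big_cons intD ?IH//; exact: L1_sum.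
Qed.

Lemma int_le f g : L1 f -> L1 g -> (forall x, f x <= g x) -> int f <= int g.
Proof. by move=> hf hg fg; apply: le_Rintegral. Qed.

Lemma int_ge0 f : (forall x, 0 <= f x) -> 0 <= int f.
Proof. by move=> f0; apply: Rintegral_ge0. Qed.

Lemma int_abs f : L1 f -> `|int f| <= int (fun x => `|f x|).
Proof. by move=> hf; apply: le_normr_Rintegral. Qed.

Lemma L1EFin f : L1 f -> (\int[@lebesgue_measure R]_x (f x)%:E)%E = (int f)%:E.
Proof.
by move=> hf; rewrite /int /Rintegral fineK//; exact: integrable_fin_num.
Qed.

(** Null sets enter as finite lists of points, since the exceptional points that occur are isolated
    ones such as the breakpoints of a piecewise formula. *)
Lemma ae_seq (s : seq R) (P : R -> Prop) : (forall x, x \notin s -> P x) ->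
  {ae @lebesgue_measure R, forall x, P x}.
Proof.
move=> h; exists [set` s]; split.
- apply: countable_measurable => //.
  exact/finite_set_countable/finite_seq.
- apply: countable_lebesgue_measure0.
  exact/finite_set_countable/finite_seq.
- by move=> x /= nP; apply: contrapT => /negP/h.
Qed.

Lemma int_ae f g (s : seq R) : mfun f -> mfun g ->
  (forall x, x \notin s -> f x = g x) -> int f = int g.
Proof.
move=> mf mg fg; rewrite /int /Rintegral; congr fine.
apply: ae_eq_integral => //; [exact/measurable_EFinP..|].
by apply: (@ae_seq s) => x xs _; rewrite fg.
Qed.

(** Translations and reflections only. Lebesgue measure is determined by half-open intervals, and a
    reflection turns []a, b]] into an interval closed on the other side, hence the two cases. *)
Lemma measure_affine (e c : R) (A : set R) : `|e| = 1 -> measurable A ->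
  pushforward (@lebesgue_measure R)
    ((fun x => e * x + c) : _ -> measurableTypeR R) A = lebesgue_measure A.
Proof.
move=> e1.
have mf : @measurable_fun _ _ (measurableTypeR R) (measurableTypeR R) setT
    (fun x : R => e * x + c).
  have : measurable_fun setT (fun x : R => e * x + c) by
    apply: measurable_funD => //; apply: measurable_funM.
  exact.
pose ff : {mfun measurableTypeR R >-> measurableTypeR R} :=
  HB.pack (fun x : R => e * x + c) (isMeasurableFun.Build _ _ _ _ _ mf).
move=> mA; apply/esym.
apply: (@lebesgue_measure_unique R (pushforward lebesgue_measure ff)) => // _ [[a b]] _ <-.
have [e0|e0] := leP 0 e.
  have {e1} ee : e = 1 by rewrite ger0_norm in e1.
  have ES : (fun x : R => e * x + c) @^-1` `]a, b]%classic = `](a - c), (b - c)]%classic.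
    apply/seteqP; split => x /=; rewrite !in_itv/= ee mul1r.
      by rewrite ltrBlDr lerBrDr.
    by rewrite ltrBlDr lerBrDr.
  refine (etrans _ (congr1 (@lebesgue_measure R) (esym ES))).
  rewrite /= !lebesgue_measure_itv/= !lte_fin ltrD2r; case: ifP => // _.
  by rewrite -!EFinD; congr EFin; ring.
have {e1} ee : e = -1 by rewrite ltr0_norm in e1 => //; rewrite -e1 opprK.
have ES : (fun x : R => e * x + c) @^-1` `]a, b]%classic = `[(c - b), (c - a)[%classic.
  apply/seteqP; split => x /=; rewrite !in_itv/= ee mulN1r => /andP[h1 h2]; apply/andP; split; lra.
refine (etrans _ (congr1 (@lebesgue_measure R) (esym ES))).
rewrite /= !lebesgue_measure_itv/= !lte_fin ltrD2l ltrN2; case: ifP => // _.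
by rewrite -!EFinD; congr EFin; ring.
Qed.

(** Integrability is assumed of the composite because the image measure transports it in this
    direction. [L1_affine] obtains the converse by applying this lemma to the inverse map. *)
Lemma int_affine_aux f (e c : R) : `|e| = 1 -> mfun f ->
  L1 (fun x => f (e * x + c)) ->
  L1 f /\ int (fun x => f (e * x + c)) = int f.
Proof.
move=> e1 mf hf.
have mphi : @measurable_fun _ _ (measurableTypeR R) (measurableTypeR R) setT
    (fun x : R => e * x + c).
  have : measurable_fun setT (fun x : R => e * x + c) by
    apply: measurable_funD => //; apply: measurable_funM.
  exact.
have mF : measurable_fun setT (EFin \o f) by exact/measurable_EFinP.
pose phi : R -> measurableTypeR R := fun x : R => e * x + c.
pose ff : {mfun measurableTypeR R >-> measurableTypeR R} :=
  HB.pack phi (isMeasurableFun.Build _ _ _ _ _ mphi).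
pose nu0 := [the measure (measurableTypeR R) R of pushforward (@lebesgue_measure R) ff].
pose nu := nu0 mphi.
have nuE (A : set R) : measurable A -> nu A = lebesgue_measure A.
  by move=> mA; exact: measure_affine.
have inu : nu.-integrable setT (EFin \o f).
  by apply: (@integrable_pushforward _ _ (measurableTypeR R) (measurableTypeR R) R phi mphi) => //; rewrite preimage_setT.
have E1 : (\int[@lebesgue_measure R]_x (f x)%:E = \int[nu]_x (f x)%:E)%E.
  by apply: eq_measure_integral => A mA _; first [exact: nuE|exact/esym/nuE].
split.
  apply/integrableP; split => //.
  rewrite (eq_measure_integral nu); last by move=> A mA _; first [exact: nuE|exact/esym/nuE].
  by have /integrableP[] := inu.
rewrite /int /Rintegral; congr fine; rewrite E1.
have := @integral_pushforward _ _ (measurableTypeR R) (measurableTypeR R) R phi mphi lebesgue_measure setT _ mF.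
rewrite preimage_setT => h; exact/esym/h.
Qed.

Lemma L1_affine f e c : `|e| = 1 -> L1 f -> L1 (fun x => f (e * x + c)).
Proof.
move=> e1 hf.
have ee : e * e = 1.
  by rewrite -expr2 -real_normK ?num_real// e1 expr1n.
have mf : mfun (fun x => f (e * x + c)).
  apply: (@measurableT_comp _ _ _ _ _ _ f); first exact: L1_mfun.
  by apply: measurable_funD => //; apply: measurable_funM.
apply: (int_affine_aux (c := - e * c) e1 mf _).1.
rewrite (_ : (fun x => _) = f) //; apply/funext => x; congr f.
rewrite mulrDr mulrA ee mulNr mulrN mulrA ee; ring.
Qed.

Lemma int_affine f e c : `|e| = 1 -> L1 f -> int (fun x => f (e * x + c)) = int f.
Proof.
by move=> e1 hf; apply: (int_affine_aux e1 (L1_mfun hf) (L1_affine _ e1 hf)).2.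
Qed.

Lemma L1_shift f c : L1 f -> L1 (fun x => f (x + c)).
Proof.
move=> /(L1_affine c (normr1 _)); under eq_fun do rewrite mul1r; exact.
Qed.

Lemma int_shift f c : L1 f -> int (fun x => f (x + c)) = int f.
Proof.
by move=> /(int_affine c (normr1 _)) <-; under [RHS]eq_int do rewrite mul1r.
Qed.

Lemma int_opp f : L1 f -> int (fun x => f (- x)) = int f.
Proof.
by move=> /(int_affine 0 (normrN1 _)) <-; under [RHS]eq_int do rewrite mulN1r addr0.
Qed.

Lemma int_reflect f c : L1 f -> int (fun x => f (c - x)) = int f.
Proof.
by move=> /(int_affine c (normrN1 _)) <-; under [RHS]eq_int do rewrite mulN1r addrC.
Qed.

Lemma int_odd f : L1 f -> (forall x, f (- x) = - f x) -> int f = 0.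
Proof.
move=> hf fo; have := int_opp hf.
under eq_int do rewrite fo -mulN1r.
by rewrite intZ// => h; lra.
Qed.

Lemma int_dct (s : seq R) (f_ : nat -> R -> R) f g :
  (forall n, mfun (f_ n)) -> mfun f -> L1 g ->
  (forall n x, `|f_ n x| <= g x) ->
  (forall x, x \notin s -> f_ n x @[n --> \oo] --> f x) ->
  L1 f /\ int (f_ n) @[n --> \oo] --> int f.
Proof.
move=> mf_ mf hg fg cf.
have mE h : mfun h -> measurable_fun setT (EFin \o h).
  by move=> mh; exact/measurable_EFinP.
have [|||i1 _ i2] := @dominated_convergence _ _ R (@lebesgue_measure R) setT measurableT
  (fun n => EFin \o f_ n) (EFin \o f) (EFin \o g)
  (fun n => mE _ (mf_ n)) (mE _ mf).
- apply: (@ae_seq s) => x xs _; apply: cvg_EFin; first exact: nearW.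
  exact: cf.
- exact: hg.
- by apply: aeW => x n _ /=; rewrite lee_fin.
split; first exact: i1.
apply: fine_cvg; move: i2; rewrite (L1EFin i1).
by rewrite -[(int f)%:E]L1EFin.
Qed.

(** * Fubini's theorem for a product of integrable functions and a bounded kernel *)

Section Fubini.
Variables (f g : R -> R) (k : R -> R -> R).
Hypotheses (hf : L1 f) (hg : L1 g).
Hypothesis mk : measurable_fun setT (fun z : R * R => k z.1 z.2).
Variable M : R.
Hypothesis kM : forall x y, `|k x y| <= M.

Let F (z : R * R) : \bar R := (f z.1 * g z.2 * k z.1 z.2)%:E.

Let mF : measurable_fun setT F.
Proof.
apply/measurable_EFinP; apply: measurable_funM => //.
apply: measurable_funM; apply: measurableT_comp.
- exact: L1_mfun.
- exact: measurable_fst.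
- exact: L1_mfun.
- exact: measurable_snd.
Qed.

Lemma mfun_section x : mfun (k x).
Proof.
exact: (measurableT_comp mk (pair1_measurable x)).
Qed.

Lemma mfun_section' y : mfun (k ^~ y).
Proof.
exact: (measurableT_comp mk (pair2_measurable y)).
Qed.

Lemma L1_section x : L1 (fun y => g y * k x y).
Proof. by apply: L1Mb => //; [exact: mfun_section|exists M]. Qed.

Lemma L1_section' y : L1 (fun x => f x * k x y).
Proof. by apply: L1Mb => //; [exact: mfun_section'|exists M]. Qed.

Let iF : ((@lebesgue_measure R) \x (@lebesgue_measure R))%E.-integrable setT F.
Proof.
apply/integrable12ltyP => //.
pose c := int (fun y => `|g y| * M).
have hgM : L1 (fun y => `|g y| * M).
  apply: L1Mb; [exact: L1_abs|exact: measurable_cst|by exists `|M|].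
apply: (@le_lt_trans _ _ (\int[@lebesgue_measure R]_x (`|f x| * c)%:E)%E).
  apply: ge0_le_integral => //.
  - by move=> x _; exact: integral_ge0.
  - have mF1 : measurable_fun setT (abse \o F) by exact: measurableT_comp.
    apply: (measurable_fun_fubini_tonelli_F (m2 := @lebesgue_measure R) (abse \o F)).
      exact: mF1.
    by move=> z; rewrite /= lee_fin.
  - have mf1 : mfun (fun x => `|f x| * c).
      by apply: measurable_funM; [exact: (L1_mfun (L1_abs hf))|exact: measurable_cst].
    by apply/measurable_EFinP; exact: mf1.
  move=> x _.
  have L2 : L1 (fun y => `|f x| * (`|g y| * M)) by exact: L1Z.
  have L3 : L1 (fun y => `|f x * g y * k x y|).
    apply: L1_abs; under eq_fun do rewrite -mulrA; apply: L1Z.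
    apply: L1Mb => //; last by exists M.
    exact: (measurableT_comp mk (pair1_measurable x)).
  have -> : ((`|f x| * c)%:E = \int[@lebesgue_measure R]_y (`|f x| * (`|g y| * M))%:E)%E.
    by rewrite L1EFin// intZ.
  rewrite (_ : integral _ _ _ = \int[@lebesgue_measure R]_y (`|f x * g y * k x y|)%:E)%E//.
  rewrite !L1EFin// lee_fin; apply: int_le => // y.
  by rewrite !normrM -mulrA; do 2 apply: ler_wpM2l => //.
rewrite L1EFin ?ltry//; apply: L1Mb; [exact: L1_abs|exact: measurable_cst|by exists `|c|].
Qed.

Lemma L1_fubini : L1 (fun x => f x * int (fun y => g y * k x y)).
Proof.
have := integrable_fubini_F iF; rewrite /fubini_F /F/= => h.
rewrite /L1; apply: eq_integrable h => // x _ /=.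
rewrite EFinM -L1EFin; last exact: L1_section.
rewrite -integralZl//; last exact: L1_section.
by apply: eq_integral => y _; rewrite -EFinM mulrA.
Qed.

(** The hypothesis is [L1_fubini] with the two variables exchanged; [fubini] discharges it outside
    the section, where the roles of [f] and [g] can be swapped. *)
Lemma fubini_aux : L1 (fun y => g y * int (fun x => f x * k x y)) ->
  int (fun x => f x * int (fun y => g y * k x y)) =
  int (fun y => g y * int (fun x => f x * k x y)).
Proof.
move=> hG; apply: EFin_inj; rewrite -!L1EFin; [|exact: hG|exact: L1_fubini].
transitivity (\int[lebesgue_measure]_x \int[lebesgue_measure]_y F (x, y))%E.
  apply: eq_integral => x _; rewrite EFinM -L1EFin; last exact: L1_section.
  rewrite -integralZl//; last exact: L1_section.
  by apply: eq_integral => y _; rewrite -EFinM mulrA.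
rewrite (Fubini iF); apply: eq_integral => y _.
rewrite EFinM -L1EFin; last exact: L1_section'.
rewrite -integralZl//; last exact: L1_section'.
by apply: eq_integral => x _; rewrite -EFinM /F/= mulrCA mulrA.
Qed.

End Fubini.

Lemma fubini f g (k : R -> R -> R) (M : R) : L1 f -> L1 g ->
  measurable_fun setT (fun z : R * R => k z.1 z.2) ->
  (forall x y, `|k x y| <= M) ->
  int (fun x => f x * int (fun y => g y * k x y)) =
  int (fun y => g y * int (fun x => f x * k x y)).
Proof.
move=> hf hg mk kM; apply: (fubini_aux hf hg mk kM).
apply: (L1_fubini (k := fun y x => k x y) hg hf _ (fun y x => kM x y)).
apply: (@measurableT_comp _ _ _ _ _ _ (fun z : R * R => k z.1 z.2) _
  (fun z : R * R => (z.2, z.1)) mk).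
by apply/measurable_fun_pairP; split; [exact: measurable_snd|exact: measurable_fst].
Qed.

End RealIntegral.

(** * Integrals over intervals, and bounded functions of compact support *)

Section Integrals.
Variable R : realType.
Implicit Types (f g h F : R -> R) (a b c x y S M : R).

(** Continuity is tested along sequences, which turns it into dominated convergence. *)
Lemma int_continuous (s : seq R) (k : R -> R -> R) g y0 :
  (forall y, mfun (k y)) -> L1 g -> (forall y x, `|k y x| <= g x) ->
  (forall x, x \notin s -> {for y0, continuous (k ^~ x)}) ->
  {for y0, continuous (fun y => int (k y))}.
Proof.
move=> mk hg kg ck; apply/(@cvg_nbhsP _ R^o) => w wy.
apply: (int_dct (s := s) (fun n => mk (w n)) (mk y0) hg _ _).2.
  by move=> n x; exact: kg.
by move=> x xs; have /(@cvg_nbhsP _ R^o) := ck x xs; apply.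
Qed.

Lemma mfun_continuous f : continuous f -> mfun f.
Proof. exact: continuous_measurable_fun. Qed.

Lemma mfunM f g : mfun f -> mfun g -> mfun (fun x => f x * g x).
Proof. exact: measurable_funM. Qed.

Lemma mfunD f g : mfun f -> mfun g -> mfun (fun x => f x + g x).
Proof. exact: measurable_funD. Qed.

Lemma mfun_cst c : mfun (fun=> c : R).
Proof. exact: measurable_cst. Qed.

Lemma mfun_comp f g : mfun f -> mfun g -> mfun (fun x => f (g x)).
Proof. exact: measurableT_comp. Qed.

Lemma mfun_if (P : R -> bool) f g : measurable_fun setT P -> mfun f -> mfun g ->
  mfun (fun x => if P x then f x else g x).
Proof. exact: measurable_fun_ifT. Qed.

Lemma mfun_affine e c : mfun (fun x : R => e * x + c).
Proof. by apply: measurable_funD => //; apply: measurable_funM. Qed.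

Lemma mfun_normr : mfun (fun x : R => `|x|).
Proof. exact: normr_measurable. Qed.

Lemma mfun_le f g : mfun f -> mfun g -> measurable_fun setT (fun x => f x <= g x).
Proof. exact: measurable_fun_ler. Qed.

Lemma mfun_lt f g : mfun f -> mfun g -> measurable_fun setT (fun x => f x < g x).
Proof. exact: measurable_fun_ltr. Qed.

Definition ind a b x : R := ((a <= x)%R && (x <= b)%R)%:R.

Lemma ind_ge0 a b x : 0 <= ind a b x.
Proof. by rewrite ler0n. Qed.

Lemma mfun_ind a b : mfun (ind a b).
Proof.
rewrite /ind (_ : (fun x => _) = fun x => if (a <= x) && (x <= b) then 1 else 0).
  apply: mfun_if; [|exact: mfun_cst..].
  apply: measurable_and; apply: mfun_le; solve [exact: mfun_cst|exact: measurable_id].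
by apply/funext => x; case: ifP.
Qed.

Lemma ind_le1 a b x : `|ind a b x| <= 1.
Proof. by rewrite /ind; case: andP => _; rewrite ?normr1 ?normr0. Qed.

Lemma ind_indic a b : ind a b = \1_(`[a, b]%classic).
Proof.
apply/funext => x; rewrite /ind indicE; congr (_ %:R); congr nat_of_bool.
by apply/idP/idP; rewrite inE /= in_itv.
Qed.

Lemma L1_ind a b : L1 (ind a b).
Proof. by rewrite ind_indic; exact: integrable_indic_itv. Qed.

Lemma int_indE a b f : mfun f ->
  int (fun x => ind a b x * f x) = \int[@lebesgue_measure R]_(x in `[a, b]) f x.
Proof.
move=> mf; rewrite Rintegral_mkcond; apply: eq_int => x.
rewrite /patch /ind mem_setE/= in_itv/=.
by case: ifP => _; rewrite ?mul1r ?mul0r.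
Qed.

Lemma int_ind_FTC F f a b : a <= b -> (forall x, is_derive x (1 : R) F (f x)) ->
  continuous f -> int (fun x => ind a b x * f x) = F b - F a.
Proof.
move=> ab dF cf; rewrite int_indE; last exact: mfun_continuous.
have cF : continuous F.
  by move=> x; apply/differentiable_continuous/derivable1_diffP; case: (dF x).
move: ab; rewrite le_eqVlt => /predU1P[->|ab].
  by rewrite set_itv1 Rintegral_set1 subrr.
rewrite /Rintegral (continuous_FTC2 ab (F := F))//.
- exact: continuous_subspaceT.
- split.
  + by move=> x _; case: (dF x).
  + exact/cvg_at_right_filter/cF.
  + exact/cvg_at_left_filter/cF.
- by move=> x _; rewrite derive1E; case: (dF x).
Qed.

Lemma int_ind a b : a <= b -> int (ind a b) = b - a.
Proof.
move=> ab; rewrite -[RHS](int_ind_FTC ab (F := id) (f := fun=> 1)).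
- by apply: eq_int => x; rewrite mulr1.
- by move=> x; exact: cvg_cst.
Qed.

Lemma mfun_indM a b f : mfun f -> mfun (fun x => ind a b x * f x).
Proof. by move=> mf; apply: mfunM => //; exact: mfun_ind. Qed.

Lemma int_ind_split a b c f : a <= b -> b <= c -> mfun f ->
  L1 (fun x => ind a c x * f x) ->
  int (fun x => ind a c x * f x) =
  int (fun x => ind a b x * f x) + int (fun x => ind b c x * f x).
Proof.
move=> ab bc mf hf.
have sub a' b' : a <= a' -> b' <= c -> L1 (fun x => ind a' b' x * f x).
  move=> aa bb; apply: L1_le (L1_abs hf); first exact: mfun_indM.
  move=> x; rewrite !normrM ler_wpM2r// /ind.
  case: (boolP (a' <= x <= b')) => [/andP[h1 h2]|_]; last by rewrite normr0.
  by rewrite (le_trans aa h1) (le_trans h2 bb).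
rewrite -intD; [|exact: sub..].
(* Both closed windows contain [b], so the integrands agree only off that point. *)
apply: (@int_ae _ _ _ [:: b]); [exact: mfun_indM| |].
  by apply: mfunD; exact: mfun_indM.
move=> x; rewrite inE => xb; rewrite -mulrDl; congr (_ * _); rewrite /ind.
have [xb1|bx] := leP x b.
  have -> : (b <= x) = false.
    by apply/negbTE; rewrite -ltNge lt_neqAle xb.
  by rewrite (le_trans xb1 bc) !andbT addr0.
by rewrite andbF add0r (ltW bx) (le_trans ab (ltW bx)).
Qed.

(** Bounded with compact support. The class is contained in L1 and stable under sums, products and
    (with a larger [S]) convolution, so that integrability side conditions are settled by
    membership. *)
Definition bcs S f : Prop :=
  [/\ mfun f, bounded f & forall x, S < `|x| -> f x = 0].

Lemma bcs_ind S f : bcs S f -> f = (fun x => ind (- S) S x * f x).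
Proof.
case=> _ _ f0; apply/funext => x; rewrite /ind.
have [h|h] := leP `|x| S; first by rewrite -ler_norml h mul1r.
by rewrite f0// mulr0.
Qed.

Lemma bounded_ge0 f : bounded f -> exists2 M, 0 <= M & forall x, `|f x| <= M.
Proof. by case=> M h; exists M => //; exact: le_trans (h 0). Qed.

Lemma bcs_bound S f : bcs S f ->
  exists2 M, 0 <= M & forall x, `|f x| <= M * ind (- S) S x.
Proof.
move=> hf; have [_ /bounded_ge0[M M0 hM] f0] := hf; exists M => // x.
by rewrite {1}(bcs_ind hf) mulrC normrM ler_pM// ger0_norm// ind_ge0.
Qed.

Lemma bcs_L1 S f : bcs S f -> L1 f.
Proof.
move=> hf; have [M M0 hM] := bcs_bound hf.
by apply: (L1_le _ hM); [case: hf|apply/L1Z/L1_ind].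
Qed.

Lemma bcs_le S S' f : S <= S' -> bcs S f -> bcs S' f.
Proof. by move=> h [? ? f0]; split=> // x hx; apply: f0; exact: le_lt_trans hx. Qed.

Lemma bcs0 S : bcs S (fun=> 0).
Proof. by split => //; [exact: mfun_cst|exists 0 => x; rewrite normr0]. Qed.

Lemma bcsD S f g : bcs S f -> bcs S g -> bcs S (fun x => f x + g x).
Proof.
move=> [mf [Mf bf] f0] [mg [Mg bg] g0]; split; first exact: mfunD.
  by exists (Mf + Mg) => x; rewrite (le_trans (ler_normD _ _))// lerD.
by move=> x hx; rewrite f0// g0// addr0.
Qed.

Lemma bcsMb S f g : bcs S f -> mfun g -> bounded g -> bcs S (fun x => f x * g x).
Proof.
move=> [mf /bounded_ge0[Mf Mf0 bf] f0] mg [Mg bg]; split; first exact: mfunM.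
  by exists (Mf * Mg) => x; rewrite normrM ler_pM.
by move=> x hx; rewrite f0// mul0r.
Qed.

Lemma bcsM S f g : bcs S f -> bcs S g -> bcs S (fun x => f x * g x).
Proof. by move=> hf [mg bg _]; exact: bcsMb. Qed.

Lemma bcsZ S c f : bcs S f -> bcs S (fun x => c * f x).
Proof.
move=> hf; under eq_fun do rewrite mulrC; apply: bcsMb => //.
  exact: mfun_cst.
by exists `|c|.
Qed.

Lemma bcsB S f g : bcs S f -> bcs S g -> bcs S (fun x => f x - g x).
Proof.
move=> hf hg; under eq_fun do rewrite -mulN1r; apply: bcsD => //.
exact: bcsZ.
Qed.

Lemma bcs_sum S (I : Type) (s : seq I) (G : I -> R -> R) :
  (forall i, bcs S (G i)) -> bcs S (fun x => \sum_(i <- s) G i x).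
Proof.
move=> hG; elim: s => [|i s IH].
  by under eq_fun do rewrite big_nil; exact: bcs0.
by under eq_fun do rewrite big_cons; exact: bcsD.
Qed.

Lemma bcs_indS S : bcs S (ind (- S) S).
Proof.
split; [exact: mfun_ind|by exists 1 => x; exact: ind_le1|move=> x hx].
by rewrite /ind -ler_norml leNgt hx.
Qed.

Lemma bcs_indr a b S : - S <= a -> b <= S -> bcs S (ind a b).
Proof.
move=> ha hb; split; [exact: mfun_ind|by exists 1 => x; exact: ind_le1|move=> x hx].
rewrite /ind; case: andP => // -[h1 h2]; exfalso; move: hx.
by rewrite ltNge ler_norml (le_trans ha h1) (le_trans h2 hb).
Qed.

Lemma mfun2_sub f : mfun f -> measurable_fun setT (fun z : R * R => f (z.1 - z.2)).
Proof.
move=> mf; apply: (measurableT_comp mf); apply: measurable_funB.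
  exact: measurable_fst.
exact: measurable_snd.
Qed.

Lemma mfun2_mul f c : mfun f ->
  measurable_fun setT (fun z : R * R => f (c * z.1 * z.2)).
Proof.
move=> mf; apply: (measurableT_comp mf); apply: measurable_funM.
  by apply: measurable_funM => //; exact: measurable_fst.
exact: measurable_snd.
Qed.

(* Cauchy-Schwarz in the weighted form that needs no square roots. *)
Lemma int_young S f g c : bcs S f -> bcs S g -> 0 < c ->
  `|int (fun x => f x * g x)| <=
  2^-1 * (c * int (fun x => f x ^+ 2) + c^-1 * int (fun x => g x ^+ 2)).
Proof.
move=> hf hg c0.
have hf2 : L1 (fun x => f x ^+ 2) := bcs_L1 (bcsM hf hf).
have hg2 : L1 (fun x => g x ^+ 2) := bcs_L1 (bcsM hg hg).
have hfg : L1 (fun x => f x * g x) := bcs_L1 (bcsM hf hg).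
have h1 : L1 (fun x => c * f x ^+ 2) by exact: L1Z.
have h2 : L1 (fun x => c^-1 * g x ^+ 2) by exact: L1Z.
rewrite -(intZ c hf2) -(intZ c^-1 hg2) -intD// -intZ; last exact: L1D.
rewrite (le_trans (int_abs hfg))//.
apply: int_le; [exact: L1_abs|by apply/L1Z/L1D|move=> x].
rewrite normrM -(real_normK (num_real (f x))) -(real_normK (num_real (g x))).
have : 0 <= c^-1 * (c * `|f x| - `|g x|) ^+ 2.
  by rewrite mulr_ge0 ?sqr_ge0// invr_ge0 ltW.
have -> : c^-1 * (c * `|f x| - `|g x|) ^+ 2 =
  c * `|f x| ^+ 2 - 2 * (`|f x| * `|g x|) + c^-1 * `|g x| ^+ 2.
  by field; rewrite gt_eqF.
lra.
Qed.

End Integrals.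

(** * Fourier inversion *)

Section Inversion.
Variable R : realType.
Implicit Types (f g h u : R -> R) (a b c d e x y t S M : R).

Local Notation D f x a := (is_derive x (1 : R) f a).

Lemma drv_eq f x a b : D f x a -> a = b -> D f x b.
Proof. by move=> h <-. Qed.

Lemma drv_cst c x : D (fun=> c) x 0.
Proof. exact: is_derive_cst. Qed.

Lemma drv_id x : D (fun y => y) x 1.
Proof. by have := @is_derive_id R R^o x 1. Qed.

Lemma drvD f g x a b : D f x a -> D g x b -> D (fun y => f y + g y) x (a + b).
Proof. by move=> hf hg; exact: (is_deriveD hf hg). Qed.

Lemma drvB f g x a b : D f x a -> D g x b -> D (fun y => f y - g y) x (a - b).
Proof. by move=> hf hg; exact: (is_deriveB hf hg). Qed.

Lemma drvM f g x a b :
  D f x a -> D g x b -> D (fun y => f y * g y) x (a * g x + f x * b).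
Proof.
move=> hf hg; apply: (drv_eq (is_deriveM hf hg)).
by rewrite /GRing.scale/= addrC; congr (_ + _); rewrite mulrC.
Qed.

Lemma drvZ c f x a : D f x a -> D (fun y => c * f y) x (c * a).
Proof. by move=> hf; apply: (drv_eq (drvM (drv_cst c x) hf)); rewrite mul0r add0r. Qed.

Lemma drv_comp f g x a b : D f (g x) a -> D g x b -> D (fun y => f (g y)) x (a * b).
Proof. by move=> hf hg; apply: (drv_eq (is_derive1_comp hf hg)); rewrite mulrC. Qed.

Lemma drv_lin c x : D (fun y => c * y) x c.
Proof. by apply: (drv_eq (drvZ c (drv_id x))); rewrite mulr1. Qed.

Lemma drv_cos c x : D (fun y => cos (c * y)) x (- c * sin (c * x)).
Proof.
apply: (drv_eq (drv_comp (is_derive_cos (c * x)) (drv_lin c x))).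
by rewrite mulNr mulrC mulNr.
Qed.

Lemma drv_sin c x : D (fun y => sin (c * y)) x (c * cos (c * x)).
Proof.
apply: (drv_eq (drv_comp (is_derive_sin (c * x)) (drv_lin c x))).
by rewrite mulrC.
Qed.

Lemma drv_exp c x : D (fun y => expR (c * y)) x (c * expR (c * x)).
Proof.
apply: (drv_eq (drv_comp (is_derive_expR (c * x)) (drv_lin c x))).
by rewrite mulrC.
Qed.

Lemma drv_continuous f : (forall x, exists a, D f x a) -> continuous f.
Proof.
move=> h x; apply/differentiable_continuous/derivable1_diffP.
by case: (h x) => a [].
Qed.

Lemma continuous_mul f g : continuous f -> continuous g ->
  continuous (fun x => f x * g x).
Proof. by move=> cf cg x; apply: cvgM; [exact: cf|exact: cg]. Qed.

Lemma continuous_add f g : continuous f -> continuous g ->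
  continuous (fun x => f x + g x).
Proof. by move=> cf cg x; apply: cvgD; [exact: cf|exact: cg]. Qed.

Lemma continuous_cosl c : continuous (fun x => cos (c * x)).
Proof. by apply: drv_continuous => x; eexists; exact: drv_cos. Qed.

Lemma continuous_sinl c : continuous (fun x => sin (c * x)).
Proof. by apply: drv_continuous => x; eexists; exact: drv_sin. Qed.

Lemma continuous_abs : continuous (fun x : R => `|x|).
Proof. exact: norm_continuous. Qed.

(** Cosine transform. On even functions it is the Fourier transform ([fourierE]), which keeps the
    analysis real-valued. *)
Definition Fc f y : R := int (fun x => f x * cos (2 * pi * x * y)).

Lemma cos_comm x y : cos (2 * pi * x * y) = cos (2 * pi * y * x) :> R.
Proof. by congr cos; ring. Qed.

Lemma mfun_cosl c : mfun (fun x => cos (c * x)).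
Proof. exact: (mfun_continuous (@continuous_cosl c)). Qed.

Lemma mfun_cosr c : mfun (fun x => cos (2 * pi * x * c)).
Proof. by under eq_fun do rewrite cos_comm; exact: mfun_cosl. Qed.

Lemma mfun_sinl c : mfun (fun x => sin (c * x)).
Proof. exact: (mfun_continuous (@continuous_sinl c)). Qed.

Lemma bounded_cos f : bounded (fun x => cos (f x)).
Proof. by exists 1 => x; exact: cos_max. Qed.

Lemma bounded_sin f : bounded (fun x => sin (f x)).
Proof. by exists 1 => x; exact: sin_max. Qed.

Lemma L1_cos f y : L1 f -> L1 (fun x => f x * cos (2 * pi * x * y)).
Proof. by move=> hf; apply: L1Mb => //; [exact: mfun_cosr|exact: bounded_cos]. Qed.

Lemma Fc_le f y : L1 f -> `|Fc f y| <= int (fun x => `|f x|).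
Proof.
move=> hf; apply: (le_trans (int_abs (L1_cos y hf))).
apply: int_le; [exact: (L1_abs (L1_cos y hf))|exact: L1_abs|move=> x].
by rewrite normrM ler_piMr// cos_max.
Qed.

Lemma Fc_continuous f : L1 f -> continuous (Fc f).
Proof.
move=> hf y; apply: (@int_continuous _ [::] _ (fun x => `|f x|)).
- by move=> z; exact: (L1_mfun (L1_cos z hf)).
- exact: L1_abs.
- by move=> z x; rewrite normrM ler_piMr// cos_max.
- move=> x _; apply: cvgM; [exact: cvg_cst|exact: continuous_cosl].
Qed.

Lemma Fc_even f y : Fc f (- y) = Fc f y.
Proof. by apply: eq_int => x; rewrite mulrN cosN. Qed.

Lemma Fc0 f : Fc f 0 = int f.
Proof. by apply: eq_int => x; rewrite mulr0 cos0 mulr1. Qed.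

(** [f0] is the smooth formula that [f], typically written with an absolute value, follows on the
    positive half-line. Non-negativity lets the finite value of the improper integral also prove
    integrability. *)
Lemma int_evenFTC f f0 F l : (forall x, 0 <= f x) -> continuous f ->
  (forall x, f (- x) = f x) -> (forall x, 0 <= x -> f x = f0 x) ->
  (forall x, D F x (f0 x)) -> continuous f0 -> F x @[x --> +oo%R] --> l ->
  L1 f /\ int f = 2 * (l - F 0).
Proof.
move=> f_ge0 cf fe ff0 dF cf0 Fl.
have cF : continuous F by apply: drv_continuous => x; exists (f0 x).
have E : (\int[@lebesgue_measure R]_x (f x)%:E = (2 * (l - F 0))%:E)%E.
  rewrite ge0_symfun_integralT//; last by move=> x; rewrite /= fe.
  rewrite -set_itvcy.
  have -> : (\int[@lebesgue_measure R]_(x in `[0%R, +oo[) (f x)%:E =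
             \int[@lebesgue_measure R]_(x in `[0%R, +oo[) (f0 x)%:E)%E.
    by apply: eq_integral => x; rewrite inE/= in_itv/= andbT => /ff0 ->.
  rewrite (@ge0_continuous_FTC2y R f0 F 0 l) ?EFinM ?EFinB//.
  - by move=> x x0; rewrite -ff0.
  - exact: continuous_subspaceT.
  - exact/cvg_at_right_filter/cF.
  - by move=> x _; rewrite derive1E; case: (dF x).
split; last by rewrite /int /Rintegral E.
apply/integrableP; split.
  by apply/measurable_EFinP; exact: (mfun_continuous cf).
under eq_integral do rewrite /= ger0_norm//.
by rewrite E ltry.
Qed.

(** Abel weight: it makes inversion integrals absolutely convergent, and its transform is the
    Poisson kernel ([poissonE]). *)
Definition expabs e y : R := expR (- e * `|y|).

Lemma expabs_ge0 e y : 0 <= expabs e y.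
Proof. exact: expR_ge0. Qed.

Lemma expabs_le1 e y : 0 <= e -> expabs e y <= 1.
Proof. by move=> e0; rewrite /expabs -expR0 ler_expR mulNr oppr_le0 mulr_ge0. Qed.

Lemma continuous_expabs e : continuous (expabs e).
Proof.
move=> y; apply: (@continuous_comp _ _ _ (fun x : R => - e * `|x|)); last first.
  exact: continuous_expR.
by apply: cvgM; [exact: cvg_cst|exact: continuous_abs].
Qed.

Lemma cvg_expNM e : 0 < e -> expR (- e * x) @[x --> +oo%R] --> (0 : R).
Proof.
move=> e0; under eq_fun do rewrite mulNr.
apply: (@cvg_comp _ _ _ (fun x => e * x) (fun z : R => expR (- z)) _ +oo%R _); last first.
  exact: cvgr_expR.
apply/cvgryPge => A; near=> x; rewrite mulrC -ler_pdivrMr//.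
Unshelve. all: by end_near. Qed.

Lemma expabs_int e : 0 < e -> L1 (expabs e) /\ int (expabs e) = 2 / e.
Proof.
move=> e0.
have [|||||h ->] := @int_evenFTC (expabs e) (fun x => expR (- e * x))
   (fun x => - e^-1 * expR (- e * x)) 0 (expabs_ge0 e) (@continuous_expabs e).
- by move=> x; rewrite /expabs normrN.
- by move=> x x0; rewrite /expabs ger0_norm.
- move=> x; apply: (drv_eq (drvZ (- e^-1) (drv_exp (- e) x))).
  by field; rewrite gt_eqF.
- by apply: drv_continuous => x; eexists; exact: drv_exp.
- rewrite -[X in _ --> X](mulr0 (- e^-1)); apply: cvgM; first exact: cvg_cst.
  exact: cvg_expNM.
- by split => //; rewrite mulr0 expR0; field; rewrite gt_eqF.
Qed.

Lemma expabs_cos_int e b : 0 < e ->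
  int (fun y => expabs e y * cos (b * y)) = 2 * e / (e ^+ 2 + b ^+ 2).
Proof.
move=> e0; have [hE iE] := expabs_int e0.
have hEc : L1 (fun y => expabs e y * cos (b * y)).
  by apply: L1Mb => //; [exact: mfun_cosl|exact: bounded_cos].
have nz : e ^+ 2 + b ^+ 2 != 0.
  by rewrite gt_eqF// ltr_wpDr ?sqr_ge0// exprn_gt0.
pose F x := expR (- e * x) *
  (- e^-1 + (b * sin (b * x) - e * cos (b * x)) / (e ^+ 2 + b ^+ 2)).
suff : int (fun y => expabs e y + expabs e y * cos (b * y)) =
    2 / e + 2 * e / (e ^+ 2 + b ^+ 2).
  by rewrite intD// iE => /addrI.
have [||||||| _ ->] := @int_evenFTC (fun y => expabs e y + expabs e y * cos (b * y))
   (fun x => expR (- e * x) * (1 + cos (b * x))) F 0.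
- move=> y; rewrite -{1}[expabs e y]mulr1 -mulrDr mulr_ge0 ?expabs_ge0//.
- apply: continuous_add; first exact: continuous_expabs.
  by apply: continuous_mul; [exact: continuous_expabs|exact: continuous_cosl].
- by move=> x; rewrite /expabs normrN mulrN cosN.
- by move=> x x0; rewrite /expabs ger0_norm// mulrDr mulr1.
- move=> x; apply: (drv_eq (drvM (drv_exp (- e) x)
    (drvD (drv_cst (- e^-1) x) (drvM
      (drvB (drvZ b (drv_sin b x)) (drvZ e (drv_cos b x)))
      (drv_cst (e ^+ 2 + b ^+ 2)^-1 x))))).
  by field; rewrite nz gt_eqF.
- apply: continuous_mul; first by apply: drv_continuous => x; eexists; exact: drv_exp.
  by apply: continuous_add; [move=> x; exact: cvg_cst|exact: continuous_cosl].
- pose M := e^-1 + (`|b| + e) / (e ^+ 2 + b ^+ 2).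
  have FM x : `|F x| <= M * expR (- e * x).
    rewrite /F normrM [leLHS]mulrC [X in _ * X <= _]ger0_norm ?expR_ge0// ler_wpM2r ?expR_ge0//.
    rewrite (le_trans (ler_normD _ _))// normrN ger0_norm ?invr_ge0 ?(ltW e0)//.
    rewrite lerD2l normrM [X in _ * X]ger0_norm ?invr_ge0 ?addr_ge0 ?sqr_ge0//.
    rewrite ler_wpM2r ?invr_ge0 ?addr_ge0 ?sqr_ge0//.
    rewrite (le_trans (ler_normB _ _))// !normrM (gtr0_norm e0).
    by rewrite lerD// ?ler_piMr// ?sin_max ?cos_max// ltW.
  apply: norm_cvg0; apply: (@squeeze_cvgr _ _ _ _ (cst 0) (fun x => M * expR (- e * x))).
  + by near=> x; rewrite normr_ge0 FM.
  + exact: cvg_cst.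
  + rewrite -[X in _ --> X](mulr0 M); apply: cvgM; first exact: cvg_cst.
    exact: cvg_expNM.
- rewrite /F !mulr0 expR0 sin0 cos0; field; rewrite nz gt_eqF//.
Unshelve. all: by end_near. Qed.

Definition poisson e t : R := 2 * e / (e ^+ 2 + (2 * pi * t) ^+ 2).

Lemma poissonE e t : 0 < e ->
  poisson e t = int (fun y => expabs e y * cos (2 * pi * t * y)).
Proof. by move=> e0; rewrite expabs_cos_int. Qed.

Lemma poisson_den e t : 0 < e -> 0 < e ^+ 2 + (2 * pi * t) ^+ 2.
Proof. by move=> e0; rewrite ltr_wpDr ?sqr_ge0// exprn_gt0. Qed.

Lemma poisson_ge0 e t : 0 < e -> 0 <= poisson e t.
Proof.
move=> e0; rewrite /poisson mulr_ge0 ?invr_ge0 ?addr_ge0 ?sqr_ge0//.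
by rewrite mulr_ge0// ltW.
Qed.

Lemma poisson_even e t : poisson e (- t) = poisson e t.
Proof. by rewrite /poisson mulrN sqrrN. Qed.

Lemma continuous_poisson e : 0 < e -> continuous (poisson e).
Proof.
move=> e0; apply: continuous_mul; first by move=> x; exact: cvg_cst.
move=> x; apply: cvgV; first by rewrite gt_eqF// poisson_den.
apply: cvgD; first exact: cvg_cst.
by rewrite expr2; under eq_fun do rewrite expr2; apply: cvgM; (apply: cvgM; [exact: cvg_cst|exact: cvg_id]).
Qed.

Lemma poisson_int e : 0 < e -> L1 (poisson e) /\ int (poisson e) = 1.
Proof.
move=> e0; have pi0 := @pi_gt0 R.
have [||||h ->] := @int_evenFTC (poisson e) (poisson e)
   (fun x => pi^-1 * atan (2 * pi / e * x)) 2^-1 (fun t => poisson_ge0 t e0)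
   (continuous_poisson e0) (poisson_even e).
- by [].
- move=> x; apply: (drv_eq (drvZ pi^-1 (drv_comp (is_derive1_atan (2 * pi / e * x))
    (drv_lin (2 * pi / e) x)))).
  have := poisson_den x e0; rewrite /poisson; move: (@pi R) pi0 => p p0 nz.
  by field; rewrite !gt_eqF.
- exact: continuous_poisson.
- rewrite (_ : 2^-1 = pi^-1 * (pi / 2)); last by rewrite mulrA mulVf ?gt_eqF// mul1r.
  apply: cvgM; first exact: cvg_cst.
  apply: (@cvg_comp _ _ _ (fun x => 2 * pi / e * x) (@atan R) _ +oo%R _); last first.
    exact: cvgy_atan.
  have k0 : 0 < 2 * pi / e by rewrite divr_gt0// mulr_gt0.
  apply/cvgryPge => A; near=> x; rewrite mulrC -ler_pdivrMr//.
- by split => //; rewrite mulr0 atan0 mulr0 subr0 divff.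
Unshelve. all: by end_near. Qed.

End Inversion.

(** * The Poisson kernel as an approximate identity, and the inversion formula *)

Section Inversion2.
Variable R : realType.
Implicit Types (f g h u w : R -> R) (a b c d e x y t S M : R).

Definition eps_ (n : nat) : R := n.+1%:R^-1.

Lemma eps_gt0 n : 0 < eps_ n.
Proof. by rewrite /eps_ invr_gt0. Qed.

Lemma cvg_eps : eps_ n @[n --> \oo] --> (0 : R).
Proof. exact: cvg_harmonic. Qed.

(** Away from 0 every kernel is compared with the fixed integrable kernel [poisson 1], with a gain
    of a factor [e]; no rescaling of the variable is needed. With [T] the square of [2 * pi * t],
    the point is that [(1 + T) / T] is at most [1 + D^-1] once [T >= D]. *)
Lemma poisson_tail e t d : 0 < e -> 0 < d -> d <= `|t| ->
  poisson e t <= e * ((1 + (4 * pi ^+ 2 * d ^+ 2)^-1) * poisson 1 t).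
Proof.
move=> e0 d0 dt; rewrite /poisson; have := @pi_gt0 R; move: (@pi R) => p p0.
have t2 : d ^+ 2 <= t ^+ 2 by rewrite -(real_normK (num_real t)) lerXn2r// nnegrE ltW.
have d2 : 0 < d ^+ 2 by rewrite exprn_gt0.
have p2 : 0 < p ^+ 2 by rewrite exprn_gt0.
have pt2 : 0 < p ^+ 2 * t ^+ 2 by rewrite mulr_gt0// (lt_le_trans d2).
have -> : (2 * p * t) ^+ 2 = 4 * (p ^+ 2 * t ^+ 2) by ring.
set D := 4 * p ^+ 2 * d ^+ 2.
have D0 : 0 < D by rewrite !mulr_gt0.
set T := 4 * (p ^+ 2 * t ^+ 2).
have DT : D <= T by rewrite /D /T -mulrA ler_wpM2l// ler_wpM2l// ltW.
have T0 : 0 < T by exact: lt_le_trans DT.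
clearbody D T.
have E0 : 0 < e ^+ 2 + T by rewrite ltr_wpDl ?sqr_ge0.
have T1 : 0 < 1 + T by rewrite ltr_wpDl.
rewrite ler_pdivrMr// (_ : e * _ * _ = 2 * e * ((D + 1) * (e ^+ 2 + T)) / (D * (1 + T))); last first.
  by rewrite expr1n; field; rewrite !gt_eqF.
rewrite ler_pdivlMr ?mulr_gt0// ler_wpM2l ?mulr_ge0 ?(ltW e0)//.
have := mulr_ge0 (ltW D0) (sqr_ge0 e); have := sqr_ge0 e; nra.
Qed.

Lemma approx_identity w : L1 w -> {for 0, continuous w} ->
  int (fun t => w t * poisson (eps_ n) t) @[n --> \oo] --> w 0.
Proof.
move=> hw cw; apply/cvgrPdist_lt => r r0.
have r20 : 0 < r / 2 by rewrite divr_gt0.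
have /cvgrPdist_lt/(_ _ r20)[d /= d0 hd] := cw.
set K := 1 + (4 * pi ^+ 2 * (d / 2) ^+ 2)^-1 : R.
have K0 : 0 <= K 
  by rewrite addr_ge0 ?ler01// invr_ge0 mulr_ge0 ?sqr_ge0// mulr_ge0 ?sqr_ge0.
have [hP1 iP1] := @poisson_int R 1 ltr01.
set C := K * (2 * int (fun t => `|w t|) + `|w 0|).
have C0 : 0 <= C.
  by rewrite mulr_ge0// addr_ge0// mulr_ge0//; apply: int_ge0.
have P1le t : poisson 1 t <= 2 :> R.
  rewrite /poisson mulr1 expr1n ler_pdivrMr ?ltr_wpDr ?sqr_ge0//.
  by rewrite ler_peMr// lerDl sqr_ge0.
(* For [|t| < d] continuity gives [r / 2] against a kernel of mass 1. Elsewhere [poisson_tail] gives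
   the factor [eps_ n]; there [poisson 1] is bounded by 2 against [w t], which is only integrable,
   and has mass 1 against the constant [w 0]. *)
have main n : `|w 0 - int (fun t => w t * poisson (eps_ n) t)| <= r / 2 + eps_ n * C.
  have e0 := eps_gt0 n; have [hP iP] := poisson_int e0.
  have bP : bounded (poisson (eps_ n)).
    exists (2 * eps_ n / eps_ n ^+ 2) => t; rewrite ger0_norm ?poisson_ge0//.
    rewrite /poisson ler_wpM2l ?mulr_ge0// ?(ltW e0)// lef_pV2 ?posrE ?exprn_gt0//.
      by rewrite lerDl sqr_ge0.
    by rewrite ltr_wpDr ?sqr_ge0 ?exprn_gt0.
  have hwP : L1 (fun t => w t * poisson (eps_ n) t).
    by apply: L1Mb => //; exact: L1_mfun.
  have hw0P : L1 (fun t => w 0 * poisson (eps_ n) t) by exact: L1Z.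
  have -> : w 0 - int (fun t => w t * poisson (eps_ n) t) =
     int (fun t => w 0 * poisson (eps_ n) t - w t * poisson (eps_ n) t).
    by rewrite intB// intZ// iP mulr1.
  have hB := L1B hw0P hwP.
  rewrite (le_trans (int_abs hB))//.
  have hR : L1 (fun t => r / 2 * poisson (eps_ n) t +
     eps_ n * K * (2 * `|w t| + `|w 0| * poisson 1 t)).
    apply: L1D; first exact: L1Z.
    by apply: L1Z; apply: L1D; apply: L1Z => //; exact: L1_abs.
  have -> : r / 2 + eps_ n * C = int (fun t => r / 2 * poisson (eps_ n) t +
     eps_ n * K * (2 * `|w t| + `|w 0| * poisson 1 t)).
    have hw1 := L1_abs hw; have A1 := L1Z 2 hw1; have A2 := L1Z `|w 0| hP1.
    rewrite (intD (L1Z _ hP) (L1Z _ (L1D A1 A2))) (intZ _ hP) iP mulr1.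
    rewrite (intZ _ (L1D A1 A2)) (intD A1 A2) (intZ _ hw1) (intZ _ hP1) iP1.
    by rewrite mulr1 /C mulrA.
  apply: int_le; [exact: L1_abs|exact: hR|move=> t].
  rewrite -mulrBl normrM (ger0_norm (poisson_ge0 t e0)).
  have Q0 : 0 <= eps_ n * K * (2 * `|w t| + `|w 0| * poisson 1 t).
    apply: mulr_ge0; first by rewrite mulr_ge0// ltW.
    by apply: addr_ge0; [exact: mulr_ge0|apply: mulr_ge0 => //; exact: poisson_ge0].
  have [td|td] := ltP `|t| d.
    rewrite -[leLHS]addr0 lerD// ler_wpM2r ?poisson_ge0//.
    by apply/ltW/hd; rewrite /= sub0r normrN.
  rewrite -[leLHS]add0r lerD//; first by rewrite mulr_ge0 ?poisson_ge0// ltW.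
  have d20 : 0 < d / 2 by rewrite divr_gt0.
  have dt : d / 2 <= `|t| by lra.
  have pt := poisson_tail e0 d20 dt; rewrite -/K in pt.
  apply: (@le_trans _ _ ((`|w t| + `|w 0|) * (eps_ n * (K * poisson 1 t)))).
    apply: ler_pM => //; first exact: poisson_ge0.
    by rewrite (le_trans (ler_normB _ _))// addrC.
  have -> : (`|w t| + `|w 0|) * (eps_ n * (K * poisson 1 t)) =
     eps_ n * K * (poisson 1 t * `|w t| + `|w 0| * poisson 1 t) by ring.
  rewrite ler_wpM2l ?mulr_ge0 ?(ltW e0)// lerD2r ler_wpM2r//.
have q0 : 0 < r / 2 / (C + 1) by rewrite divr_gt0// ltr_wpDl.
have ev : \forall n \near \oo, eps_ n < r / 2 / (C + 1).
  have /cvgrPdist_lt/(_ _ q0)[N _ hN] := cvg_eps; exists N => // m /hN /=.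
  by rewrite sub0r normrN ger0_norm// ltW// eps_gt0.
near=> n; apply: (le_lt_trans (main n)).
have : eps_ n * C < r / 2.
  apply: (@le_lt_trans _ _ (eps_ n * (C + 1))).
    by rewrite ler_wpM2l ?(ltW (eps_gt0 n))// lerDl.
  by rewrite -ltr_pdivlMr ?ltr_wpDl//; near: n; exact: ev.
lra.
Unshelve. all: by end_near. Qed.

Lemma cosM a b : cos a * cos b = 2^-1 * (cos (a - b) + cos (a + b)) :> R.
Proof. by rewrite cosB cosD; field. Qed.

Lemma poisson_shift_cvg u x : L1 u -> {for x, continuous u} ->
  int (fun t => u t * poisson (eps_ n) (t - x)) @[n --> \oo] --> u x.
Proof.
move=> hu cu; have := @approx_identity (fun t => u (t + x)) (L1_shift x hu).
rewrite add0r => h; rewrite (_ : (fun n => int _) =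
  fun n => int (fun t => u (t + x) * poisson (eps_ n) t)).
  apply: h.
  have cu2 : u (t + x) @[t --> (0 : R)] --> u (0 + x).
    rewrite add0r; apply: (@cvg_comp _ _ _ (fun t => t + x) u _ (nbhs x)); last exact: cu.
    have : t + x @[t --> (0 : R)] --> 0 + x by apply: cvgD; [exact: cvg_id|exact: cvg_cst].
    by rewrite add0r.
  exact: cu2.
apply/funext => n.
rewrite -(@int_shift _ (fun t => u t * poisson (eps_ n) (t - x)) x).
  by apply: eq_int => t; rewrite addrK.
have e0 := eps_gt0 n.
apply: L1Mb => //.
  have := mfun_comp (mfun_continuous (continuous_poisson e0)) (mfun_affine 1 (- x)).
  by under eq_fun do rewrite mul1r.
exists (2 * eps_ n / eps_ n ^+ 2) => t; rewrite ger0_norm ?poisson_ge0//.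
rewrite /poisson ler_wpM2l ?mulr_ge0// ?(ltW e0)// lef_pV2 ?posrE ?exprn_gt0//.
  by rewrite lerDl sqr_ge0.
by rewrite ltr_wpDr ?sqr_ge0 ?exprn_gt0.
Qed.

Lemma mfun2_cos : measurable_fun setT (fun z : R * R => cos (2 * pi * z.1 * z.2)).
Proof. by apply: (@mfun2_mul R cos); apply: mfun_continuous; exact: continuous_cos. Qed.

(** Fubini moves the transform onto the Abel weight, where the product formula for cosines yields
    two translated Poisson kernels: the cosine transform sees only the even part of [u]. *)
Lemma Fc_expabs u x n : L1 u ->
  int (fun y => Fc u y * (expabs (eps_ n) y * cos (2 * pi * x * y))) =
  2^-1 * (int (fun t => u t * poisson (eps_ n) (t - x)) +
          int (fun t => u t * poisson (eps_ n) (t + x))).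
Proof.
move=> hu; have e0 := eps_gt0 n; have [hE _] := expabs_int e0.
have cc a : L1 (fun y => expabs (eps_ n) y * cos (2 * pi * a * y)).
  by apply: L1Mb => //; [exact: mfun_cosl|exact: bounded_cos].
have mP : mfun (poisson (eps_ n)) by exact: (mfun_continuous (continuous_poisson e0)).
have bP : bounded (poisson (eps_ n)).
  exists (int (fun y => `|expabs (eps_ n) y|)) => t; rewrite poissonE//.
  apply: (le_trans (int_abs (cc t))); apply: int_le; [exact: L1_abs|exact: L1_abs|].
  by move=> y; rewrite normrM ler_piMr// cos_max.
have mPx a : mfun (fun t => poisson (eps_ n) (t + a)).
  have := mfun_comp mP (mfun_affine 1 a).
  by under eq_fun do rewrite mul1r.
have hP a : L1 (fun t => u t * poisson (eps_ n) (t + a)).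
  by apply: L1Mb => //; case: bP => M hM; exists M.
transitivity (int (fun y => (expabs (eps_ n) y * cos (2 * pi * x * y)) *
    int (fun t => u t * cos (2 * pi * t * y)))).
  by apply: eq_int => y; rewrite mulrC.
rewrite -(@fubini _ u (fun y => expabs (eps_ n) y * cos (2 * pi * x * y))
  (fun t y => cos (2 * pi * t * y)) 1 hu (cc x) mfun2_cos (fun t y => cos_max _)).
rewrite -(intD (hP (- x)) (hP x)) -(intZ _ (L1D (hP (- x)) (hP x))).
apply: eq_int => t; rewrite -mulrDr mulrCA; congr (_ * _).
rewrite !poissonE// -intD; [|exact: cc..]; rewrite -intZ; last by apply: L1D; exact: cc.
apply: eq_int => y; rewrite -mulrA [cos _ * cos _]mulrC cosM mulrCA -mulrDr.
by congr (_ * (_ * (cos _ + cos _))); ring.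
Qed.

Lemma expabs_cvg y : expabs (eps_ n) y @[n --> \oo] --> (1 : R).
Proof.
have h : - eps_ n * `|y| @[n --> \oo] --> - 0 * `|y|.
  by apply: cvgM; [apply: cvgN; exact: cvg_eps|exact: cvg_cst].
rewrite (_ : 1 = expR (- 0 * `|y|)); last by rewrite oppr0 mul0r expR0.
exact: (@cvg_comp nat R R (fun n => - eps_ n * `|y|) (@expR R) \oo
  (nbhs (- 0 * `|y|)) (nbhs (expR (- 0 * `|y|))) h (@continuous_expR R _)).
Qed.

(** The Abel means converge to the integral by dominated convergence and to [u x] by the approximate
    identity; the two limits must agree. *)
Theorem Fc_inversion u x : L1 u -> {for x, continuous u} ->
  (forall t, u (- t) = u t) -> L1 (Fc u) ->
  int (fun y => Fc u y * cos (2 * pi * x * y)) = u x.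
Proof.
move=> hu cu ue hF.
have L : int (fun y => Fc u y * (expabs (eps_ n) y * cos (2 * pi * x * y)))
    @[n --> \oo] --> int (fun y => Fc u y * cos (2 * pi * x * y)).
  apply: (int_dct (s := [::]) (g := fun y => `|Fc u y|) _ _ _ _ _).2.
  - move=> n; apply: mfunM; first exact: L1_mfun.
    by apply: mfunM; [apply: mfun_continuous; exact: continuous_expabs|exact: mfun_cosl].
  - by apply: mfunM; [exact: L1_mfun|exact: mfun_cosl].
  - exact: L1_abs.
  - move=> n y; rewrite normrM ler_piMr// normrM mulr_ile1//; last exact: cos_max.
    by rewrite ger0_norm ?expabs_ge0// expabs_le1// ltW// eps_gt0.
  - move=> y _; apply: cvgM; first exact: cvg_cst.
    rewrite -[X in _ --> X]mul1r; apply: cvgM; last exact: cvg_cst.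
    exact: expabs_cvg.
have cu' : {for - x, continuous u}.
  have h : u (- t) @[t --> - x] --> u x.
    apply: (@cvg_comp _ _ _ (fun t => - t) u _ (nbhs x)); last exact: cu.
    have : - t @[t --> - x] --> - - x by apply: cvgN; exact: cvg_id.
    by rewrite opprK.
  have h' : u t @[t --> - x] --> u (- x).
    by rewrite ue; under eq_fun do rewrite -ue; exact: h.
  exact: h'.
have L2 : int (fun y => Fc u y * (expabs (eps_ n) y * cos (2 * pi * x * y)))
    @[n --> \oo] --> 2^-1 * (u x + u (- x)).
  under eq_fun do rewrite Fc_expabs//.
  apply: cvgM; first exact: cvg_cst.
  apply: cvgD; first exact: poisson_shift_cvg.
  by have := poisson_shift_cvg hu cu'; under eq_fun do rewrite opprK.
have := cvg_unique _ L L2 => ->//.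
by rewrite ue; field.
Qed.

(** The Abel means of [Fc u] at 0 are Poisson averages of [u], hence bounded by a bound of [u]; by
    non-negativity they increase to the integral of [Fc u]. This supplies the integrability
    hypothesis of [Fc_inversion] for convolution squares. *)
Lemma Fc_nonneg_L1 S u : bcs S u -> (forall y, 0 <= Fc u y) -> L1 (Fc u).
Proof.
move=> hu F0.
have hu1 := bcs_L1 hu.
have cF := Fc_continuous hu1.
have [_ /bounded_ge0[M M0 hM] _] := hu.
apply/integrableP; split; first by apply/measurable_EFinP; exact: mfun_continuous.
have En n : L1 (fun y => Fc u y * expabs (eps_ n) y).
  have [hE _] := expabs_int (eps_gt0 n).
  apply: L1bM => //; first exact: mfun_continuous.
  by exists (int (fun x => `|u x|)) => y; exact: Fc_le.
have le n : int (fun y => Fc u y * expabs (eps_ n) y) <= M.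
  have := @Fc_expabs u 0 n hu1.
  under eq_int do rewrite mulr0 mul0r cos0 mulr1.
  under [X in X + _]eq_int do rewrite subr0.
  under [X in _ + X]eq_int do rewrite addr0.
  move=> ->; have [hP iP] := poisson_int (eps_gt0 n).
  have : int (fun t => u t * poisson (eps_ n) t) <= M.
    rewrite -[leRHS]mulr1 -iP -intZ//; apply: int_le; last first.
      move=> t; rewrite ler_wpM2r ?poisson_ge0// ?eps_gt0//.
      by rewrite (le_trans (ler_norm _)).
    - exact: L1Z.
    - by apply: L1bM => //; [case: hu|exists M].
  lra.
have mono : (\int[@lebesgue_measure R]_y (Fc u y * expabs (eps_ n) y)%:E
     @[n --> \oo] --> \int[@lebesgue_measure R]_y (Fc u y)%:E)%E.
  have := @cvg_monotone_convergence _ _ R (@lebesgue_measure R) setT measurableT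
     (fun n y => (Fc u y * expabs (eps_ n) y)%:E).
  rewrite (_ : (fun x => limn _) = (fun y => (Fc u y)%:E)).
    apply.
    - by move=> n; apply/measurable_EFinP; exact: (L1_mfun (En n)).
    - by move=> n y _; rewrite lee_fin mulr_ge0// expabs_ge0.
    - move=> y _ m n mn; rewrite lee_fin ler_wpM2l// /expabs ler_expR !mulNr lerN2.
      by rewrite ler_wpM2r// /eps_ lef_pV2 ?posrE// ler_nat.
  apply/funext => y; apply/cvg_lim => //; apply: cvg_EFin; first exact: nearW.
  rewrite -[X in _ --> X]mulr1; apply: cvgM; first exact: cvg_cst.
  exact: expabs_cvg.
under eq_integral do rewrite /= ger0_norm//.
apply: (@le_lt_trans _ _ M%:E); last exact: ltry.
rewrite -(cvg_lim _ mono)//; apply: lime_le; first by apply/cvg_ex; eexists; exact: mono.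
by apply: nearW => n; rewrite L1EFin// lee_fin.
Qed.

End Inversion2.

(** * The Fejer-Riesz lemma *)

Section FejerRiesz.
Variable C : numClosedFieldType.
Implicit Types (p q : {poly C}) (z : C).

Lemma circle_conj z : `|z| = 1 -> z^* = z^-1.
Proof.
move=> z1; have z0 : z != 0 by rewrite -normr_eq0 z1 oner_eq0.
by apply: (mulfI z0); rewrite -normCK z1 expr1n divff.
Qed.

(** Cayley transform: the points [(1 + 'i * t) / (1 - 'i * t)] for natural numbers [t] are distinct
    and lie on the circle, so no angles are needed in an abstract closed field. *)
Lemma circle_infinite (n : nat) : exists s : seq C,
  [/\ size s = n, uniq s & forall z, z \in s -> `|z| = 1].
Proof.
pose d (t : nat) : C := 1 - 'i * t%:R.
have dn (t : nat) : (d t)^* = 1 + 'i * t%:R.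
  by rewrite /d rmorphB rmorph1 rmorphM /= conjCi conjC_nat mulNr opprK.
have d0 (t : nat) : d t != 0.
  apply/eqP => h; have := dn t; rewrite h rmorph0 => h2.
  have : d t + (1 + 'i * t%:R) = 2 by rewrite /d; ring.
  by rewrite h -h2 addr0 => /esym/eqP; rewrite pnatr_eq0.
pose f (t : nat) : C := (d t)^* / d t.
exists [seq f t | t <- iota 0 n]; split.
- by rewrite size_map size_iota.
- rewrite map_inj_uniq ?iota_uniq// => t u; rewrite /f => /eqP.
  rewrite eqr_div ?d0// !dn /d => /eqP h.
  have {}h : 'i * (t%:R - u%:R) = 0 :> C.
    have : 2 * ('i * (t%:R - u%:R)) = (1 + 'i * t%:R) * (1 - 'i * u%:R) -
       (1 + 'i * u%:R) * (1 - 'i * t%:R) :> C by ring.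
    rewrite h subrr => /eqP; rewrite mulf_eq0 pnatr_eq0/= => /eqP; exact.
  move: h => /eqP; rewrite mulf_eq0 (negbTE (neq0Ci _))/= subr_eq0 eqr_nat.
  by move/eqP.
- move=> _ /mapP[t _ ->]; rewrite /f normf_div norm_conjC divff//.
  by rewrite normr_eq0 d0.
Qed.

Lemma circle_poly_eq p q : (forall z, `|z| = 1 -> p.[z] = q.[z]) -> p = q.
Proof.
move=> h; apply/eqP; rewrite -subr_eq0; apply/negPn/negP => nz.
have [s [ss us hs]] := circle_infinite (size (p - q)).
have := max_poly_roots nz _ us; rewrite ss ltnn => H.
suff : false by []; apply: H; apply/allP => z /hs z1.
by rewrite /root hornerD hornerN h// subrr.
Qed.

(** Conjugate reciprocal polynomial. On the unit circle its value is [z ^+ N] times the conjugate of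
    [q.[z]]. *)
Definition revp (N : nat) q : {poly C} := \poly_(i < N.+1) (q`_(N - i))^*.

Lemma revp_horner N q z : (size q <= N.+1)%N -> z != 0 ->
  (revp N q).[z] = z ^+ N * (q.[(z^-1)^*])^*.
Proof.
move=> sq z0; rewrite horner_poly (horner_coef_wide _ sq) rmorph_sum mulr_sumr.
rewrite (reindex_inj rev_ord_inj)/=; apply: eq_bigr => i _.
have iN : (i <= N)%N by rewrite -ltnS.
rewrite subSS subKn// rmorphM rmorphXn /= conjCK mulrCA; congr (_ * _).
apply: (mulIf (expf_neq0 i z0)).
by rewrite -exprD subnK// exprVn divfK// expf_neq0.
Qed.

(** Induction on [N]. Being real on the circle after division by [z ^+ N], [p] equals its conjugate
    reciprocal, so each nonzero root [al] comes with its mirror image [be] in the circle. Strict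
    positivity keeps roots off the circle, so the two are distinct; splitting off the pair divides
    by the square of [|z - al|] and lowers [N] by one. *)
Theorem fejer_riesz_circle N p : (size p <= N.*2.+1)%N ->
  (forall z, `|z| = 1 -> 0 < p.[z] / z ^+ N) ->
  exists2 q : {poly C}, (size q <= N.+1)%N &
    forall z, `|z| = 1 -> p.[z] / z ^+ N = `|q.[z]| ^+ 2.
Proof.
elim: N p => [|N IH] p sp pos.
  have pE := size1_polyC sp.
  have c0 : 0 <= p`_0.
    have := pos 1 (normr1 _); rewrite expr0 divr1 pE hornerC => /ltW.
    by rewrite coefC.
  exists (sqrtC p`_0)%:P; first by rewrite size_polyC; case: (_ != 0).
  move=> z _; rewrite expr0 divr1 {1}pE !hornerC ger0_norm ?sqrtC_ge0//.
  by rewrite sqrtCK.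
have nz z : `|z| = 1 -> z != 0 by move=> z1; rewrite -normr_eq0 z1 oner_eq0.
have pS : p = revp N.+1.*2 p.
  apply: circle_poly_eq => z z1; rewrite revp_horner ?nz//.
  rewrite -circle_conj// conjCK.
  have [r r0 ->] : exists2 r : C, 0 < r & p.[z] = r * z ^+ N.+1.
    by exists (p.[z] / z ^+ N.+1); [exact: pos|rewrite divfK// expf_neq0// nz].
  have rr : r^* = r by apply/CrealP/gtr0_real.
  rewrite rmorphM rmorphXn /= rr (circle_conj z1) mulrCA.
  congr (_ * _); rewrite -addnn exprD exprVn -mulrA divff ?mulr1//.
  by rewrite expf_neq0// nz.
have pc k : (k <= N.+1.*2)%N -> p`_k = (p`_(N.+1.*2 - k))^*.
  by move=> hk; rewrite {1}pS coef_poly ltnS hk.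
(* By the symmetry [pc] the constant and the leading coefficient vanish together. A factor ['X] is
   then divided out: the size bound drops by two and [N] by one. *)
have [p00|p00] := eqVneq p`_0 0.
  have sp2 : (size p <= N.+1.*2)%N.
    apply/leq_sizeP => j; rewrite leq_eqVlt => /predU1P[<-|hj].
      by rewrite pc// subnn p00 rmorph0.
    by apply: (leq_sizeP _ _ sp).
  have /factor_theorem[p1 p1E] : root p 0 by rewrite /root horner_coef0 p00.
  rewrite subr0 in p1E.
  have [p10|p10] := eqVneq p1 0.
    by have := pos 1 (normr1 _); rewrite p1E p10 mul0r horner0 mul0r ltxx.
  have sp1 : (size p1 <= N.*2.+1)%N.
    by move: sp2; rewrite p1E size_mulX// doubleS ltnS.
  have E z : `|z| = 1 -> p.[z] / z ^+ N.+1 = p1.[z] / z ^+ N.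
    move=> z1; rewrite p1E hornerMX exprSr invfM mulrA.
    by rewrite -!mulrA; congr (_ * _); rewrite [X in z * X]mulrC mulrA divff ?mul1r// nz.
  have [z z1|q sq hq] := IH p1 sp1; first by rewrite -E// pos.
  by exists q; [exact: leqW|move=> z z1; rewrite E// hq].
have top : p`_N.+1.*2 != 0.
  by apply: contra p00 => /eqP h; rewrite pc// subn0 h rmorph0.
have spE : size p = N.+1.*2.+1.
  apply/eqP; rewrite eqn_leq sp/= ltnNge; apply: contra top => h.
  by apply/eqP; apply: (leq_sizeP _ _ h).
have /closed_rootP[al ral] : size p != 1%N by rewrite spE.
have al0 : al != 0.
  by apply: contra p00 => /eqP a0; move: ral; rewrite a0 /root horner_coef0.
have al1 : `|al| != 1.
  apply/eqP => a1; have := pos al a1.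
  by move/eqP: ral => ->; rewrite mul0r ltxx.
pose be := (al^*)^-1.
have be0 : be != 0 by rewrite invr_eq0 conjC_eq0.
have beal : be - al != 0.
  rewrite subr_eq0; apply: contra al1 => /eqP h.
  rewrite -(@eqrXn2 _ 2)// ?expr1n; apply/eqP.
  by rewrite normCK -{1}h /be mulVf// conjC_eq0.
have rbe : p.[be] = 0.
  rewrite pS revp_horner// ?spE// (_ : (be^-1)^* = al); last by rewrite /be invrK conjCK.
  by move/eqP: ral => ->; rewrite rmorph0 mulr0.
have /factor_theorem[p1 p1E] := ral.
have /factor_theorem[p2 p2E] : root p1 be.
  move: rbe; rewrite p1E hornerM hornerXsubC => /eqP.
  by rewrite mulf_eq0 (negbTE beal) orbF.
have p2n0 : p2 != 0.
  by apply/eqP => h; move: spE; rewrite p1E p2E h !mul0r size_poly0.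
(* On the circle [z - al] times [z - be] equals [- be * z] times the squared modulus of [z - al];
   the scalar in front of [p2] is [- be], and the extra [z] accounts for the lower power of [z]. *)
pose p3 := (- (al^*)^-1) *: p2.
have sp3 : (size p3 <= N.*2.+1)%N.
  rewrite (leq_trans (size_scale_leq _ _))//.
  have := spE; rewrite p1E p2E !size_Mmonic ?monicXsubC//; last first.
    by rewrite mulf_neq0// polyXsubC_eq0.
  by rewrite !size_XsubC !addn2/= => -[->].
have zal z : `|z| = 1 -> z - al != 0.
  move=> z1; rewrite subr_eq0; apply: contra al1 => /eqP <-; exact/eqP.
have E z : `|z| = 1 -> p3.[z] / z ^+ N = p.[z] / z ^+ N.+1 / `|z - al| ^+ 2.
  move=> z1; rewrite /p3 p1E p2E !hornerM hornerZ !hornerXsubC normCK rmorphB /=.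
  rewrite (circle_conj z1) exprS.
  have a0 : al^* != 0 by rewrite conjC_eq0.
  have z0 := nz z z1; have za := zal z z1.
  have h : z^-1 - al^* != 0.
    by have : (z - al)^* != 0; [rewrite conjC_eq0|rewrite rmorphB /= (circle_conj z1)].
  rewrite /be; move: (al^*) a0 h => ab a0 h.
  have zn : z ^+ N != 0 by rewrite expf_neq0.
  have h' : 1 - ab * z != 0.
    have -> : 1 - ab * z = z * (z^-1 - ab) by rewrite mulrBr divff// mulrC.
    by rewrite mulf_neq0.
  have -> : z^-1 - ab = (1 - ab * z) / z by field.
  by field; rewrite za h' a0 z0 zn.
have [z z1|q sq hq] := IH p3 sp3.
  by rewrite E// divr_gt0 ?pos// exprn_gt0// normr_gt0 zal.
exists (q * ('X - al%:P)).
  have [->|q0] := eqVneq q 0; first by rewrite mul0r size_poly0.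
  by rewrite size_Mmonic ?monicXsubC// size_XsubC addn2/= ltnS.
move=> z z1; rewrite hornerM hornerXsubC normrM exprMn -hq// E//.
by rewrite divfK// expf_neq0// normr_eq0 zal.
Qed.

(** On the circle the conjugate of [q.[z]] is the value of [revp N q] divided by [z ^+ N], so the
    factorization becomes the polynomial identity [p = q * revp N q]; its coefficient at [N + k] is
    the stated sum. *)
Theorem fejer_riesz_coef N p : (size p <= N.*2.+1)%N ->
  (forall z, `|z| = 1 -> 0 < p.[z] / z ^+ N) ->
  exists q : {poly C}, forall k, (k <= N)%N ->
    p`_(N + k) = \sum_(k <= i < N.+1) q`_i * (q`_(i - k))^*.
Proof.
move=> sp pos; have [q sq hq] := fejer_riesz_circle sp pos; exists q => k kN.
have pE : p = q * revp N q.
  apply: circle_poly_eq => z z1.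
  have z0 : z != 0 by rewrite -normr_eq0 z1 oner_eq0.
  rewrite hornerM revp_horner// -circle_conj// conjCK mulrCA -normCK -hq//.
  by rewrite mulrC divfK// expf_neq0.
rewrite pE coefM.
rewrite -(big_mkord xpredT (fun j => q`_j * (revp N q)`_(N + k - j))).
rewrite (@big_cat_nat _ _ _ k) //=; last by rewrite leqW// leq_addl.
rewrite big_nat big1 ?add0r; last first.
  by move=> i /= ik; rewrite coef_poly ifF ?mulr0//; lia.
rewrite (@big_cat_nat _ _ _ N.+1) //=; last 2 first.
- exact: leqW.
- by rewrite ltnS leq_addr.
rewrite [X in _ + X]big_nat [X in _ + X]big1 ?addr0; last first.
  move=> i /andP[iN _]; rewrite (_ : q`_i = 0) ?mul0r//.
  by apply: (leq_sizeP _ _ sq).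
rewrite !big_nat; apply: eq_bigr => i /andP[ki iN]; rewrite ltnS in iN.
rewrite coef_poly ifT; last by lia.
by congr (_ * (q`_ _)^*); lia.
Qed.

End FejerRiesz.

(** * Test functions and convolution squares *)

Section TestFunctionClass.
Variable R : realType.
Implicit Types (f g h u v phi : R -> R) (a b c e x y t S M sigma : R).

Definition evenf f : Prop := forall x, f (- x) = f x.
(** Stronger than continuity almost everywhere: only finitely many exceptional points, as for
    piecewise formulas. *)
Definition ae_continuous f : Prop :=
  exists s : seq R, forall x, x \notin s -> {for x, continuous f}.

Definition conv f g y : R := int (fun t => f t * g (y - t)).

Lemma mfun_sub_l g y : mfun g -> mfun (fun t => g (y - t)).
Proof.
move=> mg; have := mfun_comp mg (mfun_affine (-1) y).
by under eq_fun do rewrite mulN1r addrC.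
Qed.

Lemma mfun_sub_r g y : mfun g -> mfun (fun t => g (t - y)).
Proof.
move=> mg; have := mfun_comp mg (mfun_affine 1 (- y)).
by under eq_fun do rewrite mul1r.
Qed.

Lemma L1_conv S f g y : bcs S f -> bcs S g -> L1 (fun t => f t * g (y - t)).
Proof.
move=> hf [mg [M hM] _]; apply: L1Mb; [exact: bcs_L1 hf|exact: mfun_sub_l|].
by exists M.
Qed.

Lemma conv_supp S f g y : bcs S f -> bcs S g -> 2 * S < `|y| -> conv f g y = 0.
Proof.
move=> [_ _ f0] [_ _ g0] hy; rewrite -[RHS](@int0 R); apply: eq_int => t.
have [ht|ht] := ltP S `|t|; first by rewrite f0// mul0r.
rewrite g0 ?mulr0//; have := ler_normB y (y - t).
rewrite opprB addrC subrK => h1; have := ler_distD 0 y t.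
rewrite subr0 sub0r normrN => h2; have := ler_normD (y - t) t; rewrite subrK; lra.
Qed.

(** Measurability of a convolution is a by-product of Fubini, which wants an integrable outer
    factor; hence the window. *)
Lemma mfun_conv f g : L1 f -> mfun g -> bounded g -> forall S,
  mfun (fun y => ind (- S) S y * conv f g y).
Proof.
move=> hf mg [M hM] S.
have := @L1_fubini R (ind (- S) S) f (fun y t => g (y - t)) (L1_ind _ _) hf
  (mfun2_sub mg) M (fun y t => hM _).
exact: L1_mfun.
Qed.

Lemma conv_bcs S f g : bcs S f -> bcs S g -> bcs (2 * S) (conv f g).
Proof.
move=> hf hg; have [mg /bounded_ge0[M M0 hM] g0] := hg.
split.
- rewrite (_ : conv f g = fun y => ind (- (2 * S)) (2 * S) y * conv f g y).
    by apply: mfun_conv => //; [exact: bcs_L1 hf|exists M].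
  apply/funext => y; rewrite /ind; have [h|h] := leP `|y| (2 * S).
    by rewrite -ler_norml h mul1r.
  by rewrite (conv_supp hf hg h) mulr0.
- exists (int (fun t => M * `|f t|)) => y.
  have hL := L1_conv y hf hg.
  apply: (le_trans (int_abs hL)); apply: int_le; first exact: L1_abs.
    by apply: L1Z; exact: (L1_abs (bcs_L1 hf)).
  by move=> t; rewrite normrM mulrC ler_wpM2r.
- by move=> y; exact: conv_supp.
Qed.

Lemma conv_continuous S f g : bcs S f -> bcs S g -> ae_continuous g ->
  continuous (conv f g).
Proof.
move=> hf hg [s hs] y0; have [mg /bounded_ge0[M M0 hM] _] := hg.
apply: (@int_continuous R [seq y0 - z | z <- s] (fun y t => f t * g (y - t))
  (fun t => M * `|f t|)).
- by move=> y; exact: (L1_mfun (L1_conv y hf hg)).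
- by apply: L1Z; exact: (L1_abs (bcs_L1 hf)).
- by move=> y t; rewrite normrM mulrC ler_wpM2r.
- move=> t ht; apply: cvgM; first exact: cvg_cst.
  have nts : y0 - t \notin s.
    by apply: contra ht => h; apply/mapP; exists (y0 - t) => //; rewrite subKr.
  apply: (@cvg_comp _ _ _ (fun y => y - t) g _ (nbhs (y0 - t))); last exact: hs.
  by apply: cvgB; [exact: cvg_id|exact: cvg_cst].
Qed.

Lemma conv_even S f g : bcs S f -> bcs S g -> evenf f -> evenf g -> evenf (conv f g).
Proof.
move=> hf hg fe ge y; rewrite /conv -(int_opp (L1_conv (- y) hf hg)).
by apply: eq_int => t; rewrite fe -ge opprB addrC opprK.
Qed.

Lemma Fc_shift S g t x : bcs S g -> evenf g ->
  int (fun y => g (y - t) * cos (2 * pi * y * x)) = cos (2 * pi * t * x) * Fc g x.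
Proof.
move=> hg ge; have hg1 := bcs_L1 hg.
have h1 : L1 (fun y => g (y - t) * cos (2 * pi * y * x)).
  by apply: L1_cos; exact: L1_shift.
have hs : L1 (fun y => g y * sin (2 * pi * y * x)).
  apply: L1Mb => //; last exact: bounded_sin.
  by under eq_fun do rewrite mulrAC; exact: mfun_sinl.
rewrite -(int_shift t h1).
transitivity (int (fun y => cos (2 * pi * t * x) * (g y * cos (2 * pi * y * x)) -
   sin (2 * pi * t * x) * (g y * sin (2 * pi * y * x)))).
  apply: eq_int => y; rewrite addrK.
  rewrite (_ : 2 * pi * (y + t) * x = 2 * pi * t * x + 2 * pi * y * x); last by ring.
  by rewrite cosD; ring.
have hc := L1_cos x hg1.
rewrite (intB (L1Z _ hc) (L1Z _ hs)) (intZ _ hc) (intZ _ hs).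
rewrite (@int_odd _ (fun y => g y * sin (2 * pi * y * x)))// ?mulr0 ?subr0//.
by move=> y; rewrite ge mulrN mulNr sinN mulrN.
Qed.

Lemma Fc_conv S f g x : bcs S f -> bcs S g -> evenf f -> evenf g ->
  Fc (conv f g) x = Fc f x * Fc g x.
Proof.
move=> hf hg fe ge; have [mg [M hM] g0] := hg; have [_ _ f0] := hf.
have hF : L1 (fun y => ind (- (2 * S)) (2 * S) y * cos (2 * pi * y * x)).
  by apply: L1_cos; exact: L1_ind.
have := @fubini R _ f (fun y t => g (y - t)) M hF (bcs_L1 hf) (mfun2_sub mg) (fun y t => hM _).
rewrite (_ : int (fun y => _ * int _) = Fc (conv f g) x); last first.
  apply: eq_int => y; rewrite -/(conv f g y) mulrC /ind.
  have [h|h] := leP `|y| (2 * S); first by rewrite -ler_norml h mul1r.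
  by rewrite (conv_supp hf hg h) !mul0r.
move=> ->; rewrite -intZr; last by apply: L1_cos; exact: bcs_L1 hf.
apply: eq_int => t; have [ht|ht] := ltP S `|t|; first by rewrite f0// !mul0r.
rewrite -mulrA -(Fc_shift t x hg ge); congr (_ * _); apply: eq_int => y.
rewrite mulrAC mulrC -mulrA mulrC -mulrA; congr (_ * _); rewrite mulrC /ind.
have [h|h] := leP `|y| (2 * S); first by rewrite -ler_norml h mulr1.
rewrite g0 ?mulr0//; have := ler_normD (y - t) t; rewrite subrK; lra.
Qed.

Lemma fourierE phi y : L1 phi -> evenf phi -> fourier phi y = (Fc phi y)%:C%C.
Proof.
move=> hphi pe; rewrite /fourier /cintegral; congr Complex.
  apply: eq_int => x.
  by rewrite /expi/= mul0r subr0 cosN.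
rewrite -/(int _) /expi/=.
have -> : (fun x => phi x * sin (- (2 * pi * x * y)) + 0 * cos (- (2 * pi * x * y))) =
   (fun x => phi x * sin (- (2 * pi * y) * x)).
  apply/funext => x; rewrite mul0r addr0; congr (_ * sin _); ring.
apply: int_odd.
  by apply: L1Mb => //; [exact: mfun_sinl|exact: bounded_sin].
by move=> x; rewrite pe mulrN sinN mulrN.
Qed.

Lemma convolutionE g y : evenf g ->
  convolution (fun x => (g x)%:C%C) (check (fun x => (g x)%:C%C)) y = (conv g g y)%:C%C.
Proof.
move=> ge; rewrite /convolution /cintegral /check; congr Complex.
  by apply: eq_int => t /=; rewrite oppr0 mulr0 subr0 ge.
rewrite -/(int _) -[RHS](@int0 R); apply: eq_int => t /=.
by rewrite oppr0 mulr0 mul0r addr0.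
Qed.

(** * Squares of transforms as test functions *)

Section Admissible.
Variables (S : R) (h : R -> R).
Hypotheses (hh : bcs S h) (he : evenf h) (hc : ae_continuous h).

Let u := conv h h.
(** The test function attached to [h]: its transform is [conv h h] ([Fc_sqF]). *)
Definition sqF x : R := Fc h x ^+ 2.

Lemma Fc_conv_sqF : Fc u = sqF.
Proof. by apply/funext => x; rewrite /u (Fc_conv x hh hh he he) /sqF expr2. Qed.

(** Instead of Plancherel: [sqF] is the transform of a convolution square and non-negative, so
    [Fc_nonneg_L1] applies. *)
Lemma L1_sqF : L1 sqF.
Proof.
rewrite -Fc_conv_sqF; apply: (Fc_nonneg_L1 (conv_bcs hh hh)) => y.
by rewrite -/u Fc_conv_sqF /sqF sqr_ge0.
Qed.

Lemma Fc_sqF y : Fc sqF y = u y.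
Proof.
have hu := conv_bcs hh hh.
rewrite -(@Fc_inversion R u y (bcs_L1 hu)).
- by rewrite Fc_conv_sqF; apply: eq_int => x; rewrite cos_comm.
- exact: (conv_continuous hh hh hc).
- exact: (conv_even hh hh he he).
- by rewrite Fc_conv_sqF; exact: L1_sqF.
Qed.

Lemma sqF_even : evenf sqF.
Proof. by move=> x; rewrite /sqF Fc_even. Qed.

Lemma sqF_continuous : continuous sqF.
Proof.
move=> x; rewrite /sqF; under eq_fun do rewrite expr2.
by apply: cvgM; exact: (Fc_continuous (bcs_L1 hh)).
Qed.

Lemma test_function_sqF : int h != 0 -> test_function S sqF.
Proof.
move=> h0; split.
- exact: sqF_continuous.
- exact: L1_sqF.
- exact: sqF_even.
- split; first by move=> x; exact: sqr_ge0.
  by rewrite /sqF Fc0 exprn_even_gt0.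
- rewrite /fsupport; apply: (@subset_trans _ (closure (`[- (2 * S), 2 * S]%classic))); last first.
    exact: itv_closed.
  apply: closure_subset => y /=.
  rewrite fourierE; [|exact: L1_sqF|exact: sqF_even].
  rewrite Fc_sqF in_itv/= -ler_norml; apply: contraR; rewrite -ltNge => hy.
  by rewrite /u (conv_supp hh hh hy).
Qed.

End Admissible.

(** * Fourier inversion for a general test function *)

Section TestFunction.
Variables (sigma : R) (phi : R -> R).
Hypothesis (ht : test_function sigma phi).

Lemma test_L1 : L1 phi. Proof. by case: ht. Qed.
Lemma test_even : evenf phi. Proof. by case: ht. Qed.
Lemma test_gt0 : 0 < phi 0. Proof. by case: ht => _ _ _ []. Qed.
Lemma test_ge0 x : 0 <= phi x. Proof. by case: ht => _ _ _ []. Qed.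

Lemma test_supp y : 2 * sigma < `|y| -> Fc phi y = 0.
Proof.
have [_ _ _ _ hs] := ht => hy; apply/eqP; apply: contraTT hy => nz.
have /hs : fsupport (fourier phi) y.
  apply: subset_closure => /=; rewrite fourierE; [|exact: test_L1|exact: test_even].
  by apply: contra nz => /eqP[->].
by rewrite /= in_itv/= -ler_norml -leNgt.
Qed.

Lemma test_bcs : bcs (2 * sigma) (Fc phi).
Proof.
split.
- exact: (mfun_continuous (Fc_continuous (test_L1))).
- by exists (int (fun x => `|phi x|)) => y; apply: Fc_le; exact: test_L1.
- exact: test_supp.
Qed.

Lemma test_inversion x : phi x = int (fun y => Fc phi y * cos (2 * pi * x * y)).
Proof.
rewrite (@Fc_inversion R phi x)//.
- exact: test_L1.
- by case: ht => + _ _ _ _; apply.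
- exact: test_even.
- exact: (bcs_L1 test_bcs).
Qed.

Lemma test_at0 : int (Fc phi) = phi 0.
Proof. by rewrite test_inversion; apply: eq_int => y; rewrite mulr0 mul0r cos0 mulr1. Qed.

End TestFunction.
End TestFunctionClass.

(** * The quadratic form *)

Section QuadraticForm.
Variable R : realType.
Implicit Types (f g h : R -> R) (a b c e x y z t S M : R).

Definition ker t : R := 2^-1 * ind (-1) 1 t.
Definition Kop f x : R := int (fun y => f y * ker (x - y)).
Definition Kform f g : R := int (fun x => f x * Kop g x).
Definition Bform e f g : R := int (fun x => f x * g x) + e * Kform f g.
(** Used beside [conv f f] because the step functions of the sampling are not even; for even [f] the
    two agree ([acor_conv]). *)
Definition acor f z : R := int (fun x => f x * f (x - z)).

Lemma kerN t : ker (- t) = ker t.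
Proof. by rewrite /ker /ind lerN2 lerNl andbC. Qed.

Lemma ker_ge0 t : 0 <= ker t.
Proof. by rewrite /ker mulr_ge0// ind_ge0. Qed.

Lemma ker_le t : `|ker t| <= 2^-1.
Proof. by rewrite /ker normrM ger0_norm// ler_piMr// ind_le1. Qed.

Lemma mfun_ker : mfun ker.
Proof. by apply: mfunM; [exact: mfun_cst|exact: mfun_ind]. Qed.

Lemma L1_Kop f x : L1 f -> L1 (fun y => f y * ker (x - y)).
Proof.
move=> hf; apply: L1Mb => //; first by apply: mfun_sub_l; exact: mfun_ker.
by exists 2^-1 => y; exact: ker_le.
Qed.

Lemma KopD f g x : L1 f -> L1 g -> Kop (fun y => f y + g y) x = Kop f x + Kop g x.
Proof.
move=> hf hg; rewrite /Kop -intD; [|exact: L1_Kop..].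
by apply: eq_int => y; rewrite mulrDl.
Qed.

Lemma KopZ c f x : L1 f -> Kop (fun y => c * f y) x = c * Kop f x.
Proof.
move=> hf; rewrite /Kop -intZ; last exact: L1_Kop.
by apply: eq_int => y; rewrite mulrA.
Qed.

Lemma Kop_le f x : L1 f -> `|Kop f x| <= 2^-1 * int (fun y => `|f y|).
Proof.
move=> hf; apply: (le_trans (int_abs (L1_Kop x hf))).
rewrite -intZ; last exact: L1_abs.
apply: int_le; [exact: (L1_abs (L1_Kop x hf))|by apply: L1Z; exact: L1_abs|].
by move=> y; rewrite normrM mulrC ler_wpM2r// ker_le.
Qed.

Lemma L1_Kform f g : L1 f -> L1 g -> L1 (fun x => f x * Kop g x).
Proof.
move=> hf hg; apply: (L1_fubini (k := fun x y => ker (x - y)) hf hg).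
  by apply: mfun2_sub; exact: mfun_ker.
by move=> x y; exact: ker_le.
Qed.

Lemma Kform_sym f g : L1 f -> L1 g -> Kform f g = Kform g f.
Proof.
move=> hf hg; rewrite /Kform /Kop.
rewrite (@fubini R f g (fun x y => ker (x - y)) 2^-1 hf hg); last first.
- by move=> x y; exact: ker_le.
- by apply: mfun2_sub; exact: mfun_ker.
apply: eq_int => y; congr (_ * _); apply: eq_int => x; congr (_ * _).
by rewrite -kerN opprB.
Qed.

Lemma KformDr f g h : L1 f -> L1 g -> L1 h ->
  Kform f (fun y => g y + h y) = Kform f g + Kform f h.
Proof.
move=> hf hg hh; rewrite /Kform -intD; [|exact: L1_Kform..].
by apply: eq_int => x; rewrite KopD// mulrDr.
Qed.

Lemma KformZr c f g : L1 f -> L1 g -> Kform f (fun y => c * g y) = c * Kform f g.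
Proof.
move=> hf hg; rewrite /Kform -intZ; last exact: L1_Kform.
by apply: eq_int => x; rewrite KopZ// mulrCA.
Qed.

Lemma Bform_sub S e c f g : bcs S f -> bcs S g ->
  Bform e (fun x => g x - c * f x) (fun x => g x - c * f x) =
  Bform e g g - 2 * c * Bform e g f + c ^+ 2 * Bform e f f.
Proof.
move=> hf hg; have f1 := bcs_L1 hf; have g1 := bcs_L1 hg.
have cf1 := L1Z (- c) f1.
pose d x := g x + - c * f x.
have -> : (fun x => g x - c * f x) = d by apply/funext => x; rewrite /d mulNr.
have d1 : L1 d by exact: L1D.
have Ed h : L1 h -> Kform h d = Kform h g - c * Kform h f.
  by move=> h1; rewrite (KformDr h1 g1 cf1) (KformZr _ h1 f1) mulNr.
have gg := bcs_L1 (bcsM hg hg); have gf := bcs_L1 (bcsM hg hf).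
have ff := bcs_L1 (bcsM hf hf).
have Ei : int (fun x => d x * d x) =
   int (fun x => g x * g x) - 2 * c * int (fun x => g x * f x) +
   c ^+ 2 * int (fun x => f x * f x).
  rewrite -(intZ _ gf) -(intZ _ ff) -(intB gg (L1Z _ gf)).
  rewrite -(intD (L1B gg (L1Z _ gf)) (L1Z _ ff)).
  by apply: eq_int => x; rewrite /d; ring.
rewrite /Bform Ei (Ed d d1) (Kform_sym d1 g1) (Ed g g1) (Kform_sym d1 f1) (Ed f f1).
rewrite (Kform_sym f1 g1).
move: (Kform g g) (Kform g f) (Kform f f) => k1 k2 k3.
by move: (int _) (int _) (int _) => i1 i2 i3; ring.
Qed.

Lemma acor0 f : acor f 0 = int (fun x => f x * f x).
Proof. by apply: eq_int => x; rewrite subr0. Qed.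

Lemma L1_acor S f g z : bcs S f -> bcs S g -> L1 (fun x => f x * g (x - z)).
Proof.
move=> hf [mg bg _]; apply: L1Mb; [exact: bcs_L1 hf|exact: mfun_sub_r|].
by case: bg => M hM; exists M.
Qed.

Lemma acorN S f z : bcs S f -> acor f (- z) = acor f z.
Proof.
move=> hf; rewrite /acor -(int_shift (- z) (L1_acor (- z) hf hf)).
by apply: eq_int => x; rewrite opprK subrK mulrC.
Qed.

Lemma acor_int S a b f : bcs S f ->
  int (fun z => ind a b z * acor f z) =
  int (fun x => f x * int (fun z => ind a b z * f (x - z))).
Proof.
move=> hf; have [mf [M hM] _] := hf.
rewrite (@fubini R f (ind a b) (fun x z => f (x - z)) M (bcs_L1 hf) (L1_ind _ _))//.
exact: mfun2_sub.
Qed.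

(** With [acor0] and [Kform_acor] this makes the squared integral and both parts of [Bform] linear
    functionals of the autocorrelation, so they can be followed through a limit of sums of
    autocorrelations. *)
Lemma acor_total S f : bcs S f ->
  int (fun z => ind (- (2 * S)) (2 * S) z * acor f z) = int f ^+ 2.
Proof.
move=> hf; rewrite (acor_int _ _ hf) expr2 -intZr; last exact: bcs_L1 hf.
have [_ _ f0] := hf.
apply: eq_int => x; have [hx|hx] := ltP S `|x|; first by rewrite f0// !mul0r.
congr (_ * _); rewrite -(int_reflect x (bcs_L1 hf)); apply: eq_int => z.
rewrite /ind; have [h|h] := leP `|z| (2 * S); first by rewrite -ler_norml h mul1r.
rewrite f0 ?mulr0//; have := ler_normB x (x - z).
by rewrite (_ : x - (x - z) = z); [lra|ring].
Qed.

Lemma Kform_acor S f : bcs S f ->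
  Kform f f = 2^-1 * int (fun z => ind (-1) 1 z * acor f z).
Proof.
move=> hf; rewrite (acor_int _ _ hf) /Kform -intZ; last first.
  have [mf [M hM] _] := hf.
  apply: (L1_fubini (k := fun x z => f (x - z)) (bcs_L1 hf) (L1_ind _ _)).
    exact: mfun2_sub.
  by move=> x y; exact: hM.
apply: eq_int => x; rewrite mulrCA; congr (_ * _); rewrite /Kop.
have h1 : L1 (fun z => ind (-1) 1 z * f (x - z)).
  by apply: L1Mb; [exact: L1_ind|apply: mfun_sub_l; case: hf|case: hf => _ [M hM] _; exists M].
rewrite -intZ// -(int_reflect x (L1Z 2^-1 h1)); apply: eq_int => y.
by rewrite /ker subKr; ring.
Qed.

Lemma acor_conv f : evenf f -> acor f = conv f f.
Proof.
move=> fe; apply/funext => z; apply: eq_int => x; congr (_ * _).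
by rewrite -fe opprB.
Qed.

Lemma ind_window a b x y : ind a b y * ker (x - y) =
  2^-1 * ind (Num.max a (x - 1)) (Num.min b (x + 1)) y.
Proof.
rewrite /ker mulrCA; congr (_ * _); rewrite /ind ge_max le_min.
have -> : (-1 <= x - y) = (y <= x + 1) by apply/idP/idP => h; lra.
have -> : (x - y <= 1) = (x - 1 <= y) by apply/idP/idP => h; lra.
by case: (a <= y); case: (y <= b); case: (y <= x + 1); case: (x - 1 <= y);
  rewrite /= ?mulr1 ?mulr0 ?mul0r.
Qed.

(* Weight for the Schur test: averaging [4 - x ^ 2] over a unit neighbourhood
   inside the interval multiplies it by at most 11/12. *)
Definition parab x : R := ind (- (3 / 2)) (3 / 2) x * (4 - x ^+ 2).

Lemma parab_bcs : bcs (3 / 2) parab.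
Proof.
have mp : mfun (fun x : R => 4 - x ^+ 2).
  apply: mfunD; first exact: mfun_cst.
  under eq_fun do rewrite -mulN1r expr2; apply: mfunM; first exact: mfun_cst.
  by apply: mfunM; exact: measurable_id.
split; first by apply: mfunM => //; exact: mfun_ind.
  exists 4 => x; rewrite /parab /ind; case: andP => [[h1 h2]|_]; last first.
    by rewrite mul0r normr0.
  by rewrite mul1r ger0_norm; nra.
move=> x hx; rewrite /parab /ind -ler_norml leNgt hx mul0r//.
Qed.

Lemma Kop_parab x : `|x| <= 3 / 2 -> Kop parab x <= 11 / 12 * (4 - x ^+ 2).
Proof.
rewrite ler_norml => /andP[x1 x2].
pose A y : R := 4 * y - 3^-1 * y ^+ 3.
have dA y : is_derive y (1 : R) A (4 - y ^+ 2).
  rewrite /A; under eq_fun do rewrite !exprS expr0 mulr1.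
  apply: (drv_eq (drvB (drv_lin 4 y) (drvZ 3^-1 (drvM (drv_id y) (drvM (drv_id y) (drv_id y)))))).
  by field.
have cp : continuous (fun y : R => 4 - y ^+ 2).
  move=> y; apply: cvgB; first exact: cvg_cst.
  by rewrite expr2; under eq_fun do rewrite expr2; apply: cvgM; exact: cvg_id.
set lo := Num.max (- (3 / 2)) (x - 1); set hi := Num.min (3 / 2) (x + 1).
have lohi : lo <= hi by rewrite /lo /hi ge_max !le_min; apply/andP; split; apply/andP; split; lra.
have -> : Kop parab x = 2^-1 * (A hi - A lo).
  rewrite -(int_ind_FTC lohi dA cp) -intZ; last first.
    have -> : (fun y => ind lo hi y * (4 - y ^+ 2)) =
       (fun y => 2 * (parab y * ker (x - y))).
      by apply/funext => y; rewrite /parab mulrAC ind_window -/lo -/hi; field.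
    by apply: L1Z; apply: L1_Kop; exact: bcs_L1 parab_bcs.
  by apply: eq_int => y; rewrite /parab mulrAC ind_window -/lo -/hi mulrA.
rewrite /lo /hi /A /Num.max /Num.min.
(* The cases tell which end of the unit window is clipped by the interval; both at once is
   impossible. Without clipping the average is [4 - 1/3 - x ^+ 2], and equality at [x = 0] gives the
   constant 11/12. *)
case: ifPn; rewrite -?leNgt => h1; case: ifPn; rewrite -?leNgt => h2.
- have h3 : 0 <= (x - 2^-1) * (3 / 2 - x) by apply: mulr_ge0; lra.
  have h4 : 0 <= (x - 2^-1) * ((x - 2^-1) * (3 / 2 - x)) by apply: mulr_ge0 => //; lra.
  lra.
- lra.
- have := sqr_ge0 x; lra.
- have h3 : 0 <= (- x - 2^-1) * (3 / 2 + x) by apply: mulr_ge0; lra.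
  have h4 : 0 <= (- x - 2^-1) * ((- x - 2^-1) * (3 / 2 + x)) by apply: mulr_ge0 => //; lra.
  lra.
Qed.

(** With [G] equal to [g ^+ 2] over the weight, the inequality of arithmetic and geometric means
    bounds [|g x * g y|] by half of [G x * parab y + parab x * G y]. Integrated against the
    symmetric kernel this is [Kform G parab], and [Kop_parab] turns [Kop parab] into 11/12 of the
    weight. *)
Lemma Kform_schur g : bcs (3 / 2) g ->
  `|Kform g g| <= 11 / 12 * int (fun x => g x * g x).
Proof.
move=> hg; have g1 := bcs_L1 hg; have P1 := bcs_L1 parab_bcs.
have [mg [M hM] g0] := hg.
have pos x : `|x| <= 3 / 2 -> 7 / 4 <= 4 - x ^+ 2.
  by rewrite ler_norml => /andP[h1 h2]; nra.
(* Agrees with [4 - x ^+ 2] on the interval, where that is at least 7/4, and stays positive outside,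
   so its inverse is continuous and bounded on the whole line. *)
pose q x : R := 7 / 4 + `|9 / 4 - x ^+ 2|.
have q1 x : 1 <= q x by rewrite /q; have := normr_ge0 (9 / 4 - x ^+ 2); lra.
have mq : mfun (fun x => (q x)^-1).
  apply: mfun_continuous => x; apply: cvgV; first by rewrite gt_eqF// (lt_le_trans ltr01).
  apply: cvgD; first exact: cvg_cst.
  apply: cvg_norm; apply: cvgB; first exact: cvg_cst.
  by rewrite expr2; under eq_fun do rewrite expr2; apply: cvgM; exact: cvg_id.
pose G x := g x * g x * (q x)^-1.
have hG : bcs (3 / 2) G.
  apply: bcsMb => //; first exact: bcsM.
  by exists 1 => x; rewrite ger0_norm ?invr_ge0 ?(le_trans ler01)// invf_le1// (lt_le_trans ltr01).
have G1 := bcs_L1 hG.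
have G0 x : 0 <= G x.
  rewrite /G; apply: mulr_ge0; first by rewrite -expr2 sqr_ge0.
  by rewrite invr_ge0 (le_trans ler01).
have qE x : `|x| <= 3 / 2 -> q x = 4 - x ^+ 2.
  by rewrite /q => /pos h; rewrite ger0_norm; lra.
have Gq x : `|x| <= 3 / 2 -> G x * (4 - x ^+ 2) = g x * g x.
  by move=> hx; rewrite /G -qE// divfK// gt_eqF// (lt_le_trans ltr01).
have ptw x y : `|g x * g y| <= 2^-1 * (G x * parab y + parab x * G y).
  have [hx|hx] := ltP (3 / 2) `|x|.
    have [_ _ p0] := parab_bcs; rewrite (g0 x hx) (p0 x hx) !mul0r normr0 addr0.
    by rewrite /G (g0 x hx) !mul0r mulr0.
  have [hy|hy] := ltP (3 / 2) `|y|.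
    have [_ _ p0] := parab_bcs; rewrite (g0 y hy) (p0 y hy) !mulr0 normr0 add0r.
    by rewrite /G (g0 y hy) !mul0r !mulr0.
  have px := pos x hx; have py := pos y hy.
  rewrite /parab /ind -!ler_norml hx hy !mul1r.
  have eu := Gq _ hx; have ev := Gq _ hy.
  have Gx0 := G0 x; have Gy0 := G0 y; rewrite normrM.
  have eu' : G x * (4 - x ^+ 2) = `|g x| * `|g x| by rewrite eu -normrM ger0_norm// -expr2 sqr_ge0.
  have ev' : G y * (4 - y ^+ 2) = `|g y| * `|g y| by rewrite ev -normrM ger0_norm// -expr2 sqr_ge0.
  move: (normr_ge0 (g x)) (normr_ge0 (g y)) eu' ev'.
  move: (4 - x ^+ 2) (4 - y ^+ 2) px py (`|g x|) (`|g y|) => p r p0 r0 u v u0 v0 eu' ev'.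
  have sq : (u * v) ^+ 2 = (G x * r) * (p * G y).
    by rewrite exprMn !expr2 -eu' -ev'; ring.
  have h : 0 <= (G x * r - p * G y) ^+ 2 by exact: sqr_ge0.
  have s0 : 0 <= G x * r + p * G y by rewrite addr_ge0// mulr_ge0//; lra.
  have : (u * v) ^+ 2 <= (2^-1 * (G x * r + p * G y)) ^+ 2.
    rewrite sq; nra.
  by rewrite ler_sqr// nnegrE mulr_ge0.
have hGP : L1 (fun x => G x * Kop parab x) by exact: L1_Kform.
have hPG : L1 (fun x => parab x * Kop G x) by exact: L1_Kform.
have step1 : `|Kform g g| <= Kform G parab.
  apply: (le_trans (int_abs (L1_Kform g1 g1))).
  have -> : Kform G parab = int (fun x => 2^-1 * (G x * Kop parab x + parab x * Kop G x)).
    rewrite intZ; last exact: L1D.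
    rewrite intD// -/(Kform G parab) -/(Kform parab G) (Kform_sym P1 G1).
    by field.
  apply: int_le; [exact: (L1_abs (L1_Kform g1 g1))|by apply: L1Z; exact: L1D|move=> x].
  have hKg := L1_Kop x g1; have hKG := L1_Kop x G1; have hKP := L1_Kop x P1.
  have hS := L1D (L1Z (G x) hKP) (L1Z (parab x) hKG).
  rewrite /Kop -(intZ (g x) hKg) -(intZ (G x) hKP) -(intZ (parab x) hKG).
  rewrite -(intD (L1Z (G x) hKP) (L1Z (parab x) hKG)) -(intZ 2^-1 hS).
  apply: (le_trans (int_abs (L1Z _ hKg))); apply: int_le.
  - exact: (L1_abs (L1Z _ hKg)).
  - exact: (L1Z _ hS).
  - move=> y; rewrite mulrA normrM (ger0_norm (ker_ge0 _)).
    have := ptw x y; have := ker_ge0 (x - y); move: (ker _) => w w0 h.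
    rewrite (_ : _ * (_ + _) = 2^-1 * (G x * parab y + parab x * G y) * w); last by ring.
    by rewrite ler_wpM2r.
apply: (le_trans step1); rewrite -intZ; last exact: (bcs_L1 (bcsM hg hg)).
apply: int_le => //; first by apply: L1Z; exact: (bcs_L1 (bcsM hg hg)).
move=> x; have [hx|hx] := ltP (3 / 2) `|x|.
  by rewrite /G (g0 x hx) !mul0r mulr0.
by rewrite -Gq// mulrCA ler_wpM2l// Kop_parab.
Qed.

Lemma Bform_coercive e g : `|e| <= 1 -> bcs (3 / 2) g ->
  12^-1 * int (fun x => g x * g x) <= Bform e g g.
Proof.
move=> he hg; rewrite /Bform.
have h1 := Kform_schur hg.
have h2 : `|e * Kform g g| <= `|Kform g g| by rewrite normrM ler_piMl.
have h3 := ler_norm (- (e * Kform g g)); rewrite normrN in h3.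
lra.
Qed.

End QuadraticForm.

(** * Quantitative coercivity around a solution of the Euler-Lagrange equation *)

Section Stability.
Variable R : realType.
Implicit Types (f g h : R -> R) (c x y z t S M w d : R).

Variables (e sigma kappa : R) (f0 : R -> R).
Hypotheses (he : `|e| <= 1) (s0 : 0 < sigma) (s32 : sigma < 3 / 2).
Hypothesis hf0 : bcs sigma f0.
Hypothesis f0_edge : forall x, sigma <= `|x| -> f0 x = 0.
Hypothesis EL : forall x, `|x| < sigma -> f0 x + e * Kop f0 x = kappa.
Hypothesis I0n0 : int f0 != 0.

Let f01 : L1 f0 := bcs_L1 hf0.
Let I0 := int f0.
(** Defect of the Euler-Lagrange equation. It is zero for [|x| < sigma]; what counts is its size on
    the margin up to [w], which the approximating functions may reach. *)
Let E x : R := f0 x + e * Kop f0 x - kappa.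

Lemma EL_defect_zero x : `|x| < sigma -> E x = 0.
Proof. by move=> /EL; rewrite /E => ->; rewrite subrr. Qed.

Lemma EL_defect_bound : exists2 M, 0 <= M & forall x, `|E x| <= M.
Proof.
have [_ [M hM] _] := hf0.
exists (M + 2^-1 * int (fun y => `|f0 y|) + `|kappa|); last first.
  move=> x; apply: (le_trans (ler_normB _ _)); rewrite lerD2r.
  apply: (le_trans (ler_normD _ _)); rewrite lerD// normrM.
  by apply: (le_trans _ (Kop_le x f01)); rewrite ler_piMl.
rewrite addr_ge0// addr_ge0//; first exact: le_trans (hM 0).
by rewrite mulr_ge0//; apply: int_ge0.
Qed.

Lemma mfun_EL_defect : mfun (fun x => ind (- (3 / 2)) (3 / 2) x * E x).
Proof.
have [mf _ _] := hf0.
have -> : (fun x => ind (- (3 / 2)) (3 / 2) x * E x) =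
  (fun x => ind (- (3 / 2)) (3 / 2) x * (f0 x - kappa) +
     e * (ind (- (3 / 2)) (3 / 2) x * conv f0 (@ker R) x)).
  apply/funext => x; rewrite /E (_ : conv f0 (@ker R) x = Kop f0 x)//.
  by move: (ind _ _ x) (Kop f0 x) => u k; ring.
apply: mfunD.
  by apply: mfunM; [exact: mfun_ind|apply: mfunD => //; exact: mfun_cst].
apply: mfunM; first exact: mfun_cst.
apply: mfun_conv => //; first exact: mfun_ker.
by exists 2^-1 => x; exact: ker_le.
Qed.

(** Pairing the equation with [g]: inside the interval the defect vanishes, and only the two margins
    of length [w - sigma] contribute. *)
Lemma Bform_EL w g : sigma <= w -> w <= 3 / 2 -> bcs w g ->
  Bform e g f0 - kappa * int g =
  int (fun x => g x * (ind (- (3 / 2)) (3 / 2) x * E x *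
                        (ind (- w) (- sigma) x + ind sigma w x))).
Proof.
have s0' := s0.
move=> sw w32 hg; have g1 := bcs_L1 hg; have [_ _ g0] := hg.
have h1 := bcs_L1 (bcsM hg (bcs_le sw hf0)).
have h2 := L1_Kform g1 f01.
rewrite /Bform /Kform -(intZ e h2) -(intD h1 (L1Z e h2)) -(intZ kappa g1).
rewrite -(intB (L1D h1 (L1Z e h2)) (L1Z kappa g1)).
apply: eq_int => x.
have -> : g x * f0 x + e * (g x * Kop f0 x) - kappa * g x = g x * E x by rewrite /E; ring.
have [hx|hx] := ltP w `|x|; first by rewrite (g0 x hx) !mul0r.
have [hs|hs] := ltP `|x| sigma.
  by rewrite EL_defect_zero// !mulr0 mul0r !mulr0.
have -> : ind (- (3 / 2)) (3 / 2) x = 1 by rewrite /ind -ler_norml (le_trans hx w32).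
have -> : ind (- w) (- sigma) x + ind sigma w x = 1.
  move: hx hs; rewrite /ind; have [x0|x0] := leP 0 x.
    rewrite ger0_norm// => xw sx; rewrite sx xw.
    have -> : (x <= - sigma) = false by apply/negbTE; rewrite -ltNge; lra.
    by rewrite andbF add0r.
  rewrite ltr0_norm// => xw sx.
  have -> : (sigma <= x) = false by apply/negbTE; rewrite -ltNge; lra.
  have -> : (- w <= x) by lra. have -> : (x <= - sigma) by lra.
  by rewrite addr0.
by rewrite mul1r mulr1.
Qed.

Lemma Bform_f0 : Bform e f0 f0 = kappa * I0.
Proof.
apply/eqP; rewrite -subr_eq0; apply/eqP.
rewrite (Bform_EL (lexx _) (ltW s32) hf0) -[RHS](@int0 R); apply: eq_int => x.
have [hs|hs] := ltP `|x| sigma; last by rewrite (f0_edge hs) mul0r.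
by rewrite EL_defect_zero// !mulr0 mul0r mulr0.
Qed.

(** By [Bform_f0] this product is [Bform e f0 f0], so it is positive unless [f0] has mean square 0,
    which its nonzero integral excludes. It is what later shows that the scaling factors do not
    vanish. *)
Lemma kappaI0_gt0 : 0 < kappa * I0.
Proof.
rewrite -Bform_f0; apply: (lt_le_trans _ (Bform_coercive he (bcs_le (ltW s32) hf0))).
have hi : bcs (3 / 2) (ind (- (3 / 2)) (3 / 2) : R -> R) by exact: bcs_indS.
have hf := bcs_le (ltW s32) hf0.
have F0 : 0 <= int (fun x => f0 x * f0 x).
  by apply: int_ge0 => x; rewrite -expr2 sqr_ge0.
rewrite mulr_gt0// lt_neqAle F0 andbT eq_sym; apply/eqP => F.
have ii : int f0 = int (fun x => f0 x * ind (- (3 / 2)) (3 / 2) x).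
  by apply: eq_int => x; rewrite {1}(bcs_ind hf) mulrC.
have i2 : int (fun x : R => ind (- (3 / 2)) (3 / 2) x ^+ 2) = 3.
  rewrite -[RHS](_ : 3 / 2 - - (3 / 2) = 3); last by lra.
  rewrite -int_ind; last by lra.
  by apply: eq_int => x; rewrite /ind; case: (_ && _); rewrite ?expr1n ?expr0n.
have n0 : 0 < `|int f0| by rewrite normr_gt0.
(* With mean square 0, Young's inequality against the window of length 3 and with this parameter
   gives [|int f0| <= |int f0| / 4], a contradiction. *)
have c0 : 0 < 6 / `|int f0| by rewrite divr_gt0.
have := int_young hf hi c0.
rewrite -ii i2 (_ : int (fun x => f0 x ^+ 2) = 0) ?mulr0 ?add0r; last first.
  by rewrite -[RHS]F; apply: eq_int => x; rewrite expr2.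
rewrite invf_div => h.
have : 2^-1 * (`|int f0| / 6 * 3) = `|int f0| / 4 by field.
move=> h2; rewrite h2 in h; lra.
Qed.

(** Coercivity applied to [g - c * f0] with [c = int g / I0], the multiple of [f0] that has the
    integral of [g]. After expansion the cross term is known up to the defect on the margins, whose
    mean square is at most a constant times [w - sigma]; Young's inequality with parameter [d] pays
    for it. *)
Lemma stability : exists2 M, 0 <= M & forall w g d,
  sigma <= w -> w <= 3 / 2 -> bcs w g -> 0 < d ->
  12^-1 * int (fun x => (g x - int g / I0 * f0 x) * (g x - int g / I0 * f0 x)) <=
  Bform e g g - kappa / I0 * int g ^+ 2 +
  `|int g / I0| * (d * int (fun x => g x * g x) + d^-1 * (M * (w - sigma))).
Proof.
have s0' := s0.
have [M M0 hM] := EL_defect_bound; exists (2 * M ^+ 2); first by rewrite mulr_ge0// sqr_ge0.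
move=> w g d sw w32 hg d0; have hf := bcs_le sw hf0.
set c := int g / I0.
have hb : bcs (3 / 2) (fun x => g x - c * f0 x).
  by apply: (bcs_le w32); apply: bcsB => //; exact: bcsZ.
apply: (le_trans (Bform_coercive he hb)).
rewrite (Bform_sub e c hf hg) Bform_f0.
pose D x := ind (- (3 / 2)) (3 / 2) x * E x * (ind (- w) (- sigma) x + ind sigma w x).
have BE : Bform e g f0 - kappa * int g = int (fun x => g x * D x) by exact: Bform_EL.
have hD : bcs w D.
  have [wi1 wi2] : bcs w (ind (- w) (- sigma) : R -> R) /\ bcs w (ind sigma w : R -> R).
    by split; apply: bcs_indr; lra.
  rewrite /D; under eq_fun do rewrite mulrC; apply: bcsMb; first exact: bcsD.
    exact: mfun_EL_defect.
  exists M => x; rewrite normrM (le_trans _ (hM x))//.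
  by rewrite ler_piMl// ind_le1.
have D2 : int (fun x => D x ^+ 2) <= 2 * M ^+ 2 * (w - sigma).
  have -> : 2 * M ^+ 2 * (w - sigma) =
    int (fun x => M ^+ 2 * (ind (- w) (- sigma) x + ind sigma w x)).
    rewrite intZ; last by apply: L1D; exact: L1_ind.
    by rewrite intD; [|exact: L1_ind..]; rewrite !int_ind; [ring|lra|lra].
  apply: int_le.
  - exact: (bcs_L1 (bcsM hD hD)).
  - by apply: L1Z; apply: L1D; exact: L1_ind.
  - move=> x; rewrite /D !exprMn.
    have q : (ind (- w) (- sigma) x + ind sigma w x) ^+ 2 <= ind (- w) (- sigma) x + ind sigma w x.
      rewrite /ind; case: (boolP (_ && (x <= - sigma))) => [/andP[_ h]|_].
        have -> : (sigma <= x) = false by apply/negbTE; rewrite -ltNge; lra.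
        by rewrite addr0 expr1n.
      by rewrite add0r; case: (_ && _); rewrite ?expr1n ?expr0n.
    apply: ler_pM => //; first by rewrite mulr_ge0// sqr_ge0.
      exact: sqr_ge0.
    rewrite -exprMn -(real_normK (num_real (_ * _))) lerXn2r ?nnegrE//.
    rewrite normrM (le_trans _ (hM x))//.
    by rewrite ler_piMl// ind_le1.
have hY := int_young hg hD d0; rewrite -BE in hY.
have hg2 : int (fun x => g x ^+ 2) = int (fun x => g x * g x).
  by apply: eq_int => x; rewrite expr2.
rewrite hg2 in hY.
have hY2 : `|Bform e g f0 - kappa * int g| <=
   2^-1 * (d * int (fun x => g x * g x) + d^-1 * (2 * M ^+ 2 * (w - sigma))).
  apply: (le_trans hY); rewrite ler_wpM2l// lerD2l ler_wpM2l// invr_ge0 ltW//.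
set Y := d * _ + _ in hY2 *.
set B := Bform e g f0 in hY2 *.
have -> : Bform e g g - 2 * c * B + c ^+ 2 * (kappa * I0) =
  Bform e g g - kappa / I0 * int g ^+ 2 - 2 * (c * (B - kappa * int g)).
  rewrite /c; field; exact: I0n0.
rewrite lerD2l.
have : `|c * (B - kappa * int g)| <= `|c| * (2^-1 * Y) by rewrite normrM ler_wpM2l.
have := ler_norm (- (c * (B - kappa * int g))); rewrite normrN; lra.
Qed.

(** Expansion of the autocorrelation around [c * f0]: two cross terms and a remainder, each bounded
    by Young's inequality for translates. A residual small in mean square thus forces [acor g] to be
    pointwise close to [c ^+ 2 * acor f0]. *)
Lemma acor_perturb S g c d z : sigma <= S -> bcs S g -> 0 < d ->
  let r := fun x => g x - c * f0 x in
  `|acor g z - c ^+ 2 * acor f0 z| <=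
  `|c| * (d * int (fun x => f0 x * f0 x) + d^-1 * int (fun x => r x * r x)) +
  int (fun x => r x * r x).
Proof.
move=> sS hg d0; set r := (fun x => g x - c * f0 x); rewrite [X in is_true X]/=.
have hf := bcs_le sS hf0.
have hr : bcs S r by apply: bcsB => //; exact: bcsZ.
have sh h y : bcs S h -> bcs (S + `|y|) (fun x => h (x - y)).
  case=> mh [K hK] h0; split; first exact: mfun_sub_r.
    by exists K => x; exact: hK.
  move=> x hx; apply: h0; have := ler_distD 0 x y.
  have := ler_normD (x - y) y; rewrite subrK; lra.
have wd h y : bcs S h -> bcs (S + `|y|) h by apply: bcs_le; rewrite lerDl.
have sq h y : L1 (fun x => h x * h x) ->
    int (fun x => h (x - y) ^+ 2) = int (fun x => h x * h x).
  by move=> h1; rewrite -(int_shift (- y) h1).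
have sq0 h : int (fun x => h x ^+ 2) = int (fun x => h x * h x).
  by apply: eq_int => x; rewrite expr2.
have ff := bcs_L1 (bcsM hf hf); have rr := bcs_L1 (bcsM hr hr).
have y1 := int_young (wd _ z hf) (sh _ z hr) d0.
have di0 : 0 < d^-1 by rewrite invr_gt0.
have y2 := int_young (wd _ z hr) (sh _ z hf) di0; rewrite invrK in y2.
have y3 := int_young (wd _ z hr) (sh _ z hr) ltr01; rewrite invr1 !mul1r in y3.
rewrite (sq _ z rr) sq0 in y1; rewrite (sq _ z ff) sq0 in y2.
rewrite (sq _ z rr) sq0 in y3.
have l1 := L1_acor z hf hr; have l2 := L1_acor z hr hf; have l3 := L1_acor z hr hr.
have l0 := L1_acor z hf hf.
have -> : acor g z - c ^+ 2 * acor f0 z = c * (int (fun x => f0 x * r (x - z)) +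
    int (fun x => r x * f0 (x - z))) + int (fun x => r x * r (x - z)).
  rewrite /acor -(intZ _ l0) -(intB (L1_acor z hg hg) (L1Z _ l0)) -(intD l1 l2).
  rewrite -(intZ _ (L1D l1 l2)) -(intD (L1Z _ (L1D l1 l2)) l3).
  by apply: eq_int => x; rewrite /r; ring.
apply: (le_trans (ler_normD _ _)); apply: lerD; last by lra.
rewrite normrM ler_wpM2l//; apply: (le_trans (ler_normD _ _)).
lra.
Qed.

End Stability.

(** * Passage to the limit for sums of two autocorrelations *)

Section Limit.
Variable R : realType.
Implicit Types (c x y z t M d : R).

Variables (e sigma kappa : R) (f0 : R -> R).
Hypotheses (he : `|e| <= 1) (s0 : 0 < sigma) (s32 : sigma < 3 / 2).
Hypothesis hf0 : bcs sigma f0.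
Hypothesis f0_edge : forall x, sigma <= `|x| -> f0 x = 0.
Hypothesis EL : forall x, `|x| < sigma -> f0 x + e * Kop f0 x = kappa.
Hypothesis I0n0 : int f0 != 0.
Let I0 := int f0.

Variables (a b : nat -> R -> R) (w : nat -> R) (v : R -> R).
Hypotheses (ha : forall m, bcs (w m) (a m)) (hb : forall m, bcs (w m) (b m)).
Hypotheses (w1 : forall m, sigma <= w m) (w2 : forall m, w m <= 3 / 2).
Hypothesis w3 : forall m, w m - sigma <= eps_ R m ^+ 2.
Let V m z := acor (a m) z + acor (b m) z.
Hypothesis Vv : forall z, V m z @[m --> \oo] --> v z.
Hypothesis Vb : exists M, forall m z, `|V m z| <= M.
Hypotheses (mv : mfun v) (v0 : forall z, 3 < `|z| -> v z = 0).

Let J := v 0 + e * (2^-1 * int (fun z => ind (-1) 1 z * v z)).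
Let T := int v.

Let mV m : mfun (fun z => ind (- 3) 3 z * V m z).
Proof.
have h g S : bcs S g -> mfun (fun z => ind (- 3) 3 z * acor g z).
  move=> hg; have [mg [M hM] _] := hg.
  have -> : (fun z => ind (- 3) 3 z * acor g z) =
     (fun z => ind (- 3) 3 z * conv g (fun t => g (- t)) z).
    apply/funext => z; congr (_ * _); apply: eq_int => x; congr (_ * g _); ring.
  apply: mfun_conv; first exact: bcs_L1 hg.
    by have := mfun_sub_l 0 mg; under eq_fun do rewrite sub0r.
  by exists M => x.
under eq_fun do rewrite mulrDr.
by apply: mfunD; [exact: h (ha m)|exact: h (hb m)].
Qed.

Let int_cvg p q : - 3 <= p -> q <= 3 ->
  int (fun z => ind p q z * V m z) @[m --> \oo] --> int (fun z => ind p q z * v z).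
Proof.
move=> p3 q3; have [M hM] := Vb.
apply: (int_dct (s := [::]) (g := fun z => M * ind p q z) _ _ _ _ _).2.
- move=> m; rewrite (_ : (fun z => _) = fun z => ind p q z * (ind (- 3) 3 z * V m z)).
    by apply: mfunM; [exact: mfun_ind|exact: mV].
  apply/funext => z; rewrite mulrA; congr (_ * _); rewrite /ind.
  case: (boolP ((p <= z) && _)) => [/andP[h1 h2]|_]; last by rewrite mul0r.
  by rewrite (le_trans p3 h1) (le_trans h2 q3) mul1r.
- by apply: mfunM => //; exact: mfun_ind.
- by apply: L1Z; exact: L1_ind.
- by move=> m z; rewrite normrM (ger0_norm (ind_ge0 _ _ _)) mulrC ler_wpM2r// ind_ge0.
- by move=> z _; apply: cvgM; [exact: cvg_cst|exact: Vv].
Qed.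

Let t_ m := int (a m) ^+ 2 + int (b m) ^+ 2.
Let s_ m := int (fun x => a m x * a m x) + int (fun x => b m x * b m x).
Let k_ m := Kform (a m) (a m) + Kform (b m) (b m).

Let vE : int (fun z => ind (- 3) 3 z * v z) = T.
Proof.
apply: eq_int => z; rewrite /ind; have [h|h] := leP `|z| 3.
  by rewrite -ler_norml h mul1r.
by rewrite v0// mulr0.
Qed.

Let L1V p q m : L1 (fun z => ind p q z * acor (a m) z) /\
  L1 (fun z => ind p q z * acor (b m) z).
Proof.
have h g : bcs (w m) g -> L1 (fun z => ind p q z * acor g z).
  move=> hg; have [mg [M hM] _] := hg.
  apply: (@L1_fubini R (ind p q) g (fun z x => g (x - z)) (L1_ind p q) (bcs_L1 hg) _ M).
    have := mfun2_sub mg => hs.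
    apply: (@measurableT_comp _ _ _ _ _ _ (fun z : R * R => g (z.1 - z.2)) _
      (fun z : R * R => (z.2, z.1)) hs).
    by apply/measurable_fun_pairP; split; [exact: measurable_snd|exact: measurable_fst].
  by move=> z x; exact: hM.
by split; apply: h.
Qed.

Let t_cvg : t_ m @[m --> \oo] --> T.
Proof.
rewrite -vE; have := @int_cvg (- 3) 3 (lexx _) (lexx _).
rewrite (_ : (fun m => int _) = t_)//; apply/funext => m.
have [l1 l2] := L1V (- 3) 3 m; rewrite /V; under eq_int do rewrite mulrDr.
have E3 : 2 * (3 / 2) = 3 :> R by field.
have ta := acor_total (bcs_le (w2 m) (ha m)).
have tb := acor_total (bcs_le (w2 m) (hb m)).
by rewrite E3 in ta tb; rewrite intD// ta tb.
Qed.

Let s_cvg : s_ m @[m --> \oo] --> v 0.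
Proof.
have := Vv (z := 0); rewrite (_ : (fun m => V m 0) = s_)//.
by apply/funext => m; rewrite /V !acor0.
Qed.

Let k_cvg : k_ m @[m --> \oo] --> 2^-1 * int (fun z => ind (-1) 1 z * v z).
Proof.
have h : 2^-1 * int (fun z => ind (-1) 1 z * V m z) @[m --> \oo]
   --> 2^-1 * int (fun z => ind (-1) 1 z * v z).
  by apply: cvgM; [exact: cvg_cst|apply: int_cvg; lra].
rewrite (_ : k_ = fun m => 2^-1 * int (fun z => ind (-1) 1 z * V m z))//.
apply/funext => m; have [l1 l2] := L1V (-1) 1 m.
rewrite /k_ (Kform_acor (ha m)) (Kform_acor (hb m)) -mulrDr -intD//.
by congr (_ * _); apply: eq_int => z; rewrite /V mulrDr.
Qed.

Let r_ g x := g x - int g / I0 * f0 x.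
Let X_ m := int (fun x => r_ (a m) x * r_ (a m) x) + int (fun x => r_ (b m) x * r_ (b m) x).
Let c_ g := int g / I0.

(** The error terms of [stability] carry absolute values of coefficients that need not converge;
    [|c| <= (1 + c ^+ 2) / 2] bounds them through [t_ m], which does. *)
Let cc m : `|c_ (a m)| + `|c_ (b m)| <= 1 + t_ m / I0 ^+ 2.
Proof.
have h g : `|c_ g| <= 2^-1 * (1 + int g ^+ 2 / I0 ^+ 2).
  rewrite /c_ -expr_div_n -(real_normK (num_real (_ / I0))).
  have := sqr_ge0 (1 - `|int g / I0|); nra.
apply: (le_trans (lerD (h (a m)) (h (b m)))); rewrite -mulrDr /t_ mulrDl.
have p0 : 0 <= int (a m) ^+ 2 / I0 ^+ 2 by rewrite divr_ge0 ?sqr_ge0.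
have q0 : 0 <= int (b m) ^+ 2 / I0 ^+ 2 by rewrite divr_ge0 ?sqr_ge0.
lra.
Qed.

(** The two inequalities of [stability] are added, with Young parameter [eps_ R m]. Neither [a m]
    nor [b m] need converge, but [s_], [k_] and [t_] are linear in [V m] and do, and the error terms
    tend to 0. *)
Let Z_ex : exists2 Z : nat -> R, Z m @[m --> \oo] --> J - kappa / I0 * T &
  forall m, 12^-1 * X_ m <= Z m.
Proof.
have [M M0 hM] := stability he s0 s32 hf0 f0_edge EL I0n0.
exists (fun m => s_ m + e * k_ m - kappa / I0 * t_ m +
   (1 + t_ m / I0 ^+ 2) * (eps_ R m * s_ m + 2 * eps_ R m * M)).
  rewrite -[X in _ --> X]addr0; apply: cvgD.
    apply: cvgB; last by apply: cvgM; [exact: cvg_cst|exact: t_cvg].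
    by apply: cvgD; [exact: s_cvg|apply: cvgM; [exact: cvg_cst|exact: k_cvg]].
  rewrite -[X in _ --> X](mulr0 (1 + T / I0 ^+ 2)); apply: cvgM.
    apply: cvgD; first exact: cvg_cst.
    by apply: cvgM; [exact: t_cvg|exact: cvg_cst].
  rewrite (_ : 0 = 0 * v 0 + 2 * 0 * M); last by ring.
  apply: cvgD; first by apply: cvgM; [exact: cvg_eps|exact: s_cvg].
  by apply: cvgM; [apply: cvgM; [exact: cvg_cst|exact: cvg_eps]|exact: cvg_cst].
move=> m; have e0 := eps_gt0 R m.
have ga := hM (w m) (a m) (eps_ R m) (w1 m) (w2 m) (ha m) e0.
have gb := hM (w m) (b m) (eps_ R m) (w1 m) (w2 m) (hb m) e0.
have sq g : 0 <= int (fun x => g x * g x).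
  by apply: int_ge0 => x; rewrite -expr2 sqr_ge0.
(* Here the margin must be of order [eps_ R m ^+ 2]: one factor is lost to the inverse Young
   parameter and one remains. *)
have ew : (eps_ R m)^-1 * (M * (w m - sigma)) <= eps_ R m * M.
  rewrite mulrCA mulrC ler_wpM2r// ler_pdivrMl// -expr2; exact: w3.
have ca := normr_ge0 (c_ (a m)); have cb := normr_ge0 (c_ (b m)).
have ia := sq (a m); have ib := sq (b m).
have hc := cc m.
have e1 : eps_ R m * int (fun x => a m x * a m x) + (eps_ R m)^-1 * (M * (w m - sigma)) <=
   eps_ R m * s_ m + 2 * eps_ R m * M.
  apply: lerD; first by rewrite ler_wpM2l ?(ltW e0)// /s_ lerDl.
  apply: (le_trans ew); rewrite -mulrA ler_peMl ?mulr_ge0 ?(ltW e0)// ler1n//.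
have e2 : eps_ R m * int (fun x => b m x * b m x) + (eps_ R m)^-1 * (M * (w m - sigma)) <=
   eps_ R m * s_ m + 2 * eps_ R m * M.
  apply: lerD; first by rewrite ler_wpM2l ?(ltW e0)// /s_ lerDr.
  apply: (le_trans ew); rewrite -mulrA ler_peMl ?mulr_ge0 ?(ltW e0)// ler1n//.
set U := eps_ R m * s_ m + 2 * eps_ R m * M in e1 e2 *.
have U0 : 0 <= U.
  by rewrite /U addr_ge0// ?mulr_ge0 ?(ltW e0)// /s_ addr_ge0.
clearbody U.
have f1 : 12^-1 * int (fun x => r_ (a m) x * r_ (a m) x) <=
  Bform e (a m) (a m) - kappa / I0 * int (a m) ^+ 2 + `|c_ (a m)| * U.
  exact: le_trans ga (lerD (lexx _) (ler_wpM2l ca e1)).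
have f2 : 12^-1 * int (fun x => r_ (b m) x * r_ (b m) x) <=
  Bform e (b m) (b m) - kappa / I0 * int (b m) ^+ 2 + `|c_ (b m)| * U.
  exact: le_trans gb (lerD (lexx _) (ler_wpM2l cb e2)).
have f3 := ler_wpM2r U0 hc.
rewrite /X_ mulrDr; apply: (le_trans (lerD f1 f2)).
apply: (le_trans _ (lerD (lexx _) f3)); rewrite /Bform /s_ /k_ /t_.
move: (int (fun x => a m x * a m x)) (int (fun x => b m x * b m x)).
move: (Kform (a m) (a m)) (Kform (b m) (b m)) (int (a m)) (int (b m)).
move: `|c_ (a m)| `|c_ (b m)| (kappa / I0) => u1 u2 u3 u4 u5 u6 u7 u8 u9.
by rewrite le_eqVlt; apply/orP; left; apply/eqP; ring.
Qed.

Let X_ge0 m : 0 <= X_ m.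
Proof.
by rewrite /X_ addr_ge0//; apply: int_ge0 => x; rewrite -expr2 sqr_ge0.
Qed.

Lemma limit_bound : kappa / I0 * T <= J.
Proof.
have [Z Zc hZ] := Z_ex; rewrite -subr_ge0.
have l0 : (fun=> 0 : R) @ \oo --> (0 : R) by exact: cvg_cst.
have := ler_cvg_to l0 Zc; apply.
apply: nearW => m; apply: (le_trans _ (hZ m)).
by rewrite mulr_ge0 ?X_ge0.
Qed.

Lemma limit_unique z : J = kappa / I0 * T -> v z = T / I0 ^+ 2 * acor f0 z.
Proof.
move=> JT; have [Z Zc hZ] := Z_ex; rewrite JT subrr in Zc.
set F := int (fun x => f0 x * f0 x).
have F0 : 0 <= F by apply: int_ge0 => x; rewrite -expr2 sqr_ge0.
(* As [m] grows with the Young parameter [d] fixed, the residuals disappear and an error of order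
   [d] remains; only then is [d] made small. *)
have main d : 0 < d -> `|v z - T / I0 ^+ 2 * acor f0 z| <= (1 + T / I0 ^+ 2) * (d * F).
  move=> d0.
  have l1 : `|V m z - t_ m / I0 ^+ 2 * acor f0 z| @[m --> \oo] -->
     `|v z - T / I0 ^+ 2 * acor f0 z|.
    apply: cvg_norm; apply: cvgB; first exact: Vv.
    apply: cvgM; last exact: cvg_cst.
    by apply: cvgM; [exact: t_cvg|exact: cvg_cst].
  have l2 : (1 + t_ m / I0 ^+ 2) * (d * F + d^-1 * (12 * Z m)) + 12 * Z m @[m --> \oo] -->
     (1 + T / I0 ^+ 2) * (d * F + d^-1 * (12 * 0)) + 12 * 0.
    have l3 : 12 * Z m @[m --> \oo] --> 12 * (0 : R).
      by apply: cvgM; [exact: cvg_cst|exact: Zc].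
    apply: cvgD; last exact: l3.
    apply: cvgM.
      apply: cvgD; first exact: cvg_cst.
      by apply: cvgM; [exact: t_cvg|exact: cvg_cst].
    apply: cvgD; first exact: cvg_cst.
    by apply: cvgM; [exact: cvg_cst|exact: l3].
  have := ler_cvg_to l1 l2; rewrite !mulr0 !addr0; apply.
  apply: nearW => m.
  set A := int (fun x => r_ (a m) x * r_ (a m) x).
  set B := int (fun x => r_ (b m) x * r_ (b m) x).
  have pa : `|acor (a m) z - c_ (a m) ^+ 2 * acor f0 z| <=
      `|c_ (a m)| * (d * F + d^-1 * A) + A.
    exact: (acor_perturb hf0 (c_ (a m)) z (w1 m) (ha m) d0).
  have pb : `|acor (b m) z - c_ (b m) ^+ 2 * acor f0 z| <=
      `|c_ (b m)| * (d * F + d^-1 * B) + B.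
    exact: (acor_perturb hf0 (c_ (b m)) z (w1 m) (hb m) d0).
  have A0 : 0 <= A by apply: int_ge0 => x; rewrite -expr2 sqr_ge0.
  have B0 : 0 <= B by apply: int_ge0 => x; rewrite -expr2 sqr_ge0.
  have AB : A + B <= 12 * Z m by have := hZ m; rewrite /X_ -/A -/B; lra.
  have -> : V m z - t_ m / I0 ^+ 2 * acor f0 z =
    (acor (a m) z - c_ (a m) ^+ 2 * acor f0 z) + (acor (b m) z - c_ (b m) ^+ 2 * acor f0 z).
    by rewrite /V /t_ /c_; field; exact: I0n0.
  apply: (le_trans (ler_normD _ _)).
  have di : 0 <= d^-1 by rewrite invr_ge0 ltW.
  have q1 : `|c_ (a m)| * (d * F + d^-1 * A) <= `|c_ (a m)| * (d * F + d^-1 * (12 * Z m)).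
    by rewrite ler_wpM2l// lerD2l ler_wpM2l//; lra.
  have q2 : `|c_ (b m)| * (d * F + d^-1 * B) <= `|c_ (b m)| * (d * F + d^-1 * (12 * Z m)).
    by rewrite ler_wpM2l// lerD2l ler_wpM2l//; lra.
  have U0 : 0 <= d * F + d^-1 * (12 * Z m).
    by rewrite addr_ge0// mulr_ge0//; [exact: ltW|lra].
  have q3 := ler_wpM2r U0 (cc m).
  have fin p q r u t y k x x' : p * r <= p * y -> q * u <= q * y ->
      (p + q) * y <= t * y -> x + x' <= k -> p * r + x + (q * u + x') <= t * y + k.
    by move=> h1 h2 h3 h4; lra.
  exact: (le_trans (lerD pa pb) (fin _ _ _ _ _ _ _ _ _ q1 q2 q3 AB)).
apply/eqP; rewrite -subr_eq0 -normr_le0; apply/ler_addgt0Pr => r r0; rewrite add0r.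
set C := (1 + T / I0 ^+ 2) * F.
have [C0|C0] := leP C 0.
  have := main 1 ltr01; rewrite mul1r -/C => h; exact: (le_trans h (le_trans C0 (ltW r0))).
have rc : 0 < r / C by rewrite divr_gt0.
have := main _ rc; rewrite mulrCA -/C divfK// gt_eqF//.
Qed.

End Limit.

(** * Positive definiteness of samples, and the real form of the Fejer-Riesz lemma *)

Section Discretization.
Variable R : realType.
Implicit Types (f g phi : R -> R) (c x y z t th : R).

Lemma sum_diag (F : nat -> nat -> R) (k M : nat) :
  \sum_(i < M) \sum_(j < M) F i j * (nat_of_ord i == (j + k)%N)%:R =
  \sum_(k <= i < M) F i (i - k)%N.
Proof.
rewrite -(big_mkord xpredT (fun i => \sum_(j < M) F i j * (i == (j + k)%N)%:R)).
have inner i : (i < M)%N -> \sum_(j < M) F i j * (i == (j + k)%N)%:R =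
    if (k <= i)%N then F i (i - k)%N else 0.
  move=> iM; case: ifP => ki.
    have lt : (i - k < M)%N by lia.
    rewrite (bigD1 (Ordinal lt))//= subnK// eqxx mulr1 big1 ?addr0// => j.
    rewrite -val_eqE/= => nj; rewrite (_ : (i == _) = false) ?mulr0//.
    by apply/negbTE; apply: contra nj => /eqP ->; rewrite addnK.
  rewrite big1// => j _; rewrite (_ : (i == _) = false) ?mulr0//.
  by apply/negbTE/eqP => h; move: ki; rewrite h leq_addl.
under eq_big_nat => i /andP[_ iM] do rewrite inner//.
have [kM|kM] := leqP k M.
  rewrite (@big_cat_nat _ _ _ k)//= big_nat big1 ?add0r; last first.
    by move=> i /andP[_ ik]; rewrite leqNgt ik.
  by apply: eq_big_nat => i /andP[->].
rewrite [RHS]big_geq 1?ltnW//; rewrite big_nat big1// => i /andP[_ iM].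
by rewrite leqNgt (ltn_trans iM kM).
Qed.

(** The product formula for cosines splits the modulated sum into two double sums of
    [cos ((i - j) * al)]; each of them is a sum of two squares, and [phi] integrates it with
    non-negative weight. *)
Lemma Fc_posdef phi (h th : R) (M : nat) : L1 phi -> (forall x, 0 <= phi x) ->
  0 <= \sum_(i < M) \sum_(j < M)
     Fc phi ((i%:R - j%:R) * h) * cos ((i%:R - j%:R) * th).
Proof.
move=> hphi p0.
have term (i j : nat) : Fc phi ((i%:R - j%:R) * h) * cos ((i%:R - j%:R) * th) =
  int (fun x => phi x * (2^-1 * (cos ((i%:R - j%:R) * (2 * pi * x * h - th)) +
     cos ((i%:R - j%:R) * (2 * pi * x * h + th))))).
  rewrite /Fc -intZr; last exact: L1_cos.
  apply: eq_int => x; rewrite -mulrA cosM; congr (_ * (_ * (cos _ + cos _))); ring.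
have cc (a : R) : mfun (fun x => cos (a + x)).
  apply: mfun_comp; first by apply: mfun_continuous; exact: continuous_cos.
  by apply: mfunD; [exact: mfun_cst|exact: measurable_id].
have L (i j : nat) : L1 (fun x => phi x * (2^-1 * (cos ((i%:R - j%:R) * (2 * pi * x * h - th)) +
     cos ((i%:R - j%:R) * (2 * pi * x * h + th))))).
  have hm (s : R) : mfun (fun x => cos ((i%:R - j%:R) * (2 * pi * x * h + s))).
    apply: (mfun_comp (f := cos)); first by apply: mfun_continuous; exact: continuous_cos.
    have := mfun_affine ((i%:R - j%:R) * (2 * pi * h)) ((i%:R - j%:R) * s).
    by congr mfun; apply/funext => x; ring.
  apply: L1Mb => //.
    by apply: mfunM; [exact: mfun_cst|apply: mfunD; exact: hm].
  exists 1 => x; rewrite normrM ger0_norm//.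
  have := ler_normD (cos ((i%:R - j%:R) * (2 * pi * x * h - th)))
    (cos ((i%:R - j%:R) * (2 * pi * x * h + th))).
  have := cos_max ((i%:R - j%:R) * (2 * pi * x * h - th)).
  have := cos_max ((i%:R - j%:R) * (2 * pi * x * h + th)); lra.
under eq_bigr => i _ do under eq_bigr => j _ do rewrite term.
under eq_bigr => i _ do rewrite -(int_sum _ (fun j : 'I_M => L i j)).
rewrite -(int_sum _ (fun i : 'I_M => L1_sum _ (fun j : 'I_M => L i j))).
apply: int_ge0 => x.
under eq_bigr => i _ do rewrite -mulr_sumr.
rewrite -mulr_sumr mulr_ge0//.
have sq (al : R) : 0 <= \sum_(i < M) \sum_(j < M) cos ((i%:R - j%:R) * al).
  have -> : \sum_(i < M) \sum_(j < M) cos ((i%:R - j%:R) * al) =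
    (\sum_(i < M) cos (i%:R * al)) ^+ 2 + (\sum_(i < M) sin (i%:R * al)) ^+ 2.
    rewrite !expr2 !big_distrl -big_split/=; apply: eq_bigr => i _.
    rewrite !big_distrr -big_split/=; apply: eq_bigr => j _.
    by rewrite mulrBl cosB.
  by rewrite addr_ge0// sqr_ge0.
under eq_bigr => i _ do rewrite -mulr_sumr big_split/=.
by rewrite -mulr_sumr mulr_ge0// big_split/= addr_ge0.
Qed.

Lemma sum_toeplitz (c : nat -> R) (M : nat) :
  \sum_(i < M) \sum_(j < M) c (`|i%:Z - j%:Z|)%N =
  M%:R * c 0%N + 2 * \sum_(1 <= k < M) (M - k)%:R * c k.
Proof.
elim: M => [|M IH]; first by rewrite big_ord0 mul0r big_geq// mulr0 addr0.
rewrite big_ord_recr/= -[X in _ + X = _]/(\sum_(j < M.+1) _).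
under eq_bigr => i _ do rewrite big_ord_recr/=.
rewrite big_split/= IH big_ord_recr/= subrr absz0.
have E1 : \sum_(i < M) c (`|i%:Z - M%:Z|)%N = \sum_(1 <= k < M.+1) c k.
  rewrite big_add1/= big_mkord (reindex_inj rev_ord_inj)/=.
  by apply: eq_bigr => i _; congr c; have := ltn_ord i; lia.
have E2 : \sum_(i < M) c (`|M%:Z - i%:Z|)%N = \sum_(1 <= k < M.+1) c k.
  by rewrite -E1; apply: eq_bigr => i _; congr c; lia.
rewrite E1 E2.
have E3 : \sum_(1 <= k < M.+1) (M.+1 - k)%:R * c k =
   \sum_(1 <= k < M) (M - k)%:R * c k + \sum_(1 <= k < M.+1) c k.
  have -> : \sum_(1 <= k < M) (M - k)%:R * c k = \sum_(1 <= k < M.+1) (M - k)%:R * c k.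
    case: M {IH E1 E2} => [|M]; first by rewrite !big_geq.
    by rewrite [RHS]big_nat_recr//= subnn mul0r addr0.
  rewrite -big_split/=; apply: eq_big_nat => k /andP[_ kM].
  by rewrite subSn// -natr1 mulrDl mul1r.
by rewrite E3 -natr1; ring.
Qed.

(** Since the samples vanish beyond [N], the positive double sum of size [M] is [M%:R * A - B] with
    [A] and [B] independent of [M]. Letting [M] grow forces [0 <= A]. *)
Lemma cosine_poly_ge0 phi (h th : R) (N : nat) : L1 phi -> (forall x, 0 <= phi x) ->
  (forall k : nat, (N < k)%N -> Fc phi (k%:R * h) = 0) ->
  0 <= Fc phi 0 + 2 * \sum_(1 <= k < N.+1) Fc phi (k%:R * h) * cos (k%:R * th).
Proof.
move=> hphi p0 v0.
pose c (k : nat) := Fc phi (k%:R * h) * cos (k%:R * th).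
have cE (i j : nat) : Fc phi ((i%:R - j%:R) * h) * cos ((i%:R - j%:R) * th) =
    c (`|i%:Z - j%:Z|)%N.
  rewrite /c; have [ij|ij] := leqP i j.
    have -> : (`|i%:Z - j%:Z|)%N = (j - i)%N by lia.
    by rewrite natrB// -(opprB j%:R) !mulNr Fc_even cosN.
  have -> : (`|i%:Z - j%:Z|)%N = (i - j)%N by lia.
  by rewrite natrB// ltnW.
pose A := Fc phi 0 + 2 * \sum_(1 <= k < N.+1) c k.
pose B := 2 * \sum_(1 <= k < N.+1) k%:R * c k.
have main (M : nat) : (N < M)%N -> 0 <= M%:R * A - B.
  move=> NM; have := @Fc_posdef phi h th M hphi p0.
  under eq_bigr => i _ do under eq_bigr => j _ do rewrite cE.
  rewrite sum_toeplitz /A /B.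
  have -> : c 0%N = Fc phi 0 by rewrite /c !mul0r cos0 mulr1.
  have tail0 : \sum_(N.+1 <= k < M) (M - k)%:R * c k = 0.
    by rewrite big_nat big1// => k /andP[Nk _]; rewrite /c v0// mul0r mulr0.
  rewrite (@big_cat_nat _ _ _ N.+1)//= tail0 addr0.
  have -> : \sum_(1 <= k < N.+1) (M - k)%:R * c k =
     M%:R * \sum_(1 <= k < N.+1) c k - \sum_(1 <= k < N.+1) k%:R * c k.
    rewrite mulr_sumr -sumrB; apply: eq_big_nat => k /andP[_ kN].
    by rewrite natrB ?mulrBl//; lia.
  move=> h1; apply: (le_trans h1); rewrite le_eqVlt; apply/orP; left; apply/eqP; ring.
rewrite -/A leNgt; apply/negP => A0.
have nA : 0 < - A by rewrite oppr_gt0.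
pose M := (N + Num.bound (`|B| / - A)).+1.
have := main M; rewrite ltnS leq_addr => /(_ isT).
have h1 : `|B| / - A < M%:R.
  have := archi_boundP (divr_ge0 (normr_ge0 B) (ltW nA)); move/lt_le_trans; apply.
  by rewrite ler_nat /M leqW// leq_addl.
rewrite ltr_pdivrMr// in h1; have := ler_norm (- B); rewrite normrN.
by move: (M%:R) h1 => m h1 h2 h3; lra.
Qed.

Lemma circle_param (z : R[i]) : `|z| = 1 -> exists th : R, z = (cos th +i* sin th)%C.
Proof.
case: z => p q /(congr1 (fun u => u ^+ 2)); rewrite expr1n.
rewrite normCK => h.
have {}h : p ^+ 2 + q ^+ 2 = 1.
  have := congr1 (@complex.Re R) h; rewrite /= => h2; rewrite !expr2; move: h2.
  by rewrite mulrN opprK.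
have p1 : -1 <= p <= 1 by apply/andP; split; nra.
have sE : sin (acos p) = `|q|.
  rewrite sin_acos//; have -> : 1 - p ^+ 2 = q ^+ 2 by lra.
  by rewrite sqrtr_sqr.
have [q0|q0] := leP 0 q.
  by exists (acos p); rewrite acosK// sE ger0_norm.
by exists (- acos p); rewrite cosN sinN acosK// sE ltr0_norm// opprK.
Qed.

Lemma expi_exp (th : R) (k : nat) :
  (cos th +i* sin th)%C ^+ k = (cos (k%:R * th) +i* sin (k%:R * th))%C.
Proof.
elim: k => [|k IH]; first by rewrite expr0 mul0r cos0 sin0.
rewrite exprS IH -nat1r mulrDl mul1r cosD sinD; apply/eqP.
by rewrite eq_complex /= eqxx/=; apply/eqP; rewrite addrC [in LHS]mulrC; ring.
Qed.

(* Splitting the complex coefficients of [fejer_riesz_coef] into real and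
   imaginary parts costs a second autocorrelation. *)
Theorem fejer_riesz (c : nat -> R) (N : nat) :
  (forall th, 0 < c 0%N + 2 * \sum_(1 <= k < N.+1) c k * cos (k%:R * th)) ->
  exists a b : nat -> R, forall k, (k <= N)%N ->
    c k = \sum_(k <= i < N.+1) (a i * a (i - k)%N + b i * b (i - k)%N).
Proof.
move=> pos.
pose p : {poly R[i]} := \poly_(i < N.*2.+1) (c (`|i%:Z - N%:Z|)%N)%:C%C.
have sp : (size p <= N.*2.+1)%N by exact: size_poly.
have val th : p.[(cos th +i* sin th)%C] / (cos th +i* sin th)%C ^+ N =
   (c 0%N + 2 * \sum_(1 <= k < N.+1) c k * cos (k%:R * th))%:C%C.
  set z := (cos th +i* sin th)%C.
  have zN : z * (cos th -i* sin th)%C = 1.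
    apply/eqP; rewrite eq_complex /=; have := cos2Dsin2 th => h.
    by apply/andP; split; apply/eqP; rewrite ?mulrN ?opprK -?expr2 ?h// addrC mulrC subrr.
  have z0 : z != 0.
    by apply/eqP => h; move: zN; rewrite h mul0r => /esym/eqP; rewrite oner_eq0.
  have zi : z^-1 = (cos (- th) +i* sin (- th))%C.
    by apply: (mulfI z0); rewrite divff// cosN sinN zN.
  have zk (k : nat) : z ^- k = (cos (k%:R * th) -i* sin (k%:R * th))%C.
    by rewrite -exprVn zi expi_exp mulrN cosN sinN.
  rewrite horner_poly mulr_suml.
  rewrite -(big_mkord xpredT (fun i => (c (`|i%:Z - N%:Z|)%N)%:C%C * z ^+ i / z ^+ N)).
  rewrite (@big_cat_nat _ _ _ N)//=; last by lia.
  rewrite [X in _ + X]big_ltn; last by lia.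
  have -> : \sum_(N.+1 <= i < N.*2.+1) (c (`|i%:Z - N%:Z|)%N)%:C%C * z ^+ i / z ^+ N =
     \sum_(1 <= k < N.+1) (c k)%:C%C * z ^+ k.
    rewrite -{1}[N.+1]add1n big_addn (_ : (N.*2.+1 - N = N.+1)%N); last by lia.
    apply: eq_big_nat => k _; rewrite exprD mulrA mulfK ?expf_neq0//.
    by congr ((c _)%:C%C * _); lia.
  have -> : \sum_(0 <= i < N) (c (`|i%:Z - N%:Z|)%N)%:C%C * z ^+ i / z ^+ N =
     \sum_(1 <= k < N.+1) (c k)%:C%C * z ^- k.
    rewrite big_add1/= big_nat_rev/= add0n; apply: eq_big_nat => k /andP[_ kN].
    rewrite -mulrA; congr ((c _)%:C%C * _); first by lia.
    have -> : z ^+ N = z ^+ (N - k.+1) * z ^+ k.+1 by rewrite -exprD; congr (_ ^+ _); lia.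
    by rewrite invfM mulrA divff ?mul1r// expf_neq0.
  rewrite subrr absz0 mulfK ?expf_neq0// addrCA -big_split/=.
  have -> : \sum_(1 <= k < N.+1) ((c k)%:C%C * z ^- k + (c k)%:C%C * z ^+ k) =
     (2 * \sum_(1 <= k < N.+1) c k * cos (k%:R * th))%:C%C.
    rewrite mulr_sumr rmorph_sum/=; apply: eq_big_nat => k _.
    rewrite -mulrDr zk expi_exp; apply/eqP; rewrite eq_complex /=.
    by apply/andP; split; apply/eqP; ring.
  by rewrite -rmorphD.
have [z z1|q hq] := @fejer_riesz_coef R[i] N p sp.
  have [th ->] := circle_param z1; rewrite val.
  by rewrite ltcR.
exists (fun i => complex.Re q`_i), (fun i => complex.Im q`_i) => k kN.
have := congr1 (@complex.Re R) (hq k kN).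
rewrite coef_poly ifT; last by lia.
have -> : (`|(N + k)%N%:Z - N%:Z|)%N = k by lia.
move=> /= ->; rewrite raddf_sum/=; apply: eq_bigr => i _.
by case: (q`_i) (q`_(i - k)) => p1 q1 [p2 q2] /=; rewrite mulrN opprK.
Qed.

End Discretization.

(** * Sampling a test function *)

Section Sampling.
Variable R : realType.
Implicit Types (p q h x z t w s : R).

(** Half-open, so that neighbouring cells are disjoint at every point. *)
Definition cell p h x : R := ((p <= x)%R && (x < p + h)%R)%:R.

Lemma mfun_cell p h : mfun (cell p h).
Proof.
rewrite /cell (_ : (fun x => _) = fun x => if (p <= x) && (x < p + h) then 1 else 0).
  apply: mfun_if; [|exact: mfun_cst..].
  apply: measurable_and; first by apply: mfun_le; [exact: mfun_cst|exact: measurable_id].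
  by apply: mfun_lt; [exact: measurable_id|exact: mfun_cst].
by apply/funext => x; case: ifP.
Qed.

Lemma cell_bcs p h w : - w <= p -> p + h <= w -> bcs w (cell p h).
Proof.
move=> pw hw; split; first exact: mfun_cell.
  by exists 1 => x; rewrite /cell; case: andP; rewrite ?normr1 ?normr0.
move=> x; rewrite /cell; case: andP => // -[h1 h2]; rewrite ltNge ler_norml => /negP[].
by apply/andP; split; lra.
Qed.

Lemma cell_int p h : 0 <= h -> int (cell p h) = h.
Proof.
move=> h0; transitivity (int (ind p (p + h))); last by rewrite int_ind; lra.
apply: (@int_ae _ _ _ [:: p + h]); [exact: mfun_cell|exact: mfun_ind|].
by move=> x; rewrite inE => /negbTE xn; rewrite /cell /ind (le_eqVlt x) xn.
Qed.

Lemma cell_overlap p q h : 0 <= h -> `|p - q| <= h ->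
  int (fun x => cell p h x * cell q h x) = h - `|p - q|.
Proof.
move=> h0; wlog pq : p q / p <= q => [H|].
  have [pq|/ltW qp] := leP p q; first exact: H.
  by rewrite distrC => /(H _ _ qp) <-; apply: eq_int => x; rewrite mulrC.
have np : `|p - q| = q - p by rewrite distrC ger0_norm; lra.
rewrite np => qh.
rewrite (_ : h - (q - p) = p + h - q); last by ring.
rewrite -(@cell_int q (p + h - q)); last by lra.
apply: eq_int => x; rewrite /cell; have -> : q + (p + h - q) = p + h by ring.
have [qx|qx] := leP q x; last by rewrite mulr0.
rewrite (le_trans pq qx)/=; have [xp|xp] := ltP x (p + h); last by rewrite mul0r.
by rewrite (_ : x < q + h) ?mulr1//; lra.
Qed.

Lemma cell_disjoint p q h : h <= `|p - q| ->
  int (fun x => cell p h x * cell q h x) = 0.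
Proof.
move=> hpq; rewrite -[RHS](@int0 R); apply: eq_int => x; rewrite /cell.
case: andP => [[h1 h2]|_]; last by rewrite mul0r.
case: andP => [[h3 h4]|_]; last by rewrite mulr0.
exfalso; move: hpq; apply/negP; rewrite -ltNge ltr_norml; apply/andP; split; lra.
Qed.

(** [w] centres the grid: for [w = N.+1%:R * h / 2] the cells tile [[-w, w[]. The factor [s], taken
    with [s ^+ 2 * h = 1], cancels the cell length in the autocorrelation. *)
Definition stepf (al : nat -> R) (N : nat) s h w x : R :=
  s * \sum_(i < N.+1) al i * cell (i%:R * h - w) h x.

Lemma stepf_bcs (al : nat -> R) (N : nat) s h : 0 <= h ->
  bcs (N.+1%:R * h / 2) (stepf al N s h (N.+1%:R * h / 2)).
Proof.
move=> h0; apply: bcsZ; apply: bcs_sum => i; apply: bcsZ; apply: cell_bcs.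
  by rewrite lerDr mulr_ge0.
have : (i%:R + 1) * h <= N.+1%:R * h by rewrite ler_wpM2r// natr1 ler_nat.
by move: (N.+1%:R * h) => u; lra.
Qed.

Lemma acor_stepf (al : nat -> R) (N k : nat) s h t : 0 < h -> s ^+ 2 * h = 1 ->
  0 <= t -> t < 1 ->
  acor (stepf al N s h (N.+1%:R * h / 2)) ((k%:R + t) * h) =
  (1 - t) * \sum_(k <= i < N.+1) al i * al (i - k)%N +
  t * \sum_(k.+1 <= i < N.+1) al i * al (i - k.+1)%N.
Proof.
move=> h0 sh t0 t1; set w := _ / 2; set z := _ * h.
have shift (j : nat) x : cell (j%:R * h - w) h (x - z) = cell (j%:R * h - w + z) h x.
  by rewrite /cell; congr ((_ && _)%:R); apply/idP/idP => ?; lra.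
have ov (i j : nat) : int (fun x => cell (i%:R * h - w) h x * cell (j%:R * h - w + z) h x) =
    h * ((1 - t) * (i == (j + k)%N)%:R + t * (i == (j + k.+1)%N)%:R).
  have dE : i%:R * h - w - (j%:R * h - w + z) = (i%:R - (j + k)%:R - t) * h.
    by rewrite /z natrD; ring.
  have [ijk|ijk] := leqP i (j + k)%N.
    have -> : (i == (j + k.+1)%N) = false by lia.
    have [->|nijk] := eqVneq i (j + k)%N.
      have dE' : (j + k)%:R * h - w - (j%:R * h - w + z) = - t * h.
        by rewrite /z natrD; ring.
      have nE : `|- t * h| = t * h by rewrite mulNr normrN ger0_norm// mulr_ge0// ltW.
      rewrite cell_overlap ?(ltW h0)// dE' nE; last by nra.
      by rewrite /= ?mulr1n ?mulr0n; ring.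
    rewrite cell_disjoint ?mulr0 ?addr0 ?mulr0//.
    have : i%:R + 1 <= (j + k)%:R :> R by rewrite natr1 ler_nat ltn_neqAle nijk.
    rewrite dE normrM (gtr0_norm h0); move: (i%:R) ((j + k)%:R) => u v uv.
    by rewrite ler_peMl ?(ltW h0)// ler0_norm; lra.
  have -> : (i == (j + k)%N) = false by lia.
  have [->|nijk] := eqVneq i (j + k.+1)%N.
    have dE' : (j + k.+1)%:R * h - w - (j%:R * h - w + z) = (1 - t) * h.
      by rewrite /z natrD -natr1; ring.
    rewrite cell_overlap ?(ltW h0)// dE' normrM (gtr0_norm h0) ger0_norm ?subr_ge0 ?(ltW t1)//; last by nra.
    by rewrite /= ?mulr1n ?mulr0n; ring.
  rewrite cell_disjoint ?mulr0 ?addr0 ?mulr0//.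
  have : (j + k)%:R + 2 <= i%:R :> R by rewrite -natrD ler_nat; lia.
  rewrite dE normrM (gtr0_norm h0); move: (i%:R) ((j + k)%:R) => u v uv.
  by rewrite ler_peMl ?(ltW h0)// ger0_norm; lra.
have Lc (i j : nat) : L1 (fun x => al i * al j *
    (cell (i%:R * h - w) h x * cell (j%:R * h - w + z) h x)).
  apply: L1Z; apply: L1Mb; [|exact: mfun_cell|].
    have := @cell_bcs (i%:R * h - w) h (`|i%:R * h - w| + h).
    move=> H; apply: (bcs_L1 (H _ _)).
      have := ler_norm (- (i%:R * h - w)); rewrite normrN; lra.
    have := ler_norm (i%:R * h - w); lra.
  by exists 1 => x; rewrite /cell; case: andP; rewrite ?normr1 ?normr0.
transitivity (s ^+ 2 * int (fun x => \sum_(i < N.+1) \sum_(j < N.+1) al i * al j *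
    (cell (i%:R * h - w) h x * cell (j%:R * h - w + z) h x))).
  rewrite -intZ; last by apply: L1_sum => i; apply: L1_sum => j; exact: Lc.
  apply: eq_int => x; rewrite /stepf mulrACA -expr2; congr (_ * _).
  rewrite big_distrl/=; apply: eq_bigr => i _; rewrite big_distrr/=.
  by apply: eq_bigr => j _; rewrite shift; ring.
rewrite int_sum; last by move=> i; apply: L1_sum => j; exact: Lc.
under eq_bigr => i _ do rewrite (int_sum _ (fun j : 'I_N.+1 => Lc i j)).
under eq_bigr => i _.
  under eq_bigr => j _.
    rewrite intZ; last first.
      have := L1Z (1 : R) (Lc 0%N 0%N) => _.
      apply: L1Mb; [|exact: mfun_cell|].
        have := @cell_bcs (i%:R * h - w) h (`|i%:R * h - w| + h).
        move=> H; apply: (bcs_L1 (H _ _)).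
          have := ler_norm (- (i%:R * h - w)); rewrite normrN; lra.
        have := ler_norm (i%:R * h - w); lra.
      by exists 1 => x; rewrite /cell; case: andP; rewrite ?normr1 ?normr0.
    rewrite ov.
    have -> : al i * al j * (h * ((1 - t) * (nat_of_ord i == (j + k)%N)%:R +
        t * (nat_of_ord i == (j + k.+1)%N)%:R)) =
      h * (1 - t) * (al i * al j * (nat_of_ord i == (j + k)%N)%:R) +
      h * t * (al i * al j * (nat_of_ord i == (j + k.+1)%N)%:R) by ring.
    over.
  rewrite big_split/= -!mulr_sumr; over.
rewrite big_split/= -!mulr_sumr !(sum_diag (fun i j => al i * al j)).
rewrite mulrDr !mulrA sh !mul1r.
by congr (_ + _); rewrite -!mulrA.
Qed.

(* Replaces the factorization of [phi] as a squared modulus: the step functions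
   built from a Fejer-Riesz factorization of the samples of [Fc phi] have the
   piecewise linear interpolant of these samples as total autocorrelation. *)
Theorem sampling (sigma : R) (phi : R -> R) : 0 < sigma -> sigma < 3 / 2 ->
  test_function sigma phi ->
  exists (a b : nat -> R -> R) (w : nat -> R),
  [/\ (forall m, bcs (w m) (a m) /\ bcs (w m) (b m)),
      (forall m, sigma <= w m <= 3 / 2),
      (forall m, w m - sigma <= eps_ R m ^+ 2),
      (forall z, acor (a m) z + acor (b m) z @[m --> \oo] --> Fc phi z) &
      exists M, forall m z, `|acor (a m) z + acor (b m) z| <= M].
Proof.
move=> s0 s32 ht; have hphi := test_L1 ht; have p0 := test_ge0 ht.
(* Starting the grids at index [m0] keeps the half-width [w m] below 3/2 for every [m], not only
   eventually. *)
have [m0 hm0] : exists m0, eps_ R m0 <= 3 / 2 - sigma.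
  have d0 : 0 < 3 / 2 - sigma by lra.
  have /cvgrPdist_lt/(_ _ d0)[m _ hm] := @cvg_eps R; exists m.
  by have := hm m (leqnn _); rewrite /= sub0r normrN ger0_norm ?(ltW (eps_gt0 R m))// => /ltW.
pose s (m : nat) : R := (m + m0).+1%:R.
(* The mesh is a reciprocal square, so the normalizing factor [s] is a natural number, and the
   margin [w m - sigma] has the order that the limit argument needs. *)
pose h (m : nat) : R := eps_ R (m + m0)%N ^+ 2.
have s1 m : 1 <= s m by rewrite /s ler1n.
have h0 m : 0 < h m by rewrite exprn_gt0// eps_gt0.
have sh m : s m ^+ 2 * h m = 1.
  by rewrite /s /h /eps_ -exprMn divff ?expr1n// pnatr_eq0.
have he m : h m <= eps_ R m ^+ 2.
  rewrite lerXn2r ?nnegrE ?(ltW (eps_gt0 R _))//.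
  by rewrite /eps_ lef_pV2 ?posrE// ler_nat ltnS leq_addr.
have h1 m : h m <= 1.
  apply: (le_trans (he m)); rewrite exprn_ile1 ?(ltW (eps_gt0 R _))//.
  by rewrite /eps_ invf_le1// ler1n.
have hs m : h m <= 3 / 2 - sigma.
  have e1 : eps_ R (m + m0)%N <= eps_ R m0.
    by rewrite /eps_ lef_pV2 ?posrE// ler_nat ltnS leq_addl.
  have e2 : eps_ R m0 <= 1 by rewrite /eps_ invf_le1// ler1n.
  apply: (le_trans _ hm0); apply: (le_trans _ e1); rewrite /h expr2.
  by rewrite ler_piMr ?(ltW (eps_gt0 R _))// (le_trans e1).
(* Last grid index not beyond [2 * sigma]. Later samples vanish, and [N.+1] cells have a half-width
   between [sigma] and [sigma + h / 2]. *)
pose N (m : nat) : nat := Num.truncn (2 * sigma / h m).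
have Nle m : (N m)%:R * h m <= 2 * sigma.
  by rewrite -ler_pdivlMr// /N truncn_le// divr_ge0 ?(ltW (h0 m))// mulr_ge0 ?(ltW s0).
have Ngt m : 2 * sigma < (N m).+1%:R * h m.
  by rewrite -ltr_pdivrMr// /N truncnS_gt.
(* The extra [h m] at [k = 0] makes the cosine polynomial strictly positive, as the Fejer-Riesz
   lemma requires, and disappears in the limit. *)
pose c m (k : nat) : R := Fc phi (k%:R * h m) + (k == 0%N)%:R * h m.
have v0 m (k : nat) : (N m < k)%N -> Fc phi (k%:R * h m) = 0.
  have e0 : 0 <= k%:R * h m by apply: mulr_ge0; [exact: ler0n|exact: ltW].
  move=> Nk; apply: (test_supp ht); rewrite (ger0_norm e0).
  by apply: (lt_le_trans (Ngt m)); rewrite ler_wpM2r ?(ltW (h0 m))// ler_nat.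
have pos : forall (i : nat) (th : R),
    0 < c i 0%N + 2 * \sum_(1 <= k < (N i).+1) c i k * cos (k%:R * th).
  move=> i th.
  have := @cosine_poly_ge0 R phi (h i) th (N i) hphi p0 (v0 i).
  have -> : \sum_(1 <= k < (N i).+1) c i k * cos (k%:R * th) =
     \sum_(1 <= k < (N i).+1) Fc phi (k%:R * h i) * cos (k%:R * th).
    apply: eq_big_nat => k /andP[k1 _]; congr (_ * _).
    by rewrite /c (_ : (k == 0%N) = false) ?mul0r ?addr0//; lia.
  have key (u r v : R) : 0 < r -> 0 <= u + 2 * v -> 0 < u + r + 2 * v by lra.
  by rewrite {1}/c mul0r eqxx mul1r; exact: (key _ _ _ (h0 i)).
have /choice[al hal] m : exists al : (nat -> R) * (nat -> R), forall k, (k <= N m)%N ->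
    c m k = \sum_(k <= i < (N m).+1) (al.1 i * al.1 (i - k)%N + al.2 i * al.2 (i - k)%N).
  by have [a [b ab]] := fejer_riesz (pos m); exists (a, b).
pose w m := (N m).+1%:R * h m / 2.
pose a m := stepf (al m).1 (N m) (s m) (h m) (w m).
pose b m := stepf (al m).2 (N m) (s m) (h m) (w m).
have cE m (k : nat) : c m k =
   \sum_(k <= i < (N m).+1) (al m).1 i * (al m).1 (i - k)%N +
   \sum_(k <= i < (N m).+1) (al m).2 i * (al m).2 (i - k)%N.
  have [kN|kN] := leqP k (N m); first by rewrite hal// big_split.
  rewrite !big_geq// addr0 /c v0// (_ : (k == 0%N) = false) ?mul0r ?addr0//; lia.
have VE m (k : nat) t : 0 <= t -> t < 1 ->
    acor (a m) ((k%:R + t) * h m) + acor (b m) ((k%:R + t) * h m) =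
    (1 - t) * c m k + t * c m k.+1.
  move=> t0 t1; rewrite /a /b /w !acor_stepf// !cE.
  by move: (\sum_(_ <= _ < _) _) (\sum_(_ <= _ < _) _) (\sum_(_ <= _ < _) _)
    (\sum_(_ <= _ < _) _) => u1 u2 u3 u4; ring.
have bc m : bcs (w m) (a m) /\ bcs (w m) (b m).
  by split; apply: stepf_bcs; exact: ltW.
have dec m z : 0 <= z -> exists (k : nat) (t : R), [/\ 0 <= t, t < 1 & z = (k%:R + t) * h m].
  move=> z0; have q0 : 0 <= z / h m by rewrite divr_ge0// ltW.
  exists (Num.truncn (z / h m)), (z / h m - (Num.truncn (z / h m))%:R).
  have h3 : (Num.truncn (z / h m))%:R <= z / h m by rewrite truncn_le.
  have := truncnS_gt (z / h m).
  rewrite -natr1 => h2; split; [lra|lra|].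
  by rewrite addrC subrK divfK// gt_eqF.
have Vabs m z : acor (a m) z + acor (b m) z = acor (a m) `|z| + acor (b m) `|z|.
  have [z0|z0] := leP 0 z; first by rewrite ger0_norm.
  by rewrite ltr0_norm// (acorN z (bc m).1) (acorN z (bc m).2).
exists a, b, w; split => //.
- move=> m; move: (Nle m) (Ngt m) (hs m); rewrite /w -[(N m).+1%:R]natr1.
  have key (n r q : R) : q < 3 / 2 -> n * r <= 2 * q -> 2 * q < (n + 1) * r ->
    r <= 3 / 2 - q -> q <= (n + 1) * r / 2 <= 3 / 2.
    rewrite (mulrDl n 1 r) mul1r; move: (n * r) => p q1 q2 q3 q4.
    by apply/andP; split; lra.
  exact: key.
- move=> m; move: (he m) (h0 m) (Nle m); rewrite /w -[(N m).+1%:R]natr1.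
  have key (n r e : R) : r <= e -> 0 < r -> n * r <= 2 * sigma ->
    (n + 1) * r / 2 - sigma <= e.
    by rewrite (mulrDl n 1 r) mul1r; move: (n * r) => p; lra.
  exact: key.
- move=> z; have cv : Fc phi z = Fc phi `|z|.
    by have [z0|z0] := leP 0 z; [rewrite ger0_norm|rewrite ltr0_norm// Fc_even].
  rewrite cv; apply/cvgrPdist_lt => r r0.
  have r2 : 0 < r / 2 by rewrite divr_gt0.
  have fc (x : R) : {for x, continuous (Fc phi)} by exact: Fc_continuous.
  have /cvgrPdist_lt/(_ _ r2)[d /= d0 hd] := fc `|z|.
  have h_cvg : eps_ R m @[m --> \oo] --> (0 : R) := @cvg_eps R.
  have dr : 0 < Num.min d (r / 2) by rewrite lt_min d0.
  have /cvgrPdist_lt/(_ _ dr)[m1 _ hm1] := h_cvg.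
  exists m1 => // m /hm1 /=; rewrite sub0r normrN (ger0_norm (ltW (eps_gt0 R m))).
  rewrite lt_min => /andP[ed er].
  have hle : h m <= eps_ R m.
    apply: (le_trans (he m)); rewrite expr2 ler_piMr ?(ltW (eps_gt0 R _))//.
    by rewrite /eps_ invf_le1// ler1n.
  have [k [t [t0 t1 zE]]] := dec m `|z| (normr_ge0 _).
  rewrite Vabs {2 3}zE VE//.
  have near1 (j : nat) : `| `|z| - j%:R * h m| <= h m -> `|Fc phi `|z| - c m j| < r.
    move=> hj; have h3 : `|Fc phi `|z| - Fc phi (j%:R * h m)| < r / 2.
      by apply: hd; rewrite /= (le_lt_trans hj)// (le_lt_trans hle).
    rewrite /c opprD addrA; apply: (le_lt_trans (ler_normB _ _)).
    have : `|(j == 0%N)%:R * h m| <= h m.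
      rewrite normrM (gtr0_norm (h0 m)) ler_piMl ?(ltW (h0 m))//.
      by case: (j == 0%N); rewrite ?normr1 ?normr0.
    lra.
  have n1 := near1 k; have n2 := near1 k.+1.
  have {}n1 : `|Fc phi `|z| - c m k| < r.
    apply: n1; rewrite zE mulrDl addrC addKr ger0_norm; last exact: mulr_ge0 t0 (ltW (h0 m)).
    by rewrite ler_piMl ?(ltW (h0 m))// ltW.
  have {}n2 : `|Fc phi `|z| - c m k.+1| < r.
    apply: n2; rewrite zE -natr1 -mulrBl normrM (gtr0_norm (h0 m)).
    rewrite ler_piMl ?(ltW (h0 m))//.
    by rewrite (_ : k%:R + t - (k%:R + 1) = t - 1); [rewrite ler0_norm; lra|ring].
  move: n1 n2; move: (Fc phi `|z|) (c m k) (c m k.+1) => u x y; rewrite !ltr_norml.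
  move=> /andP[x1 x2] /andP[y1 y2].
  have -> : u - ((1 - t) * x + t * y) = (1 - t) * (u - x) + t * (u - y) by ring.
  by apply/andP; split; nra.
- exists (int (fun x => `|phi x|) + 1) => m z.
  have [k [t [t0 t1 zE]]] := dec m `|z| (normr_ge0 _); rewrite Vabs zE VE//.
  have cb (j : nat) : `|c m j| <= int (fun x => `|phi x|) + 1.
    apply: (le_trans (ler_normD _ _)); apply: lerD; first exact: Fc_le.
    rewrite normrM (gtr0_norm (h0 m)); case: (j == 0%N); rewrite ?normr1 ?normr0 ?mul1r ?mul0r//.
  have b1 := cb k; have b2 := cb k.+1; rewrite (le_trans (ler_normD _ _))//.
  rewrite !normrM (ger0_norm t0) (_ : `|1 - t| = 1 - t); last by rewrite ger0_norm; lra.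
  move: b1 b2; move: (int _ + 1) (`|c m k|) (`|c m k.+1|) => u x y; nra.
Qed.

End Sampling.

(** * Schwartz functions *)

Section Schwartz.
Variable R : realType.
Implicit Types (f g h u : R -> R) (c d x y t S M : R).

(** A class closed under differentiation contains all derivatives of its members, so decay has to be
    checked on the members only. *)
Lemma schwartz_of_class (C : (R -> R) -> Prop) :
  (forall f, C f -> exists2 g, C g & forall x, is_derive x (1 : R) f (g x)) ->
  (forall f, C f -> forall m, exists K, forall x, `|x ^+ m * f x| <= K) ->
  forall f, C f -> schwartz f.
Proof.
move=> Cd Cb f hf.
have Cn (n : nat) : C (derive1n n f).
  elim: n => [|n IH]; first exact: hf.
  have [g hg dg] := Cd _ IH; rewrite derive1nS.
  rewrite (_ : (derive1n n f)^`()%classic = g)//.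
  by apply/funext => x; rewrite derive1E; case: (dg x).
split; first by move=> n x; have [g _ dg] := Cd _ (Cn n); case: (dg x).
by move=> m n; exact: Cb.
Qed.

Definition Fs f y : R := int (fun x => f x * sin (2 * pi * x * y)).

Lemma mfun_sinr c : mfun (fun x : R => sin (2 * pi * x * c)).
Proof. by under eq_fun do rewrite mulrAC; exact: mfun_sinl. Qed.

(** The factor [2 * pi * x] is what differentiating the cosine or sine under the integral brings
    out. *)
Definition tmul f x : R := 2 * pi * x * f x.

Lemma bcs_tmul S f : bcs S f -> bcs S (tmul f).
Proof.
move=> hf; have [mf /bounded_ge0[M M0 hM] f0] := hf.
have mt : mfun (fun x => 2 * pi * x) by have := mfun_affine (2 * pi) (0 : R); under eq_fun do rewrite addr0.
split; first exact: mfunM.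
  exists (`|2 * pi| * `|S| * M) => x; rewrite /tmul.
  have [hx|hx] := ltP S `|x|; first by rewrite f0// mulr0 normr0 !mulr_ge0.
  rewrite normrM (normrM (2 * pi) x) ler_pM ?mulr_ge0// ler_wpM2l//.
  by rewrite (le_trans hx)// ler_norm.
by move=> x hx; rewrite /tmul f0// mulr0.
Qed.

Lemma FcFs_derive S f y : bcs S f ->
  is_derive y (1 : R) (Fc f) (- Fs (tmul f) y) /\ is_derive y (1 : R) (Fs f) (Fc (tmul f) y).
Proof.
move=> hf; have f1 := bcs_L1 hf; have t1 := bcs_L1 (bcs_tmul hf).
have dc z x : is_derive z (1 : R) (fun y => f x * cos (2 * pi * x * y))
    (- (tmul f x * sin (2 * pi * x * z))).
  by apply: (drv_eq (drvZ (f x) (drv_cos (2 * pi * x) z))); rewrite /tmul; ring.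
have ds z x : is_derive z (1 : R) (fun y => f x * sin (2 * pi * x * y))
    (tmul f x * cos (2 * pi * x * z)).
  by apply: (drv_eq (drvZ (f x) (drv_sin (2 * pi * x) z))); rewrite /tmul; ring.
have Iy : `]y - 1, y + 1[%classic y by rewrite /= in_itv/=; apply/andP; split; lra.
have L1s g z : L1 g -> L1 (fun x => g x * sin (2 * pi * x * z)).
  by move=> hg; apply: L1Mb => //; [exact: mfun_sinr|exact: bounded_sin].
have G0 x : 0 <= `|tmul f x| by [].
split.
- have intf z : `]y - 1, y + 1[%classic z ->
     (@lebesgue_measure R).-integrable setT (EFin \o (fun x => f x * cos (2 * pi * x * z))).
    by move=> _; exact: L1_cos.
  have der z x : `]y - 1, y + 1[%classic z -> setT x ->
     derivable (fun y => f x * cos (2 * pi * x * y)) z 1 by move=> _ _; case: (dc z x).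
  have ub z x : `]y - 1, y + 1[%classic z -> setT x ->
     `|partial1of2 (fun y x => f x * cos (2 * pi * x * y)) z x| <= `|tmul f x|.
    move=> _ _; rewrite partial1of2E; case: (dc z x) => _ ->.
    by rewrite normrN normrM ler_piMr// sin_max.
  have h1 := derivable_under_integral measurableT Iy intf der G0 (L1_abs t1) ub.
  have h2 := differentiation_under_integral measurableT Iy intf der G0 (L1_abs t1) ub.
  apply: DeriveDef; first exact: h1.
  rewrite -derive1E; apply: (etrans h2).
  rewrite /Fs -mulN1r -(intZ _ (L1s _ y t1)); apply: eq_int => x.
  by rewrite partial1of2E; case: (dc y x) => _ ->; rewrite mulN1r.
- have intf z : `]y - 1, y + 1[%classic z ->
     (@lebesgue_measure R).-integrable setT (EFin \o (fun x => f x * sin (2 * pi * x * z))).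
    by move=> _; exact: L1s.
  have der z x : `]y - 1, y + 1[%classic z -> setT x ->
     derivable (fun y => f x * sin (2 * pi * x * y)) z 1 by move=> _ _; case: (ds z x).
  have ub z x : `]y - 1, y + 1[%classic z -> setT x ->
     `|partial1of2 (fun y x => f x * sin (2 * pi * x * y)) z x| <= `|tmul f x|.
    move=> _ _; rewrite partial1of2E; case: (ds z x) => _ ->.
    by rewrite normrM ler_piMr// cos_max.
  have h1 := derivable_under_integral measurableT Iy intf der G0 (L1_abs t1) ub.
  have h2 := differentiation_under_integral measurableT Iy intf der G0 (L1_abs t1) ub.
  apply: DeriveDef; first exact: h1.
  rewrite -derive1E; apply: (etrans h2).
  apply: eq_int => x.
  by rewrite partial1of2E; case: (ds y x) => _ ->.
Qed.

Lemma Fs_le f y : L1 f -> `|Fs f y| <= int (fun x => `|f x|).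
Proof.
move=> hf; have hs : L1 (fun x => f x * sin (2 * pi * x * y)).
  by apply: L1Mb => //; [exact: mfun_sinr|exact: bounded_sin].
apply: (le_trans (int_abs hs)).
apply: int_le; [exact: (L1_abs hs)|exact: L1_abs|move=> x].
by rewrite normrM ler_piMr// sin_max.
Qed.

(** * Bump functions, and transforms of rapid decay *)

Section Bump.
Variable d : R.
Hypothesis d0 : 0 < d.

(** [bump 0 0] is the usual smooth bump of radius [d]; the powers indexed by [k] and [j] are those
    that its derivatives produce. *)
Definition bump (k j : nat) t : R :=
  if `|t| < d then t ^+ k * (d ^+ 2 - t ^+ 2) ^- j * expR (- (d ^+ 2 - t ^+ 2)^-1) else 0.

(** [expR x^-1] dominates the term of order [j.+2] of its series. That order beats [x ^- j] and
    leaves [x ^+ 2], enough for a vanishing derivative at the edge. *)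
Lemma exp_decay (j : nat) x : 0 < x -> x ^- j * expR (- x^-1) <= j.+2`!%:R * x ^+ 2.
Proof.
move=> x0; have xi : 0 < x^-1 by rewrite invr_gt0.
have := @expR_ge1Dxn R x^-1 j.+1 (ltW xi) => h.
have h2 : x ^- j.+2 / j.+2`!%:R <= expR x^-1.
  by rewrite -exprVn; apply: le_trans h; rewrite lerDr.
rewrite expRN ler_pdivrMr ?expR_gt0//.
have F0 : 0 < j.+2`!%:R :> R by rewrite ltr0n fact_gt0.
have -> : x ^- j = j.+2`!%:R * x ^+ 2 * (x ^- j.+2 / j.+2`!%:R).
  have -> : x ^+ j.+2 = x ^+ 2 * x ^+ j by rewrite -exprD.
  have X0 : x ^+ j != 0 by rewrite expf_neq0// gt_eqF.
  move: (x ^+ j) X0 (j.+2`!%:R) F0 => X X0 F F0; field.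
  by rewrite X0 !gt_eqF.
by rewrite ler_wpM2l// mulr_ge0 ?sqr_ge0// ltW.
Qed.

Lemma bump_dist t s : `|t| < d -> d <= `|s| ->
  0 < d ^+ 2 - t ^+ 2 /\ d ^+ 2 - t ^+ 2 <= 2 * d * `|t - s|.
Proof.
move=> td ds; have := ler_normD (s - t) t; rewrite subrK distrC => h.
rewrite -(real_normK (num_real t)); have := normr_ge0 t.
move: (`|t|) (`|s|) (`|t - s|) td ds h => p q r td ds h p0; split; nra.
Qed.

Lemma bump_le k j t : `|t| < d ->
  `|bump k j t| <= d ^+ k * (j.+2`!%:R * (d ^+ 2 - t ^+ 2) ^+ 2).
Proof.
move=> td; rewrite /bump td -mulrA normrM.
have q0 : 0 < d ^+ 2 - t ^+ 2.
  by rewrite subr_gt0 -(real_normK (num_real t)) ltrXn2r// nnegrE ltW.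
apply: ler_pM => //.
  by rewrite normrX lerXn2r ?nnegrE ?(ltW d0)// ltW.
by rewrite ger0_norm ?mulr_ge0 ?expR_ge0 ?invr_ge0 ?exprn_ge0 ?(ltW q0)// exp_decay.
Qed.

Lemma derive_quadratic f x K : (forall y, `|f y - f x| <= K * (y - x) ^+ 2) ->
  is_derive x (1 : R) f 0.
Proof.
move=> h; have K0 : 0 <= K.
  have := h (x + 1); rewrite (_ : x + 1 - x = 1); last by ring.
  by rewrite expr1n mulr1; apply: le_trans.
have lim : (fun y => y^-1 *: (f (y *: (1 : R) + x) - f x)) y @[y --> 0^'] --> (0 : R).
  apply: norm_cvg0; apply: (@squeeze_cvgr _ _ _ _ (cst 0) (fun y => K * `|y|)).
  - near=> y; rewrite normr_ge0/= normrZ normfV.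
    have y0 : y != 0 by near: y; exact: nbhs_dnbhs_neq.
    rewrite ler_pdivrMl ?normr_gt0// scaler1.
    rewrite (le_trans (h _))// addrK -(real_normK (num_real y)).
    by rewrite le_eqVlt; apply/orP; left; apply/eqP; ring.
  - exact: cvg_cst.
  - rewrite -[X in _ --> X](mulr0 K); apply: cvgM; first exact: cvg_cst.
    have c0 : `|y| @[y --> (0 : R)] --> `|(0 : R)| by exact: continuous_abs.
    rewrite normr0 in c0; apply: (cvg_trans _ c0); apply: cvg_app; exact: nbhs_dnbhs.
apply: DeriveDef; first by apply/cvg_ex; exists 0; exact: lim.
by rewrite /derive; apply/cvg_lim => //; exact: lim.
Unshelve. all: by end_near. Qed.

(** For [k = 0] the truncated [k.-1] is harmless, its coefficient being 0. *)
Definition dbump k j t : R :=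
  k%:R * bump k.-1 j t + 2 * j%:R * bump k.+1 j.+1 t - 2 * bump k.+1 j.+2 t.

(** Inside the interval this is the product and chain rule. At the edge and beyond, [bump_le] and
    [bump_dist] bound the function by a multiple of the squared distance, so the derivative is 0. *)
Lemma bump_derive k j t : is_derive t (1 : R) (bump k j) (dbump k j t).
Proof.
have [td|td] := ltP `|t| d; last first.
  have z k' j' : bump k' j' t = 0 by rewrite /bump ltNge td.
  rewrite /dbump !z !mulr0 addr0 subr0.
  apply: (@derive_quadratic _ _ (d ^+ k * (j.+2`!%:R * (2 * d) ^+ 2))) => y.
  rewrite z subr0; have [yd|yd] := ltP `|y| d; last first.
    rewrite /bump ltNge yd normr0; apply: mulr_ge0; last exact: sqr_ge0.
    apply: mulr_ge0; first by rewrite exprn_ge0// ltW.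
    by apply: mulr_ge0; [exact: ler0n|exact: sqr_ge0].
  have [q0 q1] := bump_dist yd td.
  apply: (le_trans (bump_le k j yd)); rewrite -mulrA ler_wpM2l ?exprn_ge0 ?(ltW d0)//.
  rewrite -mulrA ler_wpM2l ?ler0n// -exprMn -(real_normK (num_real (_ * (y - t)))).
  rewrite lerXn2r ?nnegrE ?(ltW q0)//; apply: (le_trans q1).
  by rewrite normrM (ger0_norm (_ : 0 <= 2 * d))// mulr_ge0// ltW.
have q0 : 0 < d ^+ 2 - t ^+ 2.
  by rewrite subr_gt0 -(real_normK (num_real t)) ltrXn2r// nnegrE ltW.
pose g y : R := y ^+ k * (d ^+ 2 - y ^+ 2) ^- j * expR (- (d ^+ 2 - y ^+ 2)^-1).
apply: (@near_eq_is_derive R R^o R^o g).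
  near=> y; rewrite /bump ifT//; near: y.
  have : {for t, continuous (fun y : R => `|y|)} by exact: continuous_abs.
  by move/cvgr_lt; apply.
have dq : is_derive t (1 : R) (fun y => d ^+ 2 - y ^+ 2) (- (2 * t)).
  have -> : (fun y : R => d ^+ 2 - y ^+ 2) = (fun y => d ^+ 2 - y * y).
    by apply/funext => y; rewrite (expr2 y).
  by apply: (drv_eq (drvB (drv_cst (d ^+ 2) t) (drvM (drv_id t) (drv_id t)))); ring.
have qn : d ^+ 2 - t ^+ 2 != 0 by rewrite gt_eqF.
have dV : is_derive t (1 : R) (fun y => (d ^+ 2 - y ^+ 2)^-1)
    (2 * t * (d ^+ 2 - t ^+ 2)^-1 * (d ^+ 2 - t ^+ 2)^-1).
  have dV := is_deriveV (f := fun y => d ^+ 2 - y ^+ 2) (x := t) (v := 1) qn dq.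
  by apply: (drv_eq dV); rewrite /GRing.scale/= expr2 invfM; ring.
have dX (n : nat) (f : R -> R) a : is_derive t (1 : R) f a ->
    is_derive t (1 : R) (fun y => f y ^+ n) (n%:R * f t ^+ n.-1 * a).
  move=> hf; elim: n => [|n IH].
    by under eq_fun do rewrite expr0; rewrite !mul0r; exact: drv_cst.
  under eq_fun do rewrite exprS; apply: (drv_eq (drvM hf IH)).
  by case: (n) => [|p] /=; rewrite ?expr0 -?natr1 ?exprS; ring.
have -> : g = (fun y => y ^+ k * (d ^+ 2 - y ^+ 2)^-1 ^+ j *
    expR (-1 * (d ^+ 2 - y ^+ 2)^-1)).
  by apply/funext => y; rewrite /g exprVn mulN1r.
have dE := @drv_comp R expR (fun y => -1 * (d ^+ 2 - y ^+ 2)^-1) t _ _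
  (is_derive_expR (-1 * (d ^+ 2 - t ^+ 2)^-1)) (drvZ (-1) dV).
apply: (drv_eq (drvM (drvM (dX k _ _ (drv_id t)) (dX j _ _ dV)) dE)).
rewrite /dbump /bump td -!exprVn !mulN1r.
set q := (d ^+ 2 - t ^+ 2)^-1; set E := expR (- q); clearbody E; clearbody q.
have jq : j%:R * q ^+ j.-1 * q = j%:R * q ^+ j.
  by case: (j) => [|n]; rewrite ?mul0r// exprSr mulrA.
have -> : t ^+ k * (j%:R * q ^+ j.-1 * (2 * t * q * q)) =
  2 * t ^+ k * t * q * (j%:R * q ^+ j.-1 * q) by ring.
by rewrite jq (exprS t k) (exprS q j.+1) (exprS q j); ring.
Unshelve. all: by end_near. Qed.

(** Closed under differentiation and under [tmul]: the first gives decay of the transforms, the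
    second their derivatives. *)
Inductive bump_span : (R -> R) -> Prop :=
| bump_span_base k j : bump_span (bump k j)
| bump_spanD f g : bump_span f -> bump_span g -> bump_span (fun t => f t + g t)
| bump_spanZ c f : bump_span f -> bump_span (fun t => c * f t).

Lemma bump_span_derive w : bump_span w ->
  exists2 w', bump_span w' & forall t, is_derive t (1 : R) w (w' t).
Proof.
elim=> [k j|f g _ [f' hf df] _ [g' hg dg]|c f _ [f' hf df]].
- exists (fun t => k%:R * bump k.-1 j t + 2 * j%:R * bump k.+1 j.+1 t + - 2 * bump k.+1 j.+2 t).
    by do !apply: bump_spanD; apply: bump_spanZ; exact: bump_span_base.
  by move=> t; apply: (drv_eq (bump_derive k j t)); rewrite /dbump mulNr.
- by exists (fun t => f' t + g' t); [exact: bump_spanD|move=> t; exact: drvD].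
- by exists (fun t => c * f' t); [exact: bump_spanZ|move=> t; exact: drvZ].
Qed.

Lemma bump_span_tmul w : bump_span w -> bump_span (tmul w).
Proof.
elim=> [k j|f g _ hf _ hg|c f _ hf].
- have -> : tmul (bump k j) = (fun t => 2 * pi * bump k.+1 j t).
    apply/funext => t; rewrite /tmul /bump; case: ifP => _; last by rewrite !mulr0.
    by rewrite (exprS t k); ring.
  by apply: bump_spanZ; exact: bump_span_base.
- have -> : tmul (fun t => f t + g t) = (fun t => tmul f t + tmul g t).
    by apply/funext => t; rewrite /tmul mulrDr.
  exact: bump_spanD.
- have -> : tmul (fun t => c * f t) = (fun t => c * tmul f t).
    by apply/funext => t; rewrite /tmul mulrCA.
  exact: bump_spanZ.
Qed.

Lemma bump_span_supp w t : bump_span w -> d <= `|t| -> w t = 0.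
Proof.
move=> hw td; elim: hw => [k j|f g _ hf _ hg|c f _ hf].
- by rewrite /bump ltNge td.
- by rewrite hf hg addr0.
- by rewrite hf mulr0.
Qed.

Lemma bump_span_continuous w : bump_span w -> continuous w.
Proof.
by move=> /bump_span_derive[w' _ dw]; apply: drv_continuous => t; exists (w' t).
Qed.

Lemma bump_span_bcs w : bump_span w -> bcs d w.
Proof.
move=> hw; split.
- exact: (mfun_continuous (bump_span_continuous hw)).
- elim: hw => [k j|f g _ [Mf hf] _ [Mg hg]|c f _ [M hM]].
  + exists (d ^+ k * (j.+2`!%:R * (d ^+ 2) ^+ 2)) => t.
    have B0 : 0 <= j.+2`!%:R :> R by exact: ler0n.
    have [td|td] := ltP `|t| d; last first.
      rewrite /bump ltNge td normr0; apply: mulr_ge0; first by rewrite exprn_ge0// ltW.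
      by apply: mulr_ge0 => //; exact: sqr_ge0.
    apply: (le_trans (bump_le k j td)); rewrite ler_wpM2l ?exprn_ge0 ?(ltW d0)//.
    rewrite ler_wpM2l// lerXn2r ?nnegrE ?sqr_ge0//.
      by rewrite subr_ge0 -(real_normK (num_real t)) lerXn2r ?nnegrE ?(ltW d0)// ltW.
    by rewrite gerBl sqr_ge0.
  + by exists (Mf + Mg) => t; rewrite (le_trans (ler_normD _ _))// lerD.
  + by exists (`|c| * M) => t; rewrite normrM ler_wpM2l.
- by move=> t /ltW td; exact: bump_span_supp.
Qed.

(** Integration by parts; the boundary terms at [d] and [- d] vanish. Each use trades a factor [y]
    for a derivative, which is the induction in [bump_decay]. *)
Lemma int_bump_derive w w' y : bump_span w -> bump_span w' ->
  (forall t, is_derive t (1 : R) w (w' t)) ->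
  2 * pi * y * Fc w y = - Fs w' y /\ 2 * pi * y * Fs w y = Fc w' y.
Proof.
move=> hw hw' dw; have hb := bump_span_bcs hw; have hb' := bump_span_bcs hw'.
have d0' := d0; have dd : - d <= d by lra.
have cc (c : R) : continuous (fun _ : R => c) by move=> t; exact: cvg_cst.
have cw := bump_span_continuous hw; have cw' := bump_span_continuous hw'.
have ends t : `|t| = d -> w t = 0 by move=> td; apply: bump_span_supp; rewrite ?td.
have ed : w d = 0 by apply: ends; rewrite gtr0_norm.
have emd : w (- d) = 0 by apply: ends; rewrite normrN gtr0_norm.
have L1s g : L1 g -> L1 (fun x => g x * sin (2 * pi * x * y)).
  by move=> hg; apply: L1Mb => //; [exact: mfun_sinr|exact: bounded_sin].
have L1c g : L1 g -> L1 (fun x => g x * cos (2 * pi * x * y)) by exact: L1_cos.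
have wi := bcs_L1 hb; have wi' := bcs_L1 hb'.
have ext (F : R -> R) : (forall t, d < `|t| -> F t = 0) ->
    int (fun t => ind (- d) d t * F t) = int F.
  move=> F0; apply: eq_int => t; rewrite /ind; have [td|td] := leP `|t| d.
    by rewrite -ler_norml td mul1r.
  by rewrite F0// mulr0.
have zz t : d < `|t| -> w t = 0 /\ w' t = 0.
  by move=> /ltW td; split; exact: bump_span_supp.
split.
- have FTC := @int_ind_FTC R (fun t => w t * sin (2 * pi * y * t))
    (fun t => w' t * sin (2 * pi * y * t) + w t * (2 * pi * y * cos (2 * pi * y * t))) (- d) d dd.
  rewrite ext in FTC; last by move=> t /zz[-> ->]; rewrite !mul0r addr0.
  have := FTC (fun t => drvM (dw t) (drv_sin (2 * pi * y) t)) _.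
  rewrite ed emd !mul0r subrr => {FTC} FTC.
  have {}FTC := FTC (continuous_add (continuous_mul cw' (@continuous_sinl R _))
     (continuous_mul cw (continuous_mul (@cc _) (@continuous_cosl R _)))).
  rewrite -[LHS](subrK (- Fs w' y)) [X in X + _](_ : _ = 0) ?add0r//.
  rewrite opprK -FTC addrC /Fs /Fc -(intZ _ (L1c _ wi)) -(intD (L1s _ wi') (L1Z _ (L1c _ wi))).
  apply: eq_int => t; congr (_ * sin _ + _); first ring.
  by rewrite mulrCA; congr (_ * (_ * cos _)); ring.
- have FTC := @int_ind_FTC R (fun t => w t * cos (2 * pi * y * t))
    (fun t => w' t * cos (2 * pi * y * t) + w t * (- (2 * pi * y) * sin (2 * pi * y * t))) (- d) d dd.
  rewrite ext in FTC; last by move=> t /zz[-> ->]; rewrite !mul0r addr0.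
  have := FTC (fun t => drvM (dw t) (drv_cos (2 * pi * y) t)) _.
  rewrite ed emd !mul0r subrr => {FTC} FTC.
  have {}FTC := FTC (continuous_add (continuous_mul cw' (@continuous_cosl R _))
     (continuous_mul cw (continuous_mul (@cc _) (@continuous_sinl R _)))).
  apply/esym/eqP; rewrite -subr_eq0; apply/eqP.
  rewrite -FTC /Fs /Fc -(intZ _ (L1s _ wi)) -(intB (L1c _ wi') (L1Z _ (L1s _ wi))).
  apply: eq_int => t; congr (_ * cos _ + _); first ring.
  by rewrite mulNr mulrN mulrCA; congr (- (_ * (_ * sin _))); ring.
Qed.

Lemma bump_decay (m : nat) w : bump_span w ->
  (exists K, forall y, `|y ^+ m * Fc w y| <= K) /\ (exists K, forall y, `|y ^+ m * Fs w y| <= K).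
Proof.
have p0 : 0 < 2 * pi :> R by rewrite mulr_gt0// pi_gt0.
elim: m w => [|m IH] w hw.
  have wi := bcs_L1 (bump_span_bcs hw).
  split; exists (int (fun x => `|w x|)) => y; rewrite expr0 mul1r; [exact: Fc_le|exact: Fs_le].
have [w' hw' dw] := bump_span_derive hw; have [[Kc hc] [Ks hs]] := IH w' hw'.
split.
- exists (Ks / (2 * pi)) => y; rewrite ler_pdivlMr// -(gtr0_norm p0) -normrM.
  have [e _] := int_bump_derive y hw hw' dw.
  rewrite (_ : y ^+ m.+1 * Fc w y * (2 * pi) = y ^+ m * (2 * pi * y * Fc w y)); last by rewrite exprSr; ring.
  by rewrite e mulrN normrN.
- exists (Kc / (2 * pi)) => y; rewrite ler_pdivlMr// -(gtr0_norm p0) -normrM.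
  have [_ e] := int_bump_derive y hw hw' dw.
  rewrite (_ : y ^+ m.+1 * Fs w y * (2 * pi) = y ^+ m * (2 * pi * y * Fs w y)); last by rewrite exprSr; ring.
  by rewrite e.
Qed.

(** The factors [Fc k] and [Fs k], with [k] merely bounded of compact support, have bounded
    derivatives of all orders but perhaps no fast decay. Each product contains the transform of a
    bump, which supplies the decay. *)
Inductive schwartz_span S : (R -> R) -> Prop :=
| schwartz_Fc w : bump_span w -> schwartz_span S (Fc w)
| schwartz_Fs w : bump_span w -> schwartz_span S (Fs w)
| schwartz_MFc (k g : R -> R) : bcs S k -> schwartz_span S g -> schwartz_span S (fun x => Fc k x * g x)
| schwartz_MFs (k g : R -> R) : bcs S k -> schwartz_span S g -> schwartz_span S (fun x => Fs k x * g x)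
| schwartz_D f g : schwartz_span S f -> schwartz_span S g ->
    schwartz_span S (fun x => f x + g x)
| schwartz_N f : schwartz_span S f -> schwartz_span S (fun x => - f x).

Lemma schwartz_spanP S f : schwartz_span S f -> schwartz f.
Proof.
apply: schwartz_of_class => {f} f hf.
  elim: hf => [w hw|w hw|k c hk hc [c' hc' dc]|k c hk hc [c' hc' dc]
    |f1 g _ [f' hf df] _ [g' hg dg]|f1 _ [f' hf df]].
  - exists (fun x => - Fs (tmul w) x).
      by apply: schwartz_N; apply: schwartz_Fs; exact: bump_span_tmul.
    by move=> x; exact: (FcFs_derive x (bump_span_bcs hw)).1.
  - exists (Fc (tmul w)); first by apply: schwartz_Fc; exact: bump_span_tmul.
    by move=> x; exact: (FcFs_derive x (bump_span_bcs hw)).2.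
  - exists (fun x => - (Fs (tmul k) x * c x) + Fc k x * c' x).
      apply: schwartz_D; last exact: schwartz_MFc.
      by apply: schwartz_N; apply: schwartz_MFs => //; exact: bcs_tmul.
    by move=> x; apply: (drv_eq (drvM (FcFs_derive x hk).1 (dc x))); rewrite mulNr.
  - exists (fun x => Fc (tmul k) x * c x + Fs k x * c' x).
      apply: schwartz_D; last exact: schwartz_MFs.
      by apply: schwartz_MFc => //; exact: bcs_tmul.
    by move=> x; exact: (drvM (FcFs_derive x hk).2 (dc x)).
  - by exists (fun x => f' x + g' x); [exact: schwartz_D|move=> x; exact: drvD].
  - exists (fun x => - f' x); first exact: schwartz_N.
    move=> x; have -> : (fun x => - f1 x) = (fun x => -1 * f1 x).
      by apply/funext => z; rewrite mulN1r.
    by apply: (drv_eq (drvZ (-1) (df x))); rewrite mulN1r.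
move=> m; elim: hf => [w hw|w hw|k c hk hc [K hK]|k c hk hc [K hK]
    |f1 g _ [Kf hf] _ [Kg hg]|f1 _ [K hK]].
- exact: (bump_decay m hw).1.
- exact: (bump_decay m hw).2.
- exists (int (fun x => `|k x|) * K) => x; rewrite mulrCA normrM ler_pM//.
  by apply: Fc_le; exact: bcs_L1 hk.
- exists (int (fun x => `|k x|) * K) => x; rewrite mulrCA normrM ler_pM//.
  by apply: Fs_le; exact: bcs_L1 hk.
- by exists (Kf + Kg) => x; rewrite mulrDr (le_trans (ler_normD _ _))// lerD.
- by exists K => x; rewrite mulrN normrN.
Qed.

End Bump.

End Schwartz.

(** * The density functional, and approximation by Schwartz functions *)

Section Approximation.
Variable R : realType.
Implicit Types (f g h k phi : R -> R) (e r x y S : R).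

(** Defined as a transform instead of a quotient, so that continuity at 0 and the bound by 1 come
    for free; elsewhere it is the quotient in [W_fun] ([sincE]). *)
Definition sinc x : R := 2^-1 * Fc (ind (-1) 1) x.

Lemma sincE x : x != 0 -> sinc x = sin (2 * pi * x) / (2 * pi * x).
Proof.
move=> x0; have p0 : 2 * pi * x != 0 by rewrite !mulf_neq0// gt_eqF// pi_gt0.
have dF y : is_derive y (1 : R) (fun y => (2 * pi * x)^-1 * sin (2 * pi * x * y))
    (cos (2 * pi * x * y)).
  by apply: (drv_eq (drvZ (2 * pi * x)^-1 (drv_sin (2 * pi * x) y))); rewrite mulrA mulVf ?mul1r.
have h : (-1 : R) <= 1 by lra.
have := int_ind_FTC h dF (@continuous_cosl R (2 * pi * x)).
rewrite /sinc /Fc; under eq_int do rewrite cos_comm.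
by move: (2 * pi * x) p0 => p p0 ->; rewrite mulrN mulr1 sinN; field.
Qed.

Lemma sinc_continuous : continuous sinc.
Proof.
apply: continuous_mul; first by move=> ?; exact: cvg_cst.
by apply: Fc_continuous; exact: L1_ind.
Qed.

Lemma sinc_le1 x : `|sinc x| <= 1.
Proof.
rewrite /sinc normrM ger0_norm//; have := Fc_le x (@L1_ind R (-1) 1).
under eq_int do rewrite ger0_norm ?ind_ge0//.
by rewrite int_ind; lra.
Qed.

Lemma bounded_sinc : bounded sinc.
Proof. by exists 1 => x; exact: sinc_le1. Qed.

Lemma mfun_sinc : mfun sinc.
Proof. by apply: mfun_continuous; exact: sinc_continuous. Qed.

Lemma int_sinc phi : L1 phi ->
  int (fun x => phi x * sinc x) = 2^-1 * int (fun y => ind (-1) 1 y * Fc phi y).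
Proof.
move=> hp; rewrite /sinc; under eq_int do rewrite mulrCA.
rewrite intZ; last first.
  apply: L1Mb => //; first by apply: mfun_continuous; apply: Fc_continuous; exact: L1_ind.
  by exists (int (fun x => `|ind (-1) 1 x|)) => x; apply: Fc_le; exact: L1_ind.
congr (_ * _).
have -> : (fun x => phi x * Fc (ind (-1) 1) x) =
    (fun x => phi x * int (fun y => ind (-1) 1 y * cos (2 * pi * x * y))).
  by apply/funext => x; congr (_ * _); apply: eq_int => y; rewrite cos_comm.
apply: (@fubini R phi (ind (-1) 1) (fun x y => cos (2 * pi * x * y)) 1 hp (@L1_ind R (-1) 1)).
  exact: mfun2_cos.
by move=> x y; rewrite ler_norml cos_geN1 cos_le1.
Qed.

(** The part of the 1-level density that depends on the shape of [phi]. The delta part of [W] is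
    left out, as it shifts every rank bound by the same constant. *)
Definition density e phi : R :=
  Fc phi 0 + e * (2^-1 * int (fun y => ind (-1) 1 y * Fc phi y)).

Lemma densityE e phi : L1 phi ->
  density e phi = int (fun x => phi x * (1 + e * sinc x)).
Proof.
move=> hp; rewrite /density Fc0 -(int_sinc hp) -intZ; last first.
  by apply: L1Mb => //; [exact: mfun_sinc|exact: bounded_sinc].
rewrite -(intD hp); first by apply: eq_int => x; rewrite mulrDr mulr1 mulrCA.
by apply: L1Z; apply: L1Mb => //; [exact: mfun_sinc|exact: bounded_sinc].
Qed.

Lemma L1_density e phi : L1 phi -> L1 (fun x => phi x * (1 + e * sinc x)).
Proof.
move=> hp; under eq_fun do rewrite mulrDr mulr1 mulrCA.
by apply: L1D => //; apply: L1Z; apply: L1Mb => //; [exact: mfun_sinc|exact: bounded_sinc].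
Qed.

(** A non-negative weight makes [density] monotone in the test function, which is how mollification
    is controlled. *)
Lemma sinc_weight_ge0 e x : `|e| <= 1 -> 0 <= 1 + e * sinc x.
Proof.
move=> he; have : `|e * sinc x| <= 1.
  by rewrite normrM -(mulr1 1) ler_pM// sinc_le1.
by rewrite ler_norml => /andP[h _]; rewrite -lerBlDl sub0r.
Qed.

Lemma density_sqF S e f : bcs S f -> evenf f -> ae_continuous f ->
  density e (sqF f) = Bform e f f.
Proof.
move=> hf ef cf; rewrite /density /Bform (Kform_acor hf).
have -> : Fc (sqF f) = acor f.
  by apply/funext => y; rewrite (Fc_sqF hf ef cf) acor_conv.
by rewrite acor0.
Qed.

(** Adding the two radii, rather than doubling the larger, keeps a function supported within
    [sigma - d] inside [sigma] after convolution with a bump of radius [d]. *)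
Lemma conv_supp_add S d f g : bcs S f -> bcs d g -> bcs (S + d) (conv f g).
Proof.
move=> hf hg; have hf' : bcs (Num.max S d) f.
  by apply: bcs_le hf; rewrite le_max lexx.
have hg' : bcs (Num.max S d) g by apply: bcs_le hg; rewrite le_max lexx orbT.
have [m b _] := conv_bcs hf' hg'; split => // y yS; rewrite /conv -[RHS](@int0 R).
apply: eq_int => t; have [tS|tS] := ltP S `|t|; first by have [_ _ ->] := hf; rewrite ?mul0r.
have [_ _ ->] := hg; rewrite ?mulr0//.
by have := ler_normD (y - t) t; rewrite subrK; lra.
Qed.

Lemma ae_continuous_if (P : R -> bool) S f g : (forall y, y < S -> P y) ->
  (forall y, S < y -> ~~ P y) -> ae_continuous f -> ae_continuous g ->
  ae_continuous (fun x => if P `|x| then f x else g x).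
Proof.
move=> P1 P2 [s hs] [s' hs']; exists [:: S, - S & s ++ s'] => x.
rewrite !inE !negb_or mem_cat negb_or => /and3P[x1 x2 /andP[xs xs']].
have c0 : {for x, continuous (fun y : R => `|y|)} by exact: continuous_abs.
have locally_eq (F h : R -> R) : {for x, continuous h} ->
    (\forall y \near x, F y = h y) -> {for x, continuous F}.
  move=> ch hF; apply/cvgrPdist_lt => r r0; move/cvgrPdist_lt/(_ _ r0): ch => ch.
  by near=> y; rewrite (nbhs_singleton hF) (near hF y)//; near: y.
have [xS|xS] := ltP `|x| S.
  apply: (locally_eq _ f); first exact: hs.
  by near=> y; rewrite P1//; near: y; exact: (cvgr_lt _ c0).
have {}xS : S < `|x|.
  rewrite lt_neqAle xS andbT; apply/negP => /eqP SE.
  move: x1 x2; rewrite SE; have [x0|x0] := leP 0 x; first by rewrite ger0_norm ?eqxx.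
  by rewrite ltr0_norm// opprK eqxx.
apply: (locally_eq _ g); first exact: hs'.
by near=> y; rewrite (negbTE (P2 _ _))//; near: y; exact: (cvgr_gt _ c0).
Unshelve. all: by end_near. Qed.

Lemma ae_continuous_all f : continuous f -> ae_continuous f.
Proof. by move=> cf; exists [::] => x _; exact: cf. Qed.

Lemma ae_continuous_trunc S f : ae_continuous f ->
  ae_continuous (fun x => ind (- S) S x * f x).
Proof.
move=> cf; rewrite (_ : (fun x => _) = (fun x => if `|x| <= S then f x else 0)).
  apply: (@ae_continuous_if (fun y => y <= S) S f (fun=> 0)) => //.
  - by move=> y /ltW.
  - by move=> y; rewrite -ltNge.
  - by apply: ae_continuous_all => x; exact: cvg_cst.
apply/funext => x; rewrite /ind -ler_norml.
by case: ifP => _; rewrite ?mul1r ?mul0r.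
Qed.

Section Mollify.
Variables (e sigma : R) (f0 : R -> R).
Hypotheses (he : `|e| <= 1) (s0 : 0 < sigma).
Hypotheses (hf : bcs sigma f0) (ef : evenf f0) (cf : ae_continuous f0).
Hypothesis I0 : int f0 != 0.

Let cut (n : nat) x : R := ind (- (sigma - eps_ R n)) (sigma - eps_ R n) x * f0 x.

Let cut_bcs n : bcs (sigma - eps_ R n) (cut n).
Proof.
have [mf [M hM] _] := hf; split.
- by apply: mfunM => //; exact: mfun_ind.
- exists (1 * M) => x; rewrite /cut normrM ler_pM//; exact: ind_le1.
- by move=> x xs; rewrite /cut /ind -ler_norml leNgt xs mul0r.
Qed.

Let cut_even n : evenf (cut n).
Proof. by move=> x; rewrite /cut ef /ind -!ler_norml normrN. Qed.

Let cut_cvg x : x \notin [:: sigma; - sigma] -> cut n x @[n --> \oo] --> f0 x.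
Proof.
rewrite !inE negb_or => /andP[x1 x2].
have [xs|xs] := ltP `|x| sigma; last first.
  have -> : f0 x = 0.
    have [_ _ ->//] := hf; rewrite lt_neqAle xs andbT; apply/negP => /eqP SE.
    move: x1 x2; rewrite SE; have [x0|x0] := leP 0 x.
      by rewrite ger0_norm ?eqxx.
    by rewrite ltr0_norm// opprK eqxx.
  rewrite (_ : (fun n => cut n x) = (fun=> 0)); first exact: cvg_cst.
  apply/funext => n; have [_ _ ->//] := cut_bcs n.
  by have := eps_gt0 R n; lra.
apply/cvgrPdist_lt => r r0; near=> n.
rewrite /cut /ind -ler_norml (_ : `|x| <= sigma - eps_ R n) ?mul1r ?subrr ?normr0//.
rewrite lerBrDl -lerBrDr ltW//; near: n; apply: (cvgr_lt _ (@cvg_eps R)); lra.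
Unshelve. all: by end_near. Qed.

Let cut_bound : exists2 M, 0 <= M & forall n x, `|cut n x| <= M * ind (- sigma) sigma x.
Proof.
have [M M0 hM] := bcs_bound hf; exists M => // n x.
rewrite /cut normrM (le_trans _ (hM x))// ler_piMl//; exact: ind_le1.
Qed.

Let mcut n : mfun (cut n). Proof. by case: (cut_bcs n). Qed.

Let mf0 : mfun f0. Proof. by case: hf. Qed.

Let cut_int : int (cut n) @[n --> \oo] --> int f0.
Proof.
have [M M0 hM] := cut_bound.
exact: (int_dct mcut mf0 (L1Z M (@L1_ind R _ _)) hM cut_cvg).2.
Qed.

Let cut_Kop x : Kop (cut n) x @[n --> \oo] --> Kop f0 x.
Proof.
have [M M0 hM] := cut_bound.
have mk : mfun (fun y => ker (x - y)).
  by apply: mfun_sub_l; exact: mfun_ker.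
refine (int_dct (s := [:: sigma; - sigma]) (fun n => mfunM (mcut n) mk) (mfunM mf0 mk)
  (L1Z M (@L1_ind R (- sigma) sigma)) _ _).2.
  move=> n y; rewrite normrM (le_trans _ (hM n y))// ler_piMr//.
  by rewrite (le_trans (ker_le _))//; lra.
by move=> y ys; apply: cvgM; [exact: cut_cvg|exact: cvg_cst].
Qed.

Let cut_Bform : Bform e (cut n) (cut n) @[n --> \oo] --> Bform e f0 f0.
Proof.
have [M M0 hM] := cut_bound.
have ML := L1Z M (@L1_ind R (- sigma) sigma).
have Mb n x : `|cut n x| <= M by rewrite (le_trans (hM n x))// ler_piMr// (le_trans (ler_norm _))// ind_le1.
have cL n := bcs_L1 (cut_bcs n).
apply: cvgD.
  refine (int_dct (s := [:: sigma; - sigma]) (fun n => mfunM (mcut n) (mcut n)) (mfunM mf0 mf0)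
    (L1Z M ML) _ _).2.
    by move=> n x; rewrite normrM ler_pM.
  by move=> y ys; apply: cvgM; exact: cut_cvg.
apply: cvgM; first exact: cvg_cst.
refine (int_dct (s := [:: sigma; - sigma]) (fun n => L1_mfun (L1_Kform (cL n) (cL n)))
    (L1_mfun (L1_Kform (bcs_L1 hf) (bcs_L1 hf)))
    (L1Z (2^-1 * int (fun x => M * ind (- sigma) sigma x)) ML) _ _).2.
  move=> n x; rewrite normrM mulrC ler_pM//; apply: (le_trans (Kop_le _ (cL n))).
  by rewrite ler_wpM2l//; apply: int_le => //; exact: L1_abs.
by move=> y ys; apply: cvgM; [exact: cut_cvg|exact: cut_Kop].
Qed.

Lemma truncation_approx r : 0 < r -> exists n,
  int (cut n) != 0 /\
  Bform e (cut n) (cut n) / int (cut n) ^+ 2 < Bform e f0 f0 / int f0 ^+ 2 + r.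
Proof.
move=> r0.
have h : Bform e (cut n) (cut n) / int (cut n) ^+ 2 @[n --> \oo]
    --> Bform e f0 f0 / int f0 ^+ 2.
  apply: cvgM; first exact: cut_Bform.
  apply: cvgV; first by rewrite expf_neq0.
  by under eq_fun do rewrite expr2; rewrite expr2; apply: cvgM; exact: cut_int.
have hr : Bform e f0 f0 / int f0 ^+ 2 < Bform e f0 f0 / int f0 ^+ 2 + r by rewrite ltrDl.
have [n1 _ h1] := cvgr_lt _ h _ hr.
have i0 : 0 < `|int f0| by rewrite normr_gt0.
have [n2 _ h2] := (@cvgr_dist_lt _ _ _ _ _ _ _ cut_int _ i0).
exists (n1 + n2)%N; split; last exact/h1/leq_addr.
have /= := h2 (n1 + n2)%N (leq_addl _ _); apply: contraTneq => ->.
by rewrite subr0 ltxx.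
Qed.

(** Convolution with [rho] multiplies [sqF k] by the square of [Fc rho], which is at most [q ^+ 2]
    because [rho] is non-negative with integral [q]. By monotonicity the form grows at most by
    [q ^+ 2], while the squared integral grows by exactly this factor, so the quotient does not
    increase. *)
Lemma mollify k d : 0 < d -> bcs (sigma - d) k -> evenf k -> ae_continuous k ->
  0 < sigma - d -> int k != 0 ->
  exists h, [/\ bcs sigma h, evenf h, ae_continuous h & int h != 0] /\
    schwartz (sqF h) /\ Bform e h h / int h ^+ 2 <= Bform e k k / int k ^+ 2.
Proof.
move=> d0 hk ek ck sd k0; pose rho := bump d 0 0; pose q := int rho.
have hr : bump_span d rho by exact: bump_span_base.
have rb : bcs d rho by exact: bump_span_bcs.
have re : evenf rho by move=> x; rewrite /rho /bump normrN sqrrN !expr0.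
have hks : bcs sigma k by apply: bcs_le hk; lra.
have hrs : bcs sigma rho by apply: bcs_le rb; lra.
have q0 : 0 < q.
  have d2 : 0 < d / 2 by rewrite divr_gt0.
  pose c := expR (- (d ^+ 2 - (d / 2) ^+ 2)^-1).
  have : int (fun x => c * ind (- (d / 2)) (d / 2) x) <= q.
    apply: int_le; [by apply: L1Z; exact: L1_ind|exact: bcs_L1 rb|move=> x].
    rewrite /ind -ler_norml /rho /bump !expr0 invr1 !mul1r.
    have [xd|xd] := leP `|x| (d / 2); last by rewrite mulr0; case: ifP => // _; exact: expR_ge0.
    have xd' : `|x| < d by lra.
    rewrite mulr1 xd' /c ler_expR lerN2 -(real_normK (num_real x)).
    have x0 := normr_ge0 x; move: `|x| x0 xd {xd'} => t t0 td.
    have p1 : t ^+ 2 <= (d / 2) ^+ 2 by rewrite lerXn2r// nnegrE// ltW.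
    have p2 : 0 < d ^+ 2 - (d / 2) ^+ 2.
      rewrite (_ : d ^+ 2 - (d / 2) ^+ 2 = 3 / 4 * d ^+ 2); last by field.
      by rewrite mulr_gt0// exprn_gt0.
    by rewrite lef_pV2 ?posrE//; lra.
  rewrite intZ; last exact: L1_ind.
  rewrite int_ind; last by lra.
  by apply: lt_le_trans; rewrite mulr_gt0 ?expR_gt0//; lra.
pose h := conv k rho.
have hE x : Fc h x = Fc k x * Fc rho x by exact: (Fc_conv x hks hrs).
have hh : bcs sigma h by rewrite -(subrK d sigma); exact: conv_supp_add.
have eh : evenf h by exact: (conv_even hks hrs).
have ch : ae_continuous h.
  apply: ae_continuous_all; apply: (conv_continuous hks hrs).
  by apply: ae_continuous_all; exact: (bump_span_continuous d0 hr).
have ih : int h = int k * q by rewrite /q -(Fc0 h) hE !Fc0.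
exists h; split; [split => //; first by rewrite ih mulf_neq0// gt_eqF|split].
  apply: (@schwartz_spanP R d d0 sigma).
  have -> : sqF h = (fun x => Fc k x * (Fc k x * (Fc rho x * Fc rho x))).
    by apply/funext => x; rewrite /sqF hE expr2; ring.
  by do 3!apply: schwartz_MFc => //; exact: schwartz_Fc.
have Bk := density_sqF e hks ek ck; have Bh := density_sqF e hh eh ch.
rewrite (densityE _ (L1_sqF hks ek)) in Bk.
rewrite (densityE _ (L1_sqF hh eh)) in Bh.
have le : Bform e h h <= q ^+ 2 * Bform e k k.
  rewrite -Bk -Bh -intZ; last by apply: L1_density; exact: (L1_sqF hks ek).
  apply: int_le.
  - by apply: L1_density; exact: (L1_sqF hh eh).
  - by apply: L1Z; apply: L1_density; exact: (L1_sqF hks ek).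
  move=> x; rewrite mulrA ler_wpM2r ?sinc_weight_ge0//.
  rewrite /sqF hE exprMn mulrC ler_wpM2r ?sqr_ge0//.
  rewrite -(real_normK (num_real (Fc rho x))) lerXn2r ?nnegrE ?(ltW q0)//.
  apply: (le_trans (Fc_le _ (bcs_L1 rb))); rewrite le_eqVlt; apply/orP; left; apply/eqP.
  apply: eq_int => y; rewrite ger0_norm// /rho /bump !expr0 invr1 !mul1r.
  by case: ifP => // _; exact: expR_ge0.
have kk : 0 < int k ^+ 2 by rewrite lt_neqAle sqr_ge0 eq_sym expf_neq0.
have qq : 0 < q ^+ 2 by rewrite exprn_gt0.
rewrite ih exprMn ler_pdivrMr; last exact: mulr_gt0.
apply: (le_trans le); rewrite mulrA divfK; last by rewrite gt_eqF.
by rewrite mulrC.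
Qed.

Lemma schwartz_approx r : 0 < r -> exists h,
  [/\ bcs sigma h, evenf h, ae_continuous h & int h != 0] /\
  schwartz (sqF h) /\ Bform e h h / int h ^+ 2 < Bform e f0 f0 / int f0 ^+ 2 + r.
Proof.
move=> /truncation_approx[n [n0 hn]].
(* Otherwise the truncated function would vanish off 0, against its nonzero integral. *)
have sd : 0 < sigma - eps_ R n.
  rewrite ltNge; apply: contra n0 => sn; apply/eqP; rewrite -[RHS](@int0 R).
  apply: (@int_ae R _ _ [:: 0]); [exact: mcut|exact: mfun_cst|].
  move=> x; rewrite !inE => x0; have [_ _ ->//] := cut_bcs n.
  by apply: (le_lt_trans sn); rewrite normr_gt0.
have [h [h1 [h2 h3]]] := mollify (eps_gt0 R n) (cut_bcs n) (@cut_even n)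
  (ae_continuous_trunc _ cf) sd n0.
by exists h; split => //; split => //; exact: le_lt_trans hn.
Qed.

End Mollify.

End Approximation.

(** * The Euler-Lagrange equation of the explicit functions *)

Section Shape.
Variable R : realType.
Implicit Types (x y p q : R).

Let r : R := (Num.sqrt 2)^-1.

Let rr : r * r = 2^-1.
Proof. by rewrite /r -expr2 exprVn sqr_sqrtr. Qed.

Let r0 : 0 < r.
Proof. by rewrite invr_gt0 sqrtr_gt0. Qed.

Let r1 : r < 1.
Proof. by have := rr; have := r0; nra. Qed.

Lemma cos_piquarter : cos (pi / 4) = r :> R.
Proof.
have c0 : 0 < cos (pi / 4 : R).
  by apply: cos_gt0_pihalf; have := @pi_gt0 R => p0; apply/andP; split; lra.
have := tan_piquarter R; rewrite /tan => t; have sc : sin (pi / 4) = cos (pi / 4) :> R.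
  have cn : cos (pi / 4 : R) != 0 by rewrite gt_eqF.
  by rewrite -[LHS](divfK cn) t mul1r.
have := cos2Dsin2 (pi / 4 : R); rewrite sc; move: (cos _) c0 rr r0 => c c0 h1 h2 h3.
have : (c - r) * (c + r) = 0 by rewrite -subr_sqr !expr2 h1; move: h3; rewrite expr2; lra.
by move/eqP; rewrite mulf_eq0 => /orP[]/eqP; lra.
Qed.

Lemma sin_piquarter : sin (pi / 4) = r :> R.
Proof.
have := tan_piquarter R; rewrite /tan cos_piquarter => t.
by rewrite -[LHS](divfK (lt0r_neq0 r0)) t mul1r.
Qed.

Lemma drv_sin_aff (c b x : R) :
  is_derive x (1 : R) (fun y => sin (c * y + b)) (c * cos (c * x + b)).
Proof.
have h := drvD (drv_lin c x) (drv_cst b x).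
by apply: (drv_eq (@drv_comp R sin (fun y => c * y + b) x _ _ (is_derive_sin (c * x + b)) h)); ring.
Qed.

Lemma drv_cos_aff (c b x : R) :
  is_derive x (1 : R) (fun y => cos (c * y + b)) (- c * sin (c * x + b)).
Proof.
have h := drvD (drv_lin c x) (drv_cst b x).
by apply: (drv_eq (@drv_comp R cos (fun y => c * y + b) x _ _ (is_derive_cos (c * x + b)) h)); ring.
Qed.

Lemma continuous_cos_aff (c b : R) : continuous (fun y => cos (c * y + b)).
Proof. by apply: drv_continuous => x; eexists; exact: drv_cos_aff. Qed.

Lemma continuous_sin_aff (c b : R) : continuous (fun y => sin (c * y + b)).
Proof. by apply: drv_continuous => x; eexists; exact: drv_sin_aff. Qed.

(** Argument of the cosine of the middle piece at its left end [sigma - 1]. Hence the choice of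
    [coef1] is continuity there. *)
Definition phase (e sigma : R) := (2 * sigma - 3) / 4 - e * pi / 4.

Definition coef1 (e sigma : R) := cos (phase e sigma) / cos (r * (sigma - 1)).

(** Chosen so that [2 * (e * coef3)] is the integration constant joining the antiderivatives of the
    inner and the middle piece ([F12]). *)
Definition coef3 (e sigma : R) :=
  e * (coef1 e sigma * sin (r * (sigma - 1)) * r - sin (phase e sigma)).

(* With [e = 1] this is the unscaled SO(even) function, with [e = -1] the one
   of SO(odd) and Sp; [e] is the sign of the [eta]-part of the density. *)
Definition shape (e sigma x : R) : R :=
  if `|x| <= sigma - 1 then coef1 e sigma * cos (r * `|x|)
  else if `|x| <= 2 - sigma then cos (2^-1 * `|x| - (e * pi + 1) / 4)
  else if `|x| < sigma then
    e * coef1 e sigma * r * sin (r * `|x| - r) + coef3 e sigma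
  else 0.

(** The constant in the Euler-Lagrange equation ([shape_EL]); it turns out to equal the factors
    lambda of SO(even) and Sp ([even_lambdaE], [Sp_lambdaE]). *)
Definition kappa (e sigma : R) :=
  (2 + e * (sigma - 1)) * coef3 e sigma - cos (phase e sigma).

(** * Verification of the Euler-Lagrange equation zone by zone *)

Section EulerLagrange.
Variables (e sigma : R).
Hypotheses (he : e = 1 \/ e = -1) (s1 : 1 < sigma) (s2 : sigma < 3 / 2).

Let ee : e * e = 1.
Proof. by case: he => ->; rewrite ?mulr1 ?mulrNN ?mulr1. Qed.

Let P := phase e sigma.
Let c1 := coef1 e sigma.
Let c3 := coef3 e sigma.
Let b := - ((e * pi + 1) / 4).
Let f0 := shape e sigma.

Lemma cos_small_gt0 : 0 < cos (r * (sigma - 1)).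
Proof.
apply: cos_gt0_pihalf; have := pi_ge2 R; have := r0; have := r1.
by have := s1; have := s2; move: (pi : R) r sigma => p t s *; apply/andP; split; nra.
Qed.

Let c1E : c1 * cos (r * (sigma - 1)) = cos P.
Proof. by rewrite /c1 /coef1 divfK// gt_eqF// cos_small_gt0. Qed.

Let c3E : e * c3 = c1 * sin (r * (sigma - 1)) * r - sin P.
Proof. by rewrite /c3 /coef3 mulrA ee mul1r. Qed.

(** This explains the phase of the middle piece: under [x -> 1 - x] the sine in its antiderivative
    becomes [- e] times the piece itself, which cancels the local term of the equation. *)
Let sin_flip (th : R) : sin (- th - e * pi / 2) = - (e * cos th).
Proof.
case: he => ->.
  by rewrite mul1r sinBpihalf cosN mul1r.
by rewrite !mulN1r mulNr opprK sinDpihalf cosN opprK.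
Qed.

(** Antiderivatives of the three pieces for positive arguments, with constants that make them match
    at the breakpoints ([F12], [F23]). Glued together they give the integral of [f0] from 0
    ([I0F]). *)
Let F1 x := 2 * r * c1 * sin (r * x).
Let F2 x := 2 * sin (2^-1 * x + b) + 2 * (e * c3).
Let F3 x := c3 * x - e * c1 * cos (r * x - r) +
  (2 * (e * c3) - e * cos P - c3 * (2 - sigma)).
Let F x := if x <= sigma - 1 then F1 x else if x <= 2 - sigma then F2 x else F3 x.

Let F12 : F1 (sigma - 1) = F2 (sigma - 1).
Proof.
rewrite /F1 /F2 c3E (_ : 2^-1 * (sigma - 1) + b = P); last by rewrite /P /b /phase; field.
by ring.
Qed.

Let F23 : F2 (2 - sigma) = F3 (2 - sigma).
Proof.
rewrite /F2 /F3 (_ : 2^-1 * (2 - sigma) + b = - P - e * pi / 2); last first.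
  by rewrite /P /b /phase; field.
rewrite sin_flip (_ : r * (2 - sigma) - r = - (r * (sigma - 1))); last by ring.
by rewrite cosN -[e * c1 * _]mulrA c1E; ring.
Qed.

Let F1E x : x <= sigma - 1 -> F x = F1 x.
Proof. by rewrite /F => ->. Qed.

Let F2E x : sigma - 1 <= x -> x <= 2 - sigma -> F x = F2 x.
Proof.
move=> x1 x2; rewrite /F x2; case: ifP => // x3.
by have -> : x = sigma - 1 by apply: le_anti; rewrite x3 x1.
Qed.

Let F3E x : 2 - sigma <= x -> F x = F3 x.
Proof.
move=> x1; rewrite /F ifF; last by apply/negbTE; rewrite -ltNge; have := s2; lra.
case: ifP => // x3.
by have -> : x = 2 - sigma by apply: le_anti; rewrite x3 x1.
Qed.

Lemma shape_even : evenf f0.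
Proof. by move=> x; rewrite /f0 /shape normrN. Qed.

Lemma shape_edge x : sigma <= `|x| -> f0 x = 0.
Proof.
move=> h; rewrite /f0 /shape !ifF//; apply/negbTE; rewrite -?ltNge -?leNgt//;
  have := s2; have := s1; lra.
Qed.

Lemma shape_bcs : bcs sigma f0.
Proof.
split.
- apply: mfun_if; first by apply: mfun_le; [exact: mfun_normr|exact: mfun_cst].
    apply: mfunM; first exact: mfun_cst.
    by apply: (@mfun_comp R (fun x => cos (r * x)));
      [apply: mfun_continuous; exact: continuous_cosl|exact: mfun_normr].
  apply: mfun_if; first by apply: mfun_le; [exact: mfun_normr|exact: mfun_cst].
    by apply: (@mfun_comp R (fun x => cos (2^-1 * x - (e * pi + 1) / 4)));
      [apply: mfun_continuous; exact: continuous_cos_aff|exact: mfun_normr].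
  apply: mfun_if; first by apply: mfun_lt; [exact: mfun_normr|exact: mfun_cst].
    apply: mfunD; last exact: mfun_cst.
    apply: mfunM; first exact: mfun_cst.
    by apply: (@mfun_comp R (fun x => sin (r * x - r)));
      [apply: mfun_continuous; exact: continuous_sin_aff|exact: mfun_normr].
  exact: mfun_cst.
- exists (`|c1| + 1 + (`|e * c1 * r| + `|c3|)) => x.
  have cb (z : R) : `|cos z| <= 1 by rewrite ler_norml cos_geN1 cos_le1.
  have sb (z : R) : `|sin z| <= 1 by rewrite ler_norml sin_geN1 sin_le1.
  have g1 := normr_ge0 c1; have g2 := normr_ge0 (e * c1 * r); have g3 := normr_ge0 c3.
  rewrite /f0 /shape; case: ifP => _.
    rewrite normrM; have := cb (r * `|x|); move: `|cos _| => z; rewrite -/c1.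
    by move: `|c1| g1 `|e * _ * _| g2 `|c3| g3 => u *; nra.
  case: ifP => _; first by have := cb (2^-1 * `|x| - (e * pi + 1) / 4); lra.
  case: ifP => _; last by rewrite normr0; lra.
  apply: (le_trans (ler_normD _ _)); rewrite normrM; have := sb (r * `|x| - r).
  rewrite -/c1 -/c3; move: `|sin _| => z.
  by move: `|c1| g1 `|e * _ * _| g2 `|c3| g3 => u u0 v v0 w *; nra.
- by move=> x /ltW; exact: shape_edge.
Qed.

Lemma shape_ae_continuous : ae_continuous f0.
Proof.
have cabs (h : R -> R) : continuous h -> ae_continuous (fun x => h `|x|).
  move=> ch; apply: ae_continuous_all => x.
  by apply: (@continuous_comp _ _ _ (fun y : R => `|y|) h); [exact: continuous_abs|exact: ch].
apply: (@ae_continuous_if R (fun y => y <= sigma - 1) (sigma - 1)).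
- by move=> y /ltW.
- by move=> y; rewrite -ltNge.
- apply: (cabs (fun x => c1 * cos (r * x))).
  by apply: continuous_mul; [move=> ?; exact: cvg_cst|exact: continuous_cosl].
apply: (@ae_continuous_if R (fun y => y <= 2 - sigma) (2 - sigma)).
- by move=> y /ltW.
- by move=> y; rewrite -ltNge.
- by apply: (cabs (fun x => cos (2^-1 * x - (e * pi + 1) / 4))); exact: continuous_cos_aff.
apply: (@ae_continuous_if R (fun y => y < sigma) sigma) => //.
- by move=> y; rewrite -leNgt => /ltW.
- apply: (cabs (fun x => e * c1 * r * sin (r * x - r) + c3)).
  apply: continuous_add; last by move=> ?; exact: cvg_cst.
  by apply: continuous_mul; [move=> ?; exact: cvg_cst|exact: continuous_sin_aff].
- by apply: ae_continuous_all => x; exact: cvg_cst.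
Qed.

Let I p q := int (fun x => ind p q x * f0 x).

Let I_split p q s : p <= q -> q <= s -> I p s = I p q + I q s.
Proof.
move=> pq qs; have [mf bf _] := shape_bcs; apply: int_ind_split => //.
by apply: L1Mb => //; exact: L1_ind.
Qed.

Let I_piece (G g : R -> R) p q : p <= q ->
  (forall x, is_derive x (1 : R) G (g x)) -> continuous g ->
  (forall x, p < x -> x < q -> f0 x = g x) -> I p q = G q - G p.
Proof.
move=> pq dG cg fg; have [mf bf _] := shape_bcs; rewrite -(int_ind_FTC pq dG cg).
apply: (@int_ae R _ _ [:: p; q]).
- exact: mfun_indM.
- by apply: mfun_indM; exact: mfun_continuous.
move=> x; rewrite !inE negb_or => /andP[xp xq]; rewrite /ind.
case: (boolP (p <= x <= q)) => [/andP[px qx]|_]; last by rewrite !mul0r.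
by rewrite fg// lt_neqAle ?px ?qx ?andbT// eq_sym.
Qed.

Let f0E1 x : 0 <= x -> x <= sigma - 1 -> f0 x = c1 * cos (r * x).
Proof. by move=> x0 x1; rewrite /f0 /shape (ger0_norm x0) x1. Qed.

Let f0E2 x : sigma - 1 < x -> x <= 2 - sigma -> f0 x = cos (2^-1 * x + b).
Proof.
move=> x1 x2; have x0 : 0 <= x by have := s1; lra.
by rewrite /f0 /shape (ger0_norm x0) leNgt x1 x2.
Qed.

Let f0E3 x : 2 - sigma < x -> x < sigma -> f0 x = e * c1 * r * sin (r * x - r) + c3.
Proof.
move=> x1 x2; have x0 : 0 <= x by have := s2; lra.
rewrite /f0 /shape (ger0_norm x0) !leNgt x1 x2 /= (_ : sigma - 1 < x)//.
by have := s2; lra.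
Qed.

Let dF1 x : is_derive x (1 : R) F1 (c1 * cos (r * x)).
Proof.
apply: (drv_eq (drvZ (2 * r * c1) (drv_sin r x))).
have -> : 2 * r * c1 * (r * cos (r * x)) = 2 * (r * r) * (c1 * cos (r * x)) by ring.
by rewrite rr divff// mul1r.
Qed.

Let dF2 x : is_derive x (1 : R) F2 (cos (2^-1 * x + b)).
Proof.
apply: (drv_eq (drvD (drvZ 2 (drv_sin_aff 2^-1 b x)) (drv_cst (2 * (e * c3)) x))).
by field.
Qed.

Let dF3 x : is_derive x (1 : R) F3 (e * c1 * r * sin (r * x - r) + c3).
Proof.
apply: (drv_eq (drvD (drvB (drv_lin c3 x) (drvZ (e * c1) (drv_cos_aff r (- r) x)))
  (drv_cst _ x))).
by ring.
Qed.

Let I0F x : 0 <= x -> x <= sigma -> I 0 x = F x.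
Proof.
move=> x0 xs.
have i1 y : 0 <= y -> y <= sigma - 1 -> I 0 y = F1 y.
  move=> y0 ys; rewrite (I_piece y0 dF1).
  - by rewrite [F1 0]/F1 mulr0 sin0 mulr0 subr0.
  - by apply: continuous_mul; [move=> ?; exact: cvg_cst|exact: continuous_cosl].
  - by move=> z z0 zy; apply: f0E1; [exact: ltW|exact: le_trans (ltW zy) ys].
have i2 y : sigma - 1 <= y -> y <= 2 - sigma -> I 0 y = F2 y.
  move=> y0 ys; have s0 : 0 <= sigma - 1 by have := s1; lra.
  rewrite (I_split s0 y0) (i1 _ s0 (lexx _)) F12 (I_piece y0 dF2); first by ring.
  - exact: continuous_cos_aff.
  - by move=> z z0 zy; apply: f0E2 => //; exact: le_trans (ltW zy) ys.
have [x1|x1] := leP x (sigma - 1); first by rewrite F1E// i1.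
have [x2|x2] := leP x (2 - sigma); first by rewrite F2E ?i2// ltW.
have h0 : 0 <= 2 - sigma by have := s2; lra.
have h1 : sigma - 1 <= 2 - sigma by have := s2; lra.
rewrite F3E; last exact: ltW.
rewrite (I_split h0 (ltW x2)) (i2 _ h1 (lexx _)) F23 (I_piece (ltW x2) dF3); first by ring.
- apply: continuous_add; last by move=> ?; exact: cvg_cst.
  by apply: continuous_mul; [move=> ?; exact: cvg_cst|exact: continuous_sin_aff].
- by move=> z z0 zy; apply: f0E3 => //; exact: lt_le_trans zy xs.
Qed.

Let INF x : 0 <= x -> x <= sigma -> I (- x) 0 = F x.
Proof.
move=> x0 xs; rewrite -I0F// /I -int_opp; last first.
  by have [mf bf _] := shape_bcs; apply: L1Mb => //; exact: L1_ind.
by apply: eq_int => y; rewrite shape_even /ind lerN2 oppr_le0 andbC.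
Qed.

Lemma int_shape : int f0 = 2 * F sigma.
Proof.
have s0 : 0 <= sigma by have := s1; lra.
have s0' : - sigma <= 0 by lra.
have -> : int f0 = I (- sigma) sigma by rewrite /I -(bcs_ind shape_bcs).
by rewrite (I_split s0' s0) INF// I0F//; ring.
Qed.

Let KopE x : Kop f0 x = 2^-1 * I (Num.max (- sigma) (x - 1)) (Num.min sigma (x + 1)).
Proof.
rewrite /Kop /I -intZ; last first.
  by have [mf bf _] := shape_bcs; apply: L1Mb => //; exact: L1_ind.
apply: eq_int => y; rewrite [in LHS](bcs_ind shape_bcs) mulrAC ind_window.
by rewrite -mulrA.
Qed.

Let Fs : F sigma = c3 * sigma - e * cos P + (2 * (e * c3) - e * cos P - c3 * (2 - sigma)).
Proof.
rewrite F3E; last by have := s1; lra.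
by rewrite /F3 -[e * c1 * _]mulrA (_ : r * sigma - r = r * (sigma - 1)) ?c1E//; ring.
Qed.

Let kE : kappa e sigma = c3 + 2^-1 * e * F sigma.
Proof.
rewrite Fs /kappa -/c3 -/P.
have -> : c3 + 2^-1 * e * (c3 * sigma - e * cos P + (2 * (e * c3) - e * cos P - c3 * (2 - sigma)))
  = c3 + e * (sigma - 1) * c3 + (e * e) * c3 - (e * e) * cos P by field.
by rewrite ee; ring.
Qed.

Lemma shape_int : int f0 = 4 * ((e + (sigma - 1)) * c3 - e * cos P).
Proof. by rewrite int_shape Fs; ring. Qed.

(** The zones are adapted to the window [[x - 1, x + 1]]. For [x] in the inner zone both ends lie,
    in absolute value, in the outer zone. For [x] beyond it the right end is cut off at [sigma], and
    the left end lies in the middle zone if [x] does, and in the inner zone if [x] is in the outer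
    one. Each time the antiderivative at the ends cancels the varying part of [f0 x]. *)
Let EL_nneg x : 0 <= x -> x < sigma -> f0 x + e * Kop f0 x = kappa e sigma.
Proof.
move=> x0 xs; have t1 := s1; have t2 := s2.
have mx : Num.max (- sigma) (x - 1) = x - 1 by apply: max_idPr; lra.
rewrite KopE mx; have [x1|x1] := leP x (sigma - 1).
  have -> : Num.min sigma (x + 1) = x + 1 by apply: min_idPr; lra.
  have h1 : x - 1 <= 0 by lra.
  have h2 : 0 <= x + 1 by lra.
  rewrite (I_split h1 h2) -[x - 1]opprK opprB INF; [|lra|lra].
  rewrite I0F//; last by lra.
  rewrite !F3E; [|lra|lra]; rewrite f0E1// kE Fs /F3.
  rewrite (_ : r * (1 - x) - r = - (r * x)); last by ring.
  rewrite (_ : r * (x + 1) - r = r * x); last by ring.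
  rewrite cosN.
  have -> : c1 * cos (r * x) + e * (2^-1 *
    (c3 * (1 - x) - e * c1 * cos (r * x) + (2 * (e * c3) - e * cos P - c3 * (2 - sigma)) +
    (c3 * (x + 1) - e * c1 * cos (r * x) + (2 * (e * c3) - e * cos P - c3 * (2 - sigma))))) =
    c1 * cos (r * x) - (e * e) * c1 * cos (r * x) + e * (c3 + (2 * (e * c3) - e * cos P - c3 * (2 - sigma))) by field.
  have -> : c3 + 2^-1 * e * (c3 * sigma - e * cos P +
    (2 * (e * c3) - e * cos P - c3 * (2 - sigma))) =
    c3 + e * (c3 + (2 * (e * c3) - e * cos P - c3 * (2 - sigma))) - (e * e) * c3 +
    2^-1 * (e * e) * (c3 * 0) by field.
  by rewrite ee; ring.
have -> : Num.min sigma (x + 1) = sigma by apply: min_idPl; lra.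
have [x2|x2] := leP x (2 - sigma).
  have h1 : x - 1 <= 0 by lra.
  have h2 : 0 <= sigma by lra.
  rewrite (I_split h1 h2) -[x - 1]opprK opprB INF; [|lra|lra].
  rewrite I0F// f0E2// [F (1 - x)]F2E; [|lra|lra].
  rewrite kE /F2 (_ : 2^-1 * (1 - x) + b = - (2^-1 * x + b) - e * pi / 2); last first.
    by rewrite /b; field.
  rewrite sin_flip; move: (cos _) (F sigma) => u v.
  have -> : u + e * (2^-1 * (2 * - (e * u) + 2 * (e * c3) + v)) =
    u - e * e * u + e * e * c3 + 2^-1 * e * v by field.
  by rewrite ee; ring.
rewrite f0E3// kE; have [x3|x3] := leP x 1.
  have h1 : x - 1 <= 0 by lra.
  have h2 : 0 <= sigma by lra.
  rewrite (I_split h1 h2) -[x - 1]opprK opprB INF; [|lra|lra].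
  rewrite I0F// [F (1 - x)]F1E; last by lra.
  rewrite /F1 (_ : r * (1 - x) = - (r * x - r)); last by ring.
  by rewrite sinN; field.
have h1 : 0 <= x - 1 by lra.
have h2 : x - 1 <= sigma by lra.
have := I_split h1 h2; rewrite !I0F//; last by lra.
move=> h; have -> : I (x - 1) sigma = F sigma - F (x - 1) by rewrite h; ring.
rewrite [F (x - 1)]F1E; last by lra.
rewrite /F1 (_ : r * (x - 1) = r * x - r); last by ring.
by field.
Qed.

Lemma shape_EL x : `|x| < sigma -> f0 x + e * Kop f0 x = kappa e sigma.
Proof.
have [x0|x0] := leP 0 x; first by rewrite ger0_norm//; exact: EL_nneg.
rewrite ltr0_norm// => xs; rewrite -shape_even.
have -> : Kop f0 x = Kop f0 (- x); last by apply: EL_nneg => //; rewrite oppr_ge0 ltW.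
rewrite /Kop -int_opp; last exact: L1_Kop (bcs_L1 shape_bcs).
by apply: eq_int => y; rewrite shape_even -[in LHS]kerN; congr (_ * ker _); ring.
Qed.

Let Q := (2 * sigma - 3) / 4.

Let cosPE : cos P = r * (cos Q + e * sin Q).
Proof.
rewrite /P /phase -/Q; case: he => ->.
  by rewrite !mul1r cosB cos_piquarter sin_piquarter; ring.
by rewrite !mulN1r mulNr opprK cosD cos_piquarter sin_piquarter; ring.
Qed.

Let sinPE : sin P = r * (sin Q - e * cos Q).
Proof.
rewrite /P /phase -/Q; case: he => ->.
  by rewrite !mul1r sinB cos_piquarter sin_piquarter; ring.
by rewrite !mulN1r mulNr opprK sinD cos_piquarter sin_piquarter; ring.
Qed.

(** Eliminates [sin (phase e sigma)]. It is the source of the term with the square root of 2 and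
    [sin ((3 - 2 * sigma) / 4)] in the lambda formulas, and it decides the sign of the integral. *)
Lemma phase_sum : cos (phase e sigma) + e * sin (phase e sigma) =
  2 * e * (r * sin ((2 * sigma - 3) / 4)).
Proof.
rewrite -/P -/Q cosPE sinPE.
have -> : r * (cos Q + e * sin Q) + e * (r * (sin Q - e * cos Q)) =
  r * cos Q - (e * e) * (r * cos Q) + 2 * e * (r * sin Q) by ring.
by rewrite ee; ring.
Qed.

(** Once [c3] and [sin P] are eliminated by [c3E] and [phase_sum], all terms of the integral are
    non-negative and some are positive, because [cos P > 0], [c1 > 0] and [sin Q < 0] in the given
    range of [sigma]. *)
Lemma shape_int_neq0 : int f0 != 0.
Proof.
have t1 := s1; have t2 := s2; have p2 := pi_ge2 R.
have sQ : 0 < - sin Q by rewrite -sinN; apply: sin_gt0_pi; rewrite /Q; apply/andP; split; lra.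
have cP : 0 < cos P.
  apply: cos_gt0_pihalf; rewrite /P /phase; move: (pi : R) p2 => p p2.
  by case: he => ->; apply/andP; split; lra.
have cr := cos_small_gt0.
have sr : 0 <= sin (r * (sigma - 1)).
  apply/ltW/sin_gt0_pi; have := r0; have := r1; move: p2.
  by move: (pi : R) r sigma t1 t2 => p t s *; apply/andP; split; nra.
have c10 : 0 < c1 by rewrite /c1 /coef1 divr_gt0.
have z0 : 0 <= c1 * sin (r * (sigma - 1)) * r by exact: mulr_ge0 (mulr_ge0 (ltW c10) sr) (ltW r0).
rewrite shape_int mulf_neq0//.
have := phase_sum; rewrite -/P -/Q => D.
have rs : 0 < - (r * sin Q) by rewrite -mulrN mulr_gt0.
move: c3E D cP z0 rs; move: (cos P) (sin P) (c1 * sin _ * r) (r * sin Q) => C S z w.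
case: he => -> h D C0 z0 w0.
  rewrite gt_eqF// mul1r; move: h D; rewrite !mul1r => -> D.
  by move: sigma t1 t2 => s *; nra.
rewrite gt_eqF//; move: h D; rewrite !mulN1r => h D.
have {h} -> : c3 = S - z by rewrite -[c3]opprK h opprB.
by move: sigma t1 t2 => s *; nra.
Qed.

End EulerLagrange.

End Shape.

(** * The average rank bound *)

Section Rank.
Variable R : realType.
Implicit Types (G : classical_group) (phi f g : R -> R) (e sigma s x y : R).

Definition eta_sign G : R :=
  match G with SO_even => 1 | O_full => 0 | SO_odd => -1 | Sp => -1 end.

Lemma eta_sign_le1 G : `|eta_sign G| <= 1.
Proof. by case: G; rewrite /= ?normrN ?normr1 ?normr0. Qed.

(** The test [|x| <= 0] stands for [x = 0], so that measurability follows from that of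
    comparisons. *)
Lemma W_funE G x : W_fun G x =
  if `|x| <= 0 then W_fun G 0 else 1 + eta_sign G * sinc x.
Proof.
rewrite normr_le0; have [->//|x0] := eqVneq x 0.
by rewrite (sincE x0) /W_fun; case: G => /=; rewrite ?mul1r ?mul0r ?addr0 ?mulN1r.
Qed.

Lemma mfun_density phi e : mfun phi -> mfun (fun x => phi x * (1 + e * sinc x)).
Proof.
move=> mp; apply: mfunM => //; apply: mfunD; first exact: mfun_cst.
by apply: mfunM; [exact: mfun_cst|exact: mfun_sinc].
Qed.

Lemma integral_WE G phi : L1 phi ->
  integral_W G phi = W_delta R G * phi 0 + density (eta_sign G) phi.
Proof.
move=> hp; congr (_ + _); rewrite densityE// -/(int _).
have mp := L1_mfun hp; apply: (@int_ae R _ _ [:: 0]); last 1 first.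
- by move=> x; rewrite inE => x0; rewrite W_funE normr_le0 (negbTE x0).
- under eq_fun do rewrite W_funE; apply: mfunM => //; apply: mfun_if.
  + by apply: mfun_le; [exact: mfun_normr|exact: mfun_cst].
  + exact: mfun_cst.
  + apply: mfunD; first exact: mfun_cst.
    by apply: mfunM; [exact: mfun_cst|exact: mfun_sinc].
- exact: mfun_density.
Qed.

Lemma eta_ind y : y \notin [:: 1; -1] -> Defs.eta y = ind (-1) 1 y.
Proof.
rewrite !inE negb_or => /andP[y1 y2]; rewrite /Defs.eta /ind -ler_norml.
have yn : `|y| != 1.
  have [y0|y0] := leP 0 y; first by rewrite ger0_norm.
  by rewrite ltr0_norm// -eqr_opp opprK.
by rewrite (negbTE yn) lt_neqAle yn; case: (`|y| <= 1).
Qed.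

Lemma mfun_eta : mfun (@Defs.eta R).
Proof.
rewrite (_ : @Defs.eta R = fun y => if `|y| < 1 then 1 else if `|y| <= 1 then 2^-1 else 0).
  apply: mfun_if; [|exact: mfun_cst|apply: mfun_if; [|exact: mfun_cst..]].
    by apply: mfun_lt; [exact: mfun_normr|exact: mfun_cst].
  by apply: mfun_le; [exact: mfun_normr|exact: mfun_cst].
by apply/funext => y; rewrite /Defs.eta; case: ltgtP.
Qed.

Lemma integral_WhatE sigma G phi : test_function sigma phi ->
  integral_What G (fourier phi) =
  (W_delta R G * phi 0 + density (eta_sign G) phi)%:C%C.
Proof.
move=> ht; have hp := test_L1 ht; have pe := test_even ht; have hb := test_bcs ht.
have mF : mfun (Fc phi) by case: hb.
(* The delta coefficient of [W] reappears as the constant part of its transform; integrating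
   [Fc phi] against it gives the value at 0 by [test_at0]. *)
have WE y : What_fun G y = W_delta R G + eta_sign G * (2^-1 * Defs.eta y).
  by case: G; rewrite /= ?mul1r ?mul0r ?add0r ?addr0 ?mulN1r// addrC.
rewrite /integral_What /What_delta fourierE//.
have -> : cintegral (fun y => fourier phi y * (What_fun G y)%:C%C) =
    (int (fun y => Fc phi y * What_fun G y))%:C%C.
  rewrite /cintegral; congr Complex.
    by apply: eq_int => y; rewrite fourierE//= mulr0 subr0.
  rewrite -/(int _) -[RHS](@int0 R); apply: eq_int => y.
  by rewrite fourierE//= mulr0 mul0r addr0.
rewrite mul1r -[LHS]rmorphD; congr (_%:C%C).
have -> : int (fun y => Fc phi y * What_fun G y) =
    int (fun y => W_delta R G * Fc phi y + eta_sign G * 2^-1 * (ind (-1) 1 y * Fc phi y)).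
  apply: (@int_ae R _ _ [:: 1; -1]).
  - under eq_fun do rewrite WE; apply: mfunM => //; apply: mfunD; first exact: mfun_cst.
    by do 2!(apply: mfunM; first exact: mfun_cst); exact: mfun_eta.
  - apply: mfunD; first by apply: mfunM => //; exact: mfun_cst.
    by apply: mfunM; [exact: mfun_cst|exact: mfun_indM].
  - by move=> y /eta_ind yE; rewrite WE yE; ring.
have FL := bcs_L1 hb.
have IL : L1 (fun y => ind (-1) 1 y * Fc phi y).
  by apply: L1Mb => //; [exact: L1_ind|case: hb].
rewrite (intD (L1Z _ FL) (L1Z _ IL)) (intZ _ FL) (intZ _ IL) (test_at0 ht) /density.
by rewrite mulrA addrCA.
Qed.

Lemma rank_boundE sigma G phi : test_function sigma phi ->
  rank_bound G phi = W_delta R G + density (eta_sign G) phi / phi 0.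
Proof.
move=> ht; rewrite /rank_bound integral_WE; last exact: test_L1 ht.
by rewrite mulrDl mulfK// gt_eqF// (test_gt0 ht).
Qed.

(** * From a solution of the Euler-Lagrange equation to the optimal test function *)

Section Minimizer.
Variables (e sigma k lam : R) (f0 : R -> R).
Hypotheses (he : `|e| <= 1) (s0 : 0 < sigma) (s32 : sigma < 3 / 2).
Hypotheses (hf0 : bcs sigma f0) (ef0 : evenf f0) (cf0 : ae_continuous f0).
Hypothesis f0_edge : forall x, sigma <= `|x| -> f0 x = 0.
Hypothesis EL : forall x, `|x| < sigma -> f0 x + e * Kop f0 x = k.
Hypotheses (I0n0 : int f0 != 0) (lam0 : lam != 0).

Let g x := lam * f0 x.

Let hg : bcs sigma g. Proof. exact: bcsZ. Qed.

Let eg : evenf g. Proof. by move=> x; rewrite /g ef0. Qed.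

Let cg : ae_continuous g.
Proof.
have [s hs] := cf0; exists s => x xs.
by apply: continuousM; [exact: cvg_cst|exact: hs].
Qed.

Let ig : int g = lam * int f0. Proof. exact/intZ/bcs_L1/hf0. Qed.

Lemma minimizer_test : test_function sigma (sqF g).
Proof. by apply: test_function_sqF => //; rewrite ig mulf_neq0. Qed.

Lemma minimizer_fourier y : fourier (sqF g) y =
  convolution (fun x => (g x)%:C%C) (check (fun x => (g x)%:C%C)) y.
Proof.
rewrite convolutionE// fourierE; [|exact: L1_sqF hg eg|exact: sqF_even].
by rewrite (Fc_sqF hg eg cg).
Qed.

Let acor_g z : acor g z = lam ^+ 2 * acor f0 z.
Proof.
rewrite /acor -intZ; last exact: L1_acor hf0 hf0.
by apply: eq_int => x; rewrite /g; ring.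
Qed.

Let Fc_min z : Fc (sqF g) z = lam ^+ 2 * acor f0 z.
Proof. by rewrite (Fc_sqF hg eg cg) -(acor_conv eg) acor_g. Qed.

Let ratio0 : density e (sqF g) / sqF g 0 = k / int f0.
Proof.
have B := Bform_f0 s0 s32 hf0 f0_edge EL.
rewrite (density_sqF e hg eg cg) /sqF Fc0 ig.
have -> : Bform e g g = lam ^+ 2 * Bform e f0 f0.
  (* Homogeneity of the form is read off from its expansion, taken at the zero function with
     coefficient [- lam]. *)
  have := @Bform_sub R sigma e (- lam) f0 (fun=> 0) hf0 (bcs0 sigma).
  have -> : (fun x => 0 - - lam * f0 x) = g.
    by apply/funext => x; rewrite /g sub0r mulNr opprK.
  have z1 : Bform e (fun=> 0) (fun=> 0) = 0.
    rewrite /Bform /Kform; under eq_int do rewrite mul0r.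
    by under [X in _ + _ * X]eq_int do rewrite mul0r; rewrite int0 mulr0 addr0.
  have z2 : Bform e (fun=> 0) f0 = 0.
    rewrite /Bform /Kform; under eq_int do rewrite mul0r.
    by under [X in _ + _ * X]eq_int do rewrite mul0r; rewrite int0 mulr0 addr0.
  by rewrite z1 z2 sqrrN => ->; ring.
by rewrite B; field; rewrite I0n0.
Qed.

Let sampled phi : test_function sigma phi ->
  k / int f0 * phi 0 <= density e phi /\
  (density e phi = k / int f0 * phi 0 ->
   forall z, Fc phi z = phi 0 / int f0 ^+ 2 * acor f0 z).
Proof.
move=> ht; have [a [b [w [hab w12 w3 Vv Vb]]]] := sampling s0 s32 ht.
have ha m : bcs (w m) (a m) by case: (hab m).
have hb m : bcs (w m) (b m) by case: (hab m).
have w1 m : sigma <= w m by case/andP: (w12 m).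
have w2 m : w m <= 3 / 2 by case/andP: (w12 m).
have mv : mfun (Fc phi) by case: (test_bcs ht).
have v0 z : 3 < `|z| -> Fc phi z = 0.
  by move=> z3; apply: (test_supp ht); apply: lt_trans z3; have := s32; lra.
rewrite -(test_at0 ht); split.
  exact: (limit_bound he s0 s32 hf0 f0_edge EL I0n0 ha hb w1 w2 w3 Vv Vb mv v0).
move=> J z.
exact: (limit_unique he s0 s32 hf0 f0_edge EL I0n0 ha hb w1 w2 w3 Vv Vb mv v0).
Qed.

Lemma minimizer_le phi : test_function sigma phi ->
  density e (sqF g) / sqF g 0 <= density e phi / phi 0.
Proof.
move=> ht; rewrite [leLHS]ratio0 ler_pdivlMr; last exact: test_gt0 ht.
exact: (sampled ht).1.
Qed.

Lemma minimizer_unique phi : test_function sigma phi ->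
  density e phi / phi 0 = density e (sqF g) / sqF g 0 ->
  exists2 c : R, 0 < c & forall x, phi x = c * sqF g x.
Proof.
move=> ht; rewrite [X in _ = X -> _]ratio0 => r0; have p0 := test_gt0 ht.
have J : density e phi = k / int f0 * phi 0 by rewrite -r0 divfK// gt_eqF.
have FcE := (sampled ht).2 J.
have i2 : 0 < int f0 ^+ 2 by rewrite lt_neqAle sqr_ge0 eq_sym expf_neq0.
have l2 : 0 < lam ^+ 2 by rewrite lt_neqAle sqr_ge0 eq_sym expf_neq0.
exists (phi 0 / int f0 ^+ 2 / lam ^+ 2); first by rewrite !divr_gt0.
have mt := minimizer_test.
move=> x; rewrite (test_inversion ht) (test_inversion mt) -intZ; last first.
  apply: L1Mb; [exact: bcs_L1 (test_bcs mt)| |exact: bounded_cos].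
  by under eq_fun do rewrite -cos_comm; exact: mfun_cosr.
apply: eq_int => y; rewrite FcE Fc_min.
move: (acor f0 y) (cos _) (phi 0) (int f0 ^+ 2) i2 (lam ^+ 2) l2 => u v t p p1 q q1.
by field; rewrite !gt_eqF.
Qed.

Lemma minimizer_approx r : 0 < r -> exists phi,
  [/\ schwartz phi, test_function sigma phi &
      density e phi / phi 0 < density e (sqF g) / sqF g 0 + r].
Proof.
move=> /(schwartz_approx he hf0 ef0 cf0 I0n0)[h [[hh eh ch ih] [sh hr]]].
exists (sqF h); split => //; first exact: test_function_sqF.
have h0 : sqF h 0 = int h ^+ 2 by rewrite /sqF Fc0.
have B := Bform_f0 s0 s32 hf0 f0_edge EL.
rewrite [X in _ < X + _]ratio0 (density_sqF e hh eh ch) h0 (lt_le_trans hr)//.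
by rewrite B lerD2r expr2 invfM mulrA mulfK.
Qed.

End Minimizer.

(** * The orthogonal group: for [e = 0] the equation asks only for a constant on the interval *)

Section Box.
Variable sigma : R.
Hypothesis s0 : 0 < sigma.

Definition box x : R := if `|x| < sigma then 1 else 0.

Lemma box_even : evenf box.
Proof. by move=> x; rewrite /box normrN. Qed.

Lemma box_edge x : sigma <= `|x| -> box x = 0.
Proof. by rewrite /box ltNge => ->. Qed.

Lemma box_bcs : bcs sigma box.
Proof.
split; last by move=> x /ltW; exact: box_edge.
- by apply: mfun_if; [apply: mfun_lt; [exact: mfun_normr|exact: mfun_cst]|exact: mfun_cst..].
- by exists 1 => x; rewrite /box; case: ifP; rewrite ?normr1 ?normr0.
Qed.

Lemma box_ae_continuous : ae_continuous box.
Proof.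
apply: (@ae_continuous_if R (fun y => y < sigma) sigma) => //.
- by move=> y; rewrite -leNgt => /ltW.
- by apply: ae_continuous_all => x; exact: cvg_cst.
- by apply: ae_continuous_all => x; exact: cvg_cst.
Qed.

Lemma int_box : int box = 2 * sigma.
Proof.
have h : - sigma <= sigma by have := s0; lra.
rewrite -[RHS](_ : sigma - - sigma = _); last by ring.
rewrite -(int_ind h); apply: (@int_ae R _ _ [:: sigma; - sigma]).
- by case: box_bcs.
- exact: mfun_ind.
move=> x; rewrite !inE negb_or => /andP[x1 x2]; rewrite /box /ind -ler_norml lt_neqAle.
have -> : (`|x| != sigma) = true; last by rewrite andTb; case: (`|x| <= sigma).
have [x0|x0] := leP 0 x; first by rewrite ger0_norm.
by rewrite ltr0_norm// -eqr_opp opprK.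
Qed.

End Box.

(** * The trigonometric constants of the statement in terms of the phase *)

Section Constants.
Variable sigma : R.
Hypotheses (s1 : 1 < sigma) (s2 : sigma < 3 / 2).

Let r : R := (Num.sqrt 2)^-1.

(** Expresses the square root through [r], after which the identities between constants are rational
    and [field] decides them. *)
Let rE : Num.sqrt 2 = 2 * r :> R.
Proof.
have h : Num.sqrt 2 != 0 :> R by rewrite gt_eqF// sqrtr_gt0.
apply: (mulfI h); rewrite mulrCA mulfV// mulr1 -expr2 sqr_sqrtr//.
Qed.

Let aE : (sigma - 1) / Num.sqrt 2 = r * (sigma - 1).
Proof. by rewrite mulrC. Qed.

Let sin_flipl (p A B : R) : A = B + p -> p = pi -> sin A = - sin B.
Proof. by move=> -> ->; rewrite sinDpi. Qed.

Let sin_quarter (A B : R) : A = B + pi / 2 -> sin A = cos B.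
Proof. by move=> ->; rewrite sinDpihalf. Qed.

Lemma even_c1E : even_c1 sigma = coef1 1 sigma.
Proof.
by rewrite /even_c1 /coef1 /sec aE; congr (cos _ / _); rewrite /phase; field.
Qed.

Lemma odd_c1E : odd_c1 sigma = coef1 (-1) sigma.
Proof.
by rewrite /odd_c1 /coef1 /sec aE -cosN; congr (cos _ / _); rewrite /phase; field.
Qed.

Let P1 := phase 1 sigma.
Let P2 := phase (-1) sigma.

Let sin11 : sin (4^-1 * (2 * sigma + 3 * pi - 3)) = - sin P1.
Proof. by apply: (@sin_flipl pi) => //; rewrite /P1 /phase; field. Qed.

Let sin12 : sin (4^-1 * (- 2 * sigma + 3 * pi + 3)) = cos P1.
Proof. by rewrite -[cos _]cosN; apply: sin_quarter; rewrite /P1 /phase; field. Qed.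

Let sin13 : sin (4^-1 * (- 2 * sigma + pi + 3)) = - sin P1.
Proof. by rewrite -sinN; congr sin; rewrite /P1 /phase; field. Qed.

Let sin14 : sin (4^-1 * (2 * sigma + pi - 3)) = cos P1.
Proof. by apply: sin_quarter; rewrite /P1 /phase; field. Qed.

Let sin21 : sin (4^-1 * (- 2 * sigma + 3 * pi + 3)) = sin P2.
Proof.
by rewrite -[RHS]opprK -sinN; apply: (@sin_flipl pi) => //; rewrite /P2 /phase; field.
Qed.

Let sin22 : sin (4^-1 * (2 * sigma + 3 * pi - 3)) = cos P2.
Proof. by apply: sin_quarter; rewrite /P2 /phase; field. Qed.

Let cos23 : cos (4^-1 * (2 * sigma + 3 * pi - 3)) = - sin P2.
Proof. by rewrite -cosDpihalf; congr cos; rewrite /P2 /phase; field. Qed.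

Let sin24 : sin (4^-1 * (- 2 * sigma + pi + 3)) = cos P2.
Proof. by rewrite -[cos _]cosN; apply: sin_quarter; rewrite /P2 /phase; field. Qed.

Let sin25 : sin (4^-1 * (2 * sigma + pi - 3)) = sin P2.
Proof. by congr sin; rewrite /P2 /phase; field. Qed.

Let sinQ : sin (4^-1 * (3 - 2 * sigma)) = - sin ((2 * sigma - 3) / 4) :> R.
Proof. by rewrite -sinN; congr sin; field. Qed.

Let sinP1 : sin P1 = 2 * (r * sin ((2 * sigma - 3) / 4)) - cos P1.
Proof.
by have := phase_sum sigma (or_introl erefl : (1 : R) = 1 \/ (1 : R) = -1); rewrite -/r -/P1; lra.
Qed.

Let sinP2 : sin P2 = cos P2 + 2 * (r * sin ((2 * sigma - 3) / 4)).
Proof.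
by have := phase_sum sigma (or_intror erefl : (-1 : R) = 1 \/ (-1 : R) = -1); rewrite -/r -/P2; lra.
Qed.

Lemma even_c3E : even_c3 sigma = coef3 1 sigma.
Proof.
rewrite /even_c3 /coef3 /coef1 /tan aE sin11 sin12 -/r -/P1.
by move: (sin (r * _)) (cos (r * _)) => u v; ring.
Qed.

Lemma odd_c3E : odd_c3 sigma = coef3 (-1) sigma.
Proof.
rewrite /odd_c3 /coef3 /coef1 /tan aE sin21 sin22 -/r -/P2.
by move: (sin (r * _)) (cos (r * _)) => u v; ring.
Qed.

Lemma even_lambdaE : even_lambda sigma = kappa 1 sigma.
Proof.
rewrite /even_lambda /kappa /coef3 /coef1 /tan aE sinQ sin13 sin14 -/r -/P1 rE sinP1.
move: (lt0r_neq0 (cos_small_gt0 s1 s2)); rewrite -/r.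
by move: (sin (r * _)) (cos (r * _)) (sin _) (cos P1) => u v w c v0; field.
Qed.

Lemma Sp_lambdaE : Sp_lambda sigma = kappa (-1) sigma.
Proof.
rewrite /Sp_lambda /kappa /coef3 /coef1 /tan aE sinQ cos23 sin24 -/r -/P2 rE sinP2.
move: (lt0r_neq0 (cos_small_gt0 s1 s2)); rewrite -/r.
by move: (sin (r * _)) (cos (r * _)) (sin _) (cos P2) => u v w c v0; field.
Qed.

(** The transform for SO(odd) exceeds that for Sp by the constant 1, which adds [int f0] to the left
    side of the Euler-Lagrange equation; this factor is the resulting constant value. *)
Lemma SO_odd_lambdaE : SO_odd_lambda sigma =
  kappa (-1) sigma + int (shape (-1) sigma).
Proof.
rewrite (shape_int (or_intror erefl) s1 s2) /SO_odd_lambda Sp_lambdaE.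
rewrite /coef3 /coef1 /tan aE sinQ sin24 sin25 -/r -/P2 rE sinP2.
move: (lt0r_neq0 (cos_small_gt0 s1 s2)); rewrite -/r.
by move: (sin (r * _)) (cos (r * _)) (sin _) (cos P2) => u v w c v0; field.
Qed.

End Constants.

Lemma even_shapeE s x : even_shape s x = shape 1 (s / 2) x.
Proof.
rewrite /even_shape /shape even_c1E even_c3E mul1r.
case: ifP => _; first by rewrite [`|x| / _]mulrC.
case: ifP => _; first by rewrite [`|x| / 2]mulrC.
by case: ifP => _ //; rewrite mul1r [(`|x| - 1) / _]mulrC mulrBr mulr1.
Qed.

Lemma odd_shapeE s x : odd_shape s x = shape (-1) (s / 2) x.
Proof.
rewrite /odd_shape /shape odd_c1E odd_c3E.
case: ifP => _; first by rewrite [`|x| / _]mulrC.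
case: ifP => _; first by congr cos; field.
by case: ifP => _ //; rewrite mulN1r [(`|x| - 1) / _]mulrC mulrBr mulr1.
Qed.

Lemma optimal_gE G s : 2 < s -> s < 3 -> exists (k lam : R) (f0 : R -> R),
  [/\ bcs (s / 2) f0, evenf f0, ae_continuous f0,
      forall x, s / 2 <= `|x| -> f0 x = 0 &
      [/\ forall x, `|x| < s / 2 -> f0 x + eta_sign G * Kop f0 x = k,
          int f0 != 0, lam != 0 & forall x, optimal_g G s x = lam * f0 x]].
Proof.
move=> s2 s3; have t0 : 0 < s / 2 by lra.
have t1 : 1 < s / 2 by lra.
have t2 : s / 2 < 3 / 2 by lra.
have shapeP (e : R) : e = 1 \/ e = -1 -> let f := shape e (s / 2) in
    [/\ bcs (s / 2) f, evenf f, ae_continuous f, forall x, s / 2 <= `|x| -> f x = 0 &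
        [/\ forall x, `|x| < s / 2 -> f x + e * Kop f x = kappa e (s / 2),
            int f != 0 & 0 < kappa e (s / 2) * int f]].
  move=> he f; have e1 : `|e| <= 1 by case: he => ->; rewrite ?normrN normr1.
  have hb : bcs (s / 2) f by exact: shape_bcs.
  have hd x : s / 2 <= `|x| -> f x = 0 by exact: shape_edge.
  have hE x : `|x| < s / 2 -> f x + e * Kop f x = kappa e (s / 2) by exact: shape_EL.
  have hi : int f != 0 by exact: shape_int_neq0.
  split=> //; [exact: shape_even|exact: shape_ae_continuous|split=> //].
  exact: (kappaI0_gt0 e1 t0 t2 hb hd hE hi).
(* A positive product means equal signs, so [k + i] cannot vanish either; SO(odd) needs the sum,
   SO(even) and Sp the first factor. *)
have nz (k i : R) : 0 < k * i -> k != 0 /\ k + i != 0.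
  move=> ki; split; first by apply: contraTneq ki => ->; rewrite mul0r ltxx.
  apply: contraTneq ki => /eqP; rewrite addr_eq0 => /eqP ->.
  by rewrite mulNr oppr_gt0 -leNgt -expr2 sqr_ge0.
case: G => /=.
- have [b ev ae ed [el i0 /nz[l0 _]]] := shapeP 1 (or_introl erefl).
  exists (kappa 1 (s / 2)), (kappa 1 (s / 2)), (shape 1 (s / 2)); split=> //.
  by split=> // x; rewrite even_shapeE even_lambdaE.
- exists 1, (1 + s / 2)^-1, (box (s / 2)); split.
  + exact: box_bcs.
  + exact: box_even.
  + exact: box_ae_continuous.
  + exact: box_edge.
  split; [by move=> x xs; rewrite mul0r addr0 /box xs| | |].
  + by rewrite int_box// mulf_neq0// gt_eqF.
  + by rewrite invr_neq0// gt_eqF//; lra.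
  + by move=> x; rewrite /box; case: ifP => _; rewrite ?mulr1 ?mulr0.
- have [b ev ae ed [el i0 /nz[_ l0]]] := shapeP (-1) (or_intror erefl).
  exists (kappa (-1) (s / 2)), (SO_odd_lambda (s / 2)), (shape (-1) (s / 2)); split=> //.
  by split=> //; [rewrite SO_odd_lambdaE|move=> x; rewrite odd_shapeE].
- have [b ev ae ed [el i0 /nz[l0 _]]] := shapeP (-1) (or_intror erefl).
  exists (kappa (-1) (s / 2)), (kappa (-1) (s / 2)), (shape (-1) (s / 2)); split=> //.
  by split=> // x; rewrite odd_shapeE Sp_lambdaE.
Qed.

End Rank.

Local Open Scope complex_scope.

(** Optimality among Schwartz functions is expressed by two clauses together: the lower bound on the
    larger class and its approach by Schwartz functions. Uniqueness can hold only up to a positive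
    factor, because the rank bound is invariant under scaling. *)
Theorem theorem1p1 (R : realType) (G : classical_group) (s sigma : R)
    (s_gt2 : 2 < s) (s_lt3 : s < 3) (sigmaE : sigma = s / 2) :
  (forall phi : R -> R, test_function sigma phi ->
     (integral_W G phi)%:C = integral_What G (fourier phi)) /\
  exists phi0 : R -> R,
    let g := fun x : R => (optimal_g G s x)%:C in
    [/\ test_function sigma phi0,
        (forall y, fourier phi0 y = convolution g (check g) y),
        (forall phi : R -> R, test_function sigma phi ->
           rank_bound G phi0 <= rank_bound G phi),
        (forall e : R, 0 < e ->
           exists phi : R -> R, [/\ schwartz phi, test_function sigma phi &
             rank_bound G phi < rank_bound G phi0 + e]) &
        (forall phi : R -> R, test_function sigma phi ->
           rank_bound G phi = rank_bound G phi0 ->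
           exists2 c : R, 0 < c & forall x, phi x = c * phi0 x)].
Proof.
rewrite {}sigmaE; have s0 : 0 < s / 2 by lra.
have s32 : s / 2 < 3 / 2 by lra.
have e1 := eta_sign_le1 R G.
split.
  by move=> phi ht; rewrite (integral_WhatE G ht) integral_WE//; exact: test_L1 ht.
have [k [lam [f0 [hf ef cf edge [EL I0 lam0 gE]]]]] := optimal_gE G s_gt2 s_lt3.
have mt := minimizer_test hf ef cf I0 lam0.
exists (sqF (fun x => lam * f0 x)) => g; split => //.
- move=> y; have -> : g = (fun x => (lam * f0 x)%:C).
    by apply/funext => x; rewrite /g gE.
  exact: minimizer_fourier hf ef cf y.
- move=> phi ht; rewrite (rank_boundE G mt) (rank_boundE G ht) lerD2l.
  exact: (minimizer_le e1 s0 s32 hf ef cf edge EL I0 lam0 ht).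
- move=> r r0.
  have [phi [sp ht hr]] := minimizer_approx e1 s0 s32 hf ef cf edge EL I0 lam0 r0.
  exists phi; split => //.
  by rewrite (rank_boundE G mt) (rank_boundE G ht) -addrA ltrD2l.
- move=> phi ht; rewrite (rank_boundE G mt) (rank_boundE G ht) => /addrI.
  exact: (minimizer_unique e1 s0 s32 hf ef cf edge EL I0 lam0 ht).
Qed.
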